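(* Let $Y$ be a rich solid QBF-space on $X$ with quasi-norm constant $C_Y$ and suppose that the analyzing frame $\mathcal F=\{\varphi_x\}_{x\in X}$ possesses property $D(\delta,\nu,Y)$ for the covering $\mathcal U=\{U_i\}_{i\in I}$ and a small enough $\delta>0$ such that $$\delta\big((1+C_Y)\,\big\|\,|R_{\mathcal F}|\,\big|\,\mathcal B_{Y,m_\nu}\big\|+\delta C_Y\big)C_Y\le 1 .$$ Then for any choice of points $x_i\in U_i$, the sampled frame $\mathcal F_d:=\{\varphi_i\}_{i\in I}:=\{\varphi_{x_i}\}_{i\in I}$ possesses a ''dual family'' $\widehat{\mathcal F_d}=\{\psi_i\}_{i\in I}\subset \mathcal H_1^\nu\cap \mathrm{Co}(Y)$ such that the following holds true: (i) (Analysis) An element $f\in(\mathcal H_1^\nu)^\urcorner$ belongs to $\mathrm{Co}(Y)$ if and only if $\{\langle f,\varphi_i\rangle\}_{i\in I}\in Y^\flat(\mathcal U)$ (or, equivalently, if and only if $\{\langle f,\psi_i\rangle\}_{i\in I}\in Y^\natural(\mathcal U)$), and we have the quasi-norm equivalences $$\|f|\mathrm{Co}(Y)\|\asymp\|\{\langle f,\varphi_i\rangle\}_{i\in I}|Y^\flat(\mathcal U)\|\quad\text{and}\quad \|f|\mathrm{Co}(Y)\|\asymp\|\{\langle f,\psi_i\rangle\}_{i\in I}|Y^\natural(\mathcal U)\| .$$ (ii) (Synthesis) For every sequence $\{\lambda_i\}_{i\in I}\in Y^\natural(\mathcal U)$ it holds $f=\sum_{i\in I}\lambda_i\varphi_i\in\mathrm{Co}(Y)$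 with $\|f|\mathrm{Co}(Y)\|\lesssim\|\{\lambda_i\}_{i\in I}|Y^\natural(\mathcal U)\|$. In general, the convergence of the sum is in the weak*-topology induced by $(\mathcal H_1^\nu)^\urcorner$. It is unconditional in the quasi-norm of $\mathrm{Co}(Y)$ if the finite sequences are dense in $Y^\natural(\mathcal U)$. Similarly, $f=\sum_{i\in I}\lambda_i\psi_i\in\mathrm{Co}(Y)$ with $\|f|\mathrm{Co}(Y)\|\lesssim\|\{\lambda_i\}_{i\in I}|Y^\flat(\mathcal U)\|$ in case $\{\lambda_i\}_{i\in I}\in Y^\flat(\mathcal U)$. (iii) (Reconstruction) For all $f\in\mathrm{Co}(Y)$ we have $f=\sum_{i\in I}\langle f,\psi_i\rangle\varphi_i$ and $f=\sum_{i\in I}\langle f,\varphi_i\rangle\psi_i$ (convergence as described in (ii)).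
   Context: Frame setting. $\mathcal H$ is a separable complex Hilbert space (inner product linear in the first argument); $X$ is a $\sigma$-compact locally compact Hausdorff space with a positive Radon measure $\mu$, $\operatorname{supp}\mu=X$. $\mathcal F=\{\varphi_x\}_{x\in X}\subset\mathcal H$ is a Parseval continuous frame: $x\mapsto\varphi_x$ is weakly measurable and $\|f|\mathcal H\|^2=\int_X|\langle f,\varphi_x\rangle|^2\,d\mu(x)$ for all $f\in\mathcal H$. Voice transform: $V_{\mathcal F}f(x)=\langle f,\varphi_x\rangle$. Frame kernel: $R_{\mathcal F}(x,y)=\langle\varphi_y,\varphi_x\rangle$. A measurable kernel $K:X\times X\to\mathbb C$ acts on functions by $K(F)(x)=\int_XK(x,y)F(y)\,d\mu(y)$. Weights. For a weight (measurable function) $\nu:X\to[1,\infty)$: $\|F|L_p^\nu\|=\|F\nu|L_p(X,\mu)\|$, $m_\nu(x,y)=\max\{\nu(x)/\nu(y),\nu(y)/\nu(x)\}$; $\mathcal A_1$ is the set of measurable $K$ with $\|K|\mathcal A_1\|=\max\{\operatorname{ess\,sup}_x\int|K(x,y)|d\mu(y),\operatorname{ess\,sup}_y\int|K(x,y)|d\mu(x)\}<\infty$; $\mathcal A_{m_\nu}=\{K:Km_\nu\in\mathcal A_1\}$, $\|K|\mathcal A_{m_\nu}\|=\|Km_\nu|\mathcal A_1\|$. $\mathcal H_1^\nu=\{f\in\mathcal H:V_{\mathcal F}f\in L_1^\nu(X)\}$ with norm $\|V_{\mathcal F}f|L_1^\nu\|$; $(\mathcal H_1^\nu)^\urcorner$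 is its normed anti-dual (bounded conjugate-linear functionals), with duality product $\langle\cdot,\cdot\rangle$ extending the inner product of $\mathcal H$, so $\mathcal H_1^\nu\hookrightarrow\mathcal H\hookrightarrow(\mathcal H_1^\nu)^\urcorner$. Frame condition: (a) $\|\varphi_x|\mathcal H\|\le C_B\nu(x)$ for some constant $C_B>0$ and all $x\in X$; (b) $R_{\mathcal F}\in\mathcal A_{m_\nu}$. Under it $\varphi_x\in\mathcal H_1^\nu$ for a.e. $x$; by convention one assumes $\mathcal F\subset\mathcal H_1^\nu$. The voice transform extends to $(\mathcal H_1^\nu)^\urcorner$ by $V_{\mathcal F}f(x)=\langle f,\varphi_x\rangle$. Function spaces. A QBF-space $Y$ on $X$ is a linear space of ($\mu$-a.e. equivalence classes of) measurable functions on $X$, complete under a quasi-norm $\|\cdot|Y\|$ with $\|f+g|Y\|\le C_Y(\|f|Y\|+\|g|Y\|)$. It is solid if $f$ measurable, $g\in Y$, $|f|\le|g|$ a.e. imply $f\in Y$ and $\|f|Y\|\le\|g|Y\|$; rich if $\chi_K\in Y$ for all compact $K\subset X$. $\mathcal B_{Y,m_\nu}$ is the set of $K\in\mathcal A_{m_\nu}$ that are bounded operators $Y\to Y$, with $\|K|\mathcal B_{Y,m_\nu}\|=\max\{\|K|\mathcal A_{m_\nu}\|,\|K|Y\to Y\|\}$. Property $F(\nu,Y)$: $\mathcal F$ satisfies the frame condition (a),(b), $R_{\mathcal F}:Y\to Y$ is continuous, and $R_{\mathcal F}(Y)\hookrightarrow L_\infty^{1/\nu}(X)$ continuously. In this case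 the coorbit is $\mathrm{Co}(Y)=\mathrm{Co}(\mathcal F,Y)=\{f\in(\mathcal H_1^\nu)^\urcorner:V_{\mathcal F}f\in Y\}$, $\|f|\mathrm{Co}(Y)\|=\|V_{\mathcal F}f|Y\|$. Coverings. A covering $\mathcal U=\{U_i\}_{i\in I}$ of $X$ is admissible if it is locally finite (each $x\in X$ has a neighborhood meeting only finitely many $U_i$), each $U_i$ is measurable, relatively compact, with non-void interior, and $\sigma(\mathcal U)=\sup_{i}\sharp\{j:U_i\cap U_j\ne\emptyset\}<\infty$. (Then $I$ is countable.) $Y^\flat(\mathcal U)$ and $Y^\natural(\mathcal U)$ are the spaces of complex sequences $\{\lambda_i\}_{i\in I}$ with finite quasi-norms $\|\sum_i|\lambda_i|\chi_{U_i}|Y\|$ and $\|\sum_i|\lambda_i|\mu(U_i)^{-1}\chi_{U_i}|Y\|$, respectively. $Q_y=\bigcup_{i:y\in U_i}U_i$. Property $D(\delta,\nu,Y)$ (for a weight $\nu\ge1$, $\delta>0$): $\mathcal F$ has property $F(\nu,Y)$ and there exist an admissible covering $\mathcal U$ and a phase function $\Gamma:X\times X\to\{z\in\mathbb C:|z|=1\}$ such that, with $\mathrm{osc}_{\mathcal U,\Gamma}(x,y)=\sup_{z\in Q_y}|R_{\mathcal F}(x,y)-\Gamma(y,z)R_{\mathcal F}(x,z)|$ and $\mathrm{osc}^*_{\mathcal U,\Gamma}(x,y)=\mathrm{osc}_{\mathcal U,\Gamma}(y,x)$, the kernels $|R_{\mathcal F}|,\mathrm{osc}_{\mathcal U,\Gamma},\mathrm{osc}^*_{\mathcal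 U,\Gamma}$ belong to $\mathcal B_{Y,m_\nu}$ and $\|\mathrm{osc}_{\mathcal U,\Gamma}|\mathcal B_{Y,m_\nu}\|<\delta$, $\|\mathrm{osc}^*_{\mathcal U,\Gamma}|\mathcal B_{Y,m_\nu}\|<\delta$. The covering in the claim is the one from this property. *)

(* Defs.v *)
From HB Require Import structures.
From mathcomp Require Import all_boot all_order all_algebra finmap.
From mathcomp Require Import sesquilinear complex.
From mathcomp Require Import all_classical all_reals all_analysis.
From mathcomp Require Import ess_sup_inf hoelder.
From mathcomp Require Export summability.

Set Implicit Arguments.
Unset Strict Implicit.
Unset Printing Implicit Defensive.

Import Order.TTheory GRing.Theory Num.Def Num.Theory.
Import numFieldNormedType.Exports.

Local Open Scope classical_set_scope.
Local Open Scope ring_scope.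

(* Norms over [R[i]] take values in [R[i]]; [rnorm] is the same number in [R]. *)
Definition rnorm (R : realType) (V : normedZmodType R[i]) (v : V) : R :=
  complex.Re `|v|.

Definition cmeasurable (R : realType) d (T : measurableType d) (f : T -> R[i]) :=
  measurable_fun [set: T] (fun x => complex.Re (f x)) /\
  measurable_fun [set: T] (fun x => complex.Im (f x)).

Section complex_integral.
Context (R : realType) d (T : measurableType d).
Variable mu : {measure set T -> \bar R}.

Definition cintegrable (f : T -> R[i]) :=
  cmeasurable f /\ mu.-integrable [set: T] (fun x => (rnorm (f x))%:E).

Definition cintegral (f : T -> R[i]) : R[i] :=
  Complex (Rintegral mu [set: T] (fun x => complex.Re (f x)))
          (Rintegral mu [set: T] (fun x => complex.Im (f x))).

End complex_integral.

Definition separable (T : topologicalType) :=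
  exists D : set T, countable D /\ dense D.

Definition sigma_compact (T : topologicalType) :=
  exists K : (set T)^nat, (forall n, compact (K n)) /\ \bigcup_n K n = [set: T].

(* [X] with its Borel sigma-algebra. *)
Notation borel X := (g_sigma_algebraType (@open X)).

Record radon_measure (X : ptopologicalType) (R : realType)
    (mu : {measure set (borel X) -> \bar R}) : Prop := RadonMeasure {
  radon_compact : forall K : set X, compact K -> (mu K < +oo)%E ;
  radon_outer : forall A : set (borel X), measurable A ->
    mu A = ereal_inf [set mu O | O in [set O : set X | open O /\ A `<=` O]] ;
  radon_inner : forall O : set X, open O ->
    mu O = ereal_sup [set mu K | K in [set K : set X | compact K /\ K `<=` O]]
}.

Definition full_support (X : ptopologicalType) (R : realType)
    (mu : {measure set (borel X) -> \bar R}) :=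
  forall O : set X, open O -> O !=set0 -> (0 < mu O)%E.

Section coorbit.
Context (R : realType) (X : ptopologicalType).
Variable mu : {measure set (borel X) -> \bar R}.
Local Notation C := R[i].
Local Notation BX := (borel X).
Implicit Types (F G : BX -> C) (K : BX -> BX -> C).

(* Kernels are measurable for the product of the Borel sigma-algebras. *)
Definition kmeasurable K := cmeasurable (fun p : BX * BX => K p.1 p.2).

Definition kapply K F : BX -> C := fun x => cintegral mu (fun y => K x y * F y).

Definition weight (nu : BX -> R) :=
  measurable_fun [set: BX] nu /\ forall x, 1 <= nu x.

Section weighted.
Variable nu : BX -> R.

Definition Lpw_norm (p : \bar R) F : \bar R :=
  Lnorm mu p (fun x => (rnorm (F x) * nu x)%:E).

Definition Lpw (p : \bar R) : set (BX -> C) :=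
  [set F | cmeasurable F /\ (Lpw_norm p F < +oo)%E].

Definition mweight (x y : BX) : R := Num.max (nu x / nu y) (nu y / nu x).

End weighted.

Definition A1_norm K : \bar R :=
  maxe (ess_sup mu (fun x : BX => \int[mu]_y (rnorm (K x y))%:E)%E)
       (ess_sup mu (fun y : BX => \int[mu]_x (rnorm (K x y))%:E)%E).

Definition A1 : set (BX -> BX -> C) :=
  [set K | kmeasurable K /\ (A1_norm K < +oo)%E].

Definition kweighted (nu : BX -> R) K : BX -> BX -> C :=
  fun x y => K x y * (mweight nu x y)%:C%C.

Definition Am (nu : BX -> R) : set (BX -> BX -> C) :=
  [set K | A1 (kweighted nu K)].

Definition Am_norm (nu : BX -> R) K : \bar R := A1_norm (kweighted nu K).

(* A space of a.e. classes is represented by the set [Y] of all its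
   representatives, closed under a.e. equality; the values of [q] outside [Y]
   are irrelevant. *)
Record qbf_space (Y : set (BX -> C)) (q : (BX -> C) -> R) (CY : R) : Prop :=
  QBFSpace {
  qbf_measurable : forall F, Y F -> cmeasurable F ;
  qbf_ae : forall F G, Y F -> cmeasurable G ->
    (\forall x \ae mu, F x = G x) -> Y G /\ q G = q F ;
  qbf_0 : Y (fun=> 0) ;
  qbf_D : forall F G, Y F -> Y G -> Y (fun x => F x + G x) ;
  qbf_Z : forall (a : C) F, Y F -> Y (fun x => a * F x) ;
  qbf_ge0 : forall F, Y F -> 0 <= q F ;
  qbf_eq0 : forall F, Y F -> q F = 0 -> \forall x \ae mu, F x = 0 ;
  qbf_homog : forall (a : C) F, Y F -> q (fun x => a * F x) = rnorm a * q F ;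
  qbf_triangle : forall F G, Y F -> Y G ->
    q (fun x => F x + G x) <= CY * (q F + q G) ;
  qbf_complete : forall u : nat -> BX -> C, (forall n, Y (u n)) ->
    (forall e : R, 0 < e -> exists N, forall m n, (N <= m)%N -> (N <= n)%N ->
       q (fun x => u m x - u n x) < e) ->
    exists2 F, Y F & q (fun x => u n x - F x) @[n --> \oo] --> (0 : R)
}.

Section spaces.
Variables (Y : set (BX -> C)) (q : (BX -> C) -> R).

Definition solid := forall F G, cmeasurable F -> Y G ->
  (\forall x \ae mu, rnorm (F x) <= rnorm (G x)) -> Y F /\ q F <= q G.

Definition rich := forall A : set X, compact A -> Y (\1_A : BX -> C).

(* [q] extended by [+oo] outside [Y]. *)
Definition Ynorm F : \bar R := if `[< Y F >] then (q F)%:E else +oo%E.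

Definition op_norm K : \bar R :=
  ereal_sup [set Ynorm (kapply K F) | F in [set F | Y F /\ q F <= 1]].

Definition bounded_on K :=
  [/\ forall F, Y F -> \forall x \ae mu, cintegrable mu (fun y => K x y * F y),
      forall F, Y F -> Y (kapply K F)
    & (op_norm K < +oo)%E].

Definition BYm (nu : BX -> R) : set (BX -> BX -> C) :=
  [set K | Am nu K /\ bounded_on K].

Definition BYm_norm (nu : BX -> R) K : \bar R := maxe (Am_norm nu K) (op_norm K).

Section sequence_spaces.
Context (I : choiceType) (U : I -> set X).

(* The sums below have finite support at every point when [U] is locally
   finite. *)
Definition flat_fun (lam : I -> C) : BX -> C :=
  fun x => \sum_(i \in [set: I]) (`|lam i| * \1_(U i) x).

Definition natural_fun (lam : I -> C) : BX -> C := fun x =>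
  \sum_(i \in [set: I])
     (`|lam i| * (fine (mu (U i : set BX)))%:C%C^-1 * \1_(U i) x).

Definition flat_norm (lam : I -> C) : \bar R := Ynorm (flat_fun lam).

Definition natural_norm (lam : I -> C) : \bar R := Ynorm (natural_fun lam).

Definition Yflat : set (I -> C) := [set lam | (flat_norm lam < +oo)%E].

Definition Ynatural : set (I -> C) := [set lam | (natural_norm lam < +oo)%E].

Definition finite_sequence (lam : I -> C) := finite_set [set i | lam i != 0].

Definition finite_dense (N : (I -> C) -> \bar R) :=
  forall lam, (N lam < +oo)%E -> forall e : R, 0 < e ->
  exists2 lam', finite_sequence lam' & (N (fun i => lam i - lam' i)%R < e%:E)%E.

Record admissible_covering : Prop := AdmissibleCovering {
  adm_cover : \bigcup_i U i = [set: X] ;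
  adm_locally_finite : forall x : X, exists2 V, nbhs x V &
    finite_set [set i | V `&` U i !=set0] ;
  adm_measurable : forall i, measurable (U i : set BX) ;
  adm_relatively_compact : forall i, compact (closure (U i)) ;
  adm_interior : forall i, (U i)° !=set0 ;
  adm_overlap : exists N : nat, forall i,
    ([set j | U i `&` U j !=set0] #<= `I_N)%card
}.

End sequence_spaces.

Section frame.
Context (H : completeNormedModType R[i]) (dot : {dot H for conjC}).
Variable phi : BX -> H.

Definition parseval_frame :=
  (forall f : H, cmeasurable (fun x => dot f (phi x))) /\
  (forall f : H, ((rnorm f ^+ 2)%:E =
                  \int[mu]_x (rnorm (dot f (phi x)) ^+ 2)%:E)%E).

Definition frame_kernel : BX -> BX -> C := fun x y => dot (phi y) (phi x).

(* Functionals on (a subspace of) [H] are functions [H -> C]; a vector [h] acts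
   as the functional [emb h]. *)
Definition emb (h : H) : H -> C := fun g => dot h g.

Definition voice (f : H -> C) : BX -> C := fun x => f (phi x).

Section with_weight.
Variable nu : BX -> R.

Definition H1 : set H := [set h | Lpw nu 1%E (voice (emb h))].

Definition H1_norm (h : H) : \bar R := Lpw_norm nu 1%E (voice (emb h)).

(* Only the values on [H1] of an element of the anti-dual are meaningful. *)
Definition antidual : set (H -> C) := [set f |
  (forall (a : C) (g h : H), H1 g -> H1 h ->
     f (a *: g + h) = conjC a * f g + f h) /\
  (exists M : R, forall h, H1 h -> ((rnorm (f h))%:E <= M%:E * H1_norm h)%E)].

Record frame_condition : Prop := FrameCondition {
  frame_bound : exists2 CB : R, 0 < CB & forall x, rnorm (phi x) <= CB * nu x ;
  frame_kernel_Am : Am nu frame_kernel ;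
  frame_sub_H1 : forall x, H1 (phi x)
}.

Record property_F : Prop := PropertyF {
  F_frame : frame_condition ;
  F_bounded : bounded_on frame_kernel ;
  F_embedding :
    let RY := [set kapply frame_kernel F | F in Y] in
    (forall G, RY G -> Lpw (fun x => (nu x)^-1) +oo%E G) /\
    (exists M : R, forall G, RY G ->
       (Lpw_norm (fun x => (nu x)^-1)%R +oo%E G <= M%:E * Ynorm G)%E)
}.

Definition Co : set (H -> C) := [set f | antidual f /\ Y (voice f)].

Definition Co_norm (f : H -> C) : \bar R := Ynorm (voice f).

Section discretization.
Context (I : choiceType) (U : I -> set X).

Definition Qset (y : X) : set X := \bigcup_(i in [set i | U i y]) U i.

Definition phase_function (Gam : X -> X -> C) := forall x y, `|Gam x y| = 1.

Definition osc (Gam : X -> X -> C) (x y : BX) : \bar R :=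
  ereal_sup [set (rnorm (frame_kernel x y - Gam y z * frame_kernel x z))%:E
            | z in Qset y].

(* [osc] as a complex kernel; used where [osc] is a.e. finite. *)
Definition osc_kernel (Gam : X -> X -> C) : BX -> BX -> C :=
  fun x y => (fine (osc Gam x y))%:C%C.

Definition osc_kernel_star (Gam : X -> X -> C) : BX -> BX -> C :=
  fun x y => osc_kernel Gam y x.

Definition abs_frame_kernel : BX -> BX -> C := fun x y => `|frame_kernel x y|.

(* [property_D delta U] is property [D] witnessed by the covering [U]. *)
Record property_D (delta : R) : Prop := PropertyD {
  D_F : property_F ;
  D_admissible : admissible_covering U ;
  D_abs : BYm nu abs_frame_kernel ;
  D_osc : exists Gam : X -> X -> C, [/\ phase_function Gam,
    \forall p \ae (mu \x mu)%E, osc Gam p.1 p.2 \is a fin_num,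
    BYm nu (osc_kernel Gam), BYm nu (osc_kernel_star Gam)
    & (BYm_norm nu (osc_kernel Gam) < delta%:E)%E /\
      (BYm_norm nu (osc_kernel_star Gam) < delta%:E)%E]
}.

(* The index set carries no order: sums over it are limits along the net of
   finite subsets. *)
Definition weak_star_sum (lam : I -> C) (xi : I -> H) (f : H -> C) :=
  forall h, H1 h ->
  (fun J : {fset I} => rnorm (f h - \sum_(i <- J) lam i * dot (xi i) h))
    @ totally --> (0 : R).

Definition Co_sum (lam : I -> C) (xi : I -> H) (f : H -> C) :=
  (fun J : {fset I} =>
     Co_norm (fun h => f h - \sum_(i <- J) lam i * dot (xi i) h))
    @ totally --> (0 : \bar R).

(* [N] is the quasi-norm of the sequence space of the coefficients. *)
Definition sum_converges (N : (I -> C) -> \bar R)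
    (lam : I -> C) (xi : I -> H) (f : H -> C) :=
  weak_star_sum lam xi f /\ (finite_dense N -> Co_sum lam xi f).

End discretization.
End with_weight.
End frame.
End spaces.
End coorbit.

Definition norm_equiv (R : realType) (T : Type) (A : set T) (N N' : T -> \bar R) :=
  exists c d : R, [/\ 0 < c, 0 < d & forall t, A t ->
    (c%:E * N' t <= N t)%E /\ (N t <= d%:E * N' t)%E].

(* Main.v *)
Require Import Defs.
From HB Require Import structures.
From mathcomp Require Import all_boot all_order all_algebra finmap.
From mathcomp Require Import sesquilinear complex.
From mathcomp Require Import all_classical all_reals all_analysis.
From mathcomp Require Import measurable_realfun ess_sup_inf hoelder ring lra.

Set Implicit Arguments.
Unset Strict Implicit.
Unset Printing Implicit Defensive.

Import Order.TTheory GRing.Theory Num.Def Num.Theory.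
Import numFieldNormedType.Exports.

Local Open Scope classical_set_scope.
Local Open Scope ring_scope.

(** Choosing measurably, for every [z], a covering set that contains it cuts [X]
    into disjoint cells of measure [c_i <= mu (U_i)], and the Riemann sum
    [S h = sum_i c_i <h, phi_i> phi_i] discretizes the reproducing formula
    [h = int <h, phi_z> phi_z dmu(z)].  With [T = 1 - S], the numbers
    [<T phi_x, phi_y>] are for almost all [x], [y] bounded by the kernel
    [|R| osc' + osc (|R| + osc')], where [osc' (x, y) = osc (y, x)]
    ([Top_kernel]).  Schur's test turns this into
    [|T| <= rho1] on [H_1^nu], and boundedness of the three kernels on [Y], with
    two uses of the quasi-triangle inequality, into the factor [rhoY] on [Y].  The
    condition on [delta] gives [rhoY < 1], and [rho1 <= rhoY]
    ([contraction_constants]).  Hence [S] is inverted on [H_1^nu] by a Neumann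
    series, and the dual family is [psi_i = c_i S^-1 phi_i].  Since [S] is
    symmetric, [h = sum_i <h, psi_i> phi_i] holds absolutely in [H_1^nu], and
    applying an anti-dual functional to this expansion, or to the one that defines
    [S], gives both reconstruction formulas ([antidual_sum_dual],
    [antidual_sum_sample]).

    Vector-valued integrals do not occur.  The bound
    [|<g, h>| <= int |Vg| |Vh|] and its analogue for [<T g, h>] follow by
    polarization from Parseval's identity for the norms ([dot_le_integral],
    [Sop_error]); the reconstruction formulas extend the first one to
    [|f(h)| <= int |Vf| |Vh|] for every anti-dual [f] ([antidual_represented]).

    On [Y], the voice transform of [f o T] is dominated by the above kernel applied
    to that of [f], so the Neumann series for [f o S^-1] is dominated by a geometric
    series in [Y], and composing with [S^-1] preserves the coorbit ([Sinv_dom]).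
    This reduces everything about [psi_i] to [phi_i].  There, the oscillation
    gives [|f(phi_i)| <= |Vf(z)| + (osc' |Vf|)(z)] for [z] in [U_i], which yields
    the analysis bounds, and [|R(x, x_i)| <= (|R| + osc)(x, z)] for such [z];
    averaging the latter over [U_i] bounds [sum_i |lambda_i| |R(x, x_i)|] by
    [|R| + osc] applied to the step function with values
    [|lambda_i| / mu (U_i)] ([sample_le_integral]), which yields the synthesis
    bounds.  That the synthesized series defines an anti-dual functional needs
    [int |F| |Vh| <= C q(F) N1(h)] for [F] in [Y], where [N1] is the norm of
    [H_1^nu]; this comes from the embedding of [R(Y)] into [L_oo^(1/nu)] by Fubini's
    theorem ([pairing]).  Convergence in the
    coorbit follows because, off the support of a finite sequence [lambda'] close to
    [lambda], the coefficients [lambda] coincide with those of [lambda - lambda']. *)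

(** * Real-valued norms of complex numbers *)

Section complex_norm.
Variable R : realType.
Implicit Types (V : normedZmodType R[i]) (z w : R[i]).

Lemma rnormE V (v : V) : `|v| = (rnorm v)%:C%C.
Proof. by rewrite /rnorm RRe_real// ger0_real. Qed.

Lemma rnorm_ge0 V (v : V) : 0 <= rnorm v.
Proof. by rewrite -ler0c -rnormE. Qed.

Lemma rnorm_eq0 V (v : V) : (rnorm v == 0) = (v == 0).
Proof. by rewrite -[RHS]normr_eq0 rnormE -(inj_eq (@complexI R)). Qed.

Lemma rnorm0 V : rnorm (0 : V) = 0.
Proof. by apply/eqP; rewrite rnorm_eq0. Qed.

Lemma rnormN V (v : V) : rnorm (- v) = rnorm v.
Proof. by rewrite /rnorm normrN. Qed.

Lemma rdistC V (u v : V) : rnorm (u - v) = rnorm (v - u).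
Proof. by rewrite /rnorm distrC. Qed.

Lemma rnormD V (u v : V) : rnorm (u + v) <= rnorm u + rnorm v.
Proof. by rewrite -lecR rmorphD/= -!rnormE ler_normD. Qed.

Lemma rnormB V (u v : V) : rnorm (u - v) <= rnorm u + rnorm v.
Proof. by rewrite -(rnormN v) rnormD. Qed.

Lemma rnorm_le_dist V (u v : V) : rnorm u <= rnorm (u - v) + rnorm v.
Proof. by rewrite -{1}(subrK v u) rnormD. Qed.

Lemma rnorm_sum V (J : Type) (s : seq J) (F : J -> V) :
  rnorm (\sum_(i <- s) F i) <= \sum_(i <- s) rnorm (F i).
Proof.
elim: s => [|a s IH]; first by rewrite !big_nil rnorm0.
by rewrite !big_cons (le_trans (rnormD _ _))// lerD2l.
Qed.

Lemma rnormM z w : rnorm (z * w) = rnorm z * rnorm w.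
Proof. by apply: (@complexI R); rewrite rmorphM/= -!rnormE normrM. Qed.

Lemma rnormZ (V : normedModType R[i]) z (v : V) :
  rnorm (z *: v) = rnorm z * rnorm v.
Proof. by apply: (@complexI R); rewrite rmorphM/= -!rnormE normrZ. Qed.

Lemma rnormJ z : rnorm (z^*)%C = rnorm z.
Proof. by rewrite /rnorm normcJ. Qed.

Lemma rnorm_real (r : R) : rnorm (r%:C%C) = `|r|.
Proof. by rewrite /rnorm normc_def/= expr0n/= addr0 sqrtr_sqr. Qed.

Lemma rnorm1 : rnorm (1 : R[i]) = 1.
Proof. by rewrite /rnorm normr1. Qed.

Lemma ler_Re_rnorm z : complex.Re z <= rnorm z.
Proof.
apply: le_trans (ler_norm _) _.
by have := normc_ge_Re z; rewrite rnormE lecR.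
Qed.

Lemma sqr_rnorm z : rnorm z ^+ 2 = complex.Re z ^+ 2 + complex.Im z ^+ 2.
Proof.
by apply: (@complexI R); rewrite add_Re2_Im2 rmorphXn/= -rnormE.
Qed.

Lemma ler_absRe z : `|complex.Re z| <= rnorm z.
Proof. by have := normc_ge_Re z; rewrite rnormE lecR. Qed.

Lemma ler_absIm z : `|complex.Im z| <= rnorm z.
Proof.
rewrite -(@ler_pXn2r _ 2) ?nnegrE ?rnorm_ge0//.
by rewrite sqr_rnorm real_normK ?num_real// lerDr sqr_ge0.
Qed.

Lemma rnorm_Re_Im z : rnorm z = Num.sqrt (complex.Re z ^+ 2 + complex.Im z ^+ 2).
Proof. by rewrite -sqr_rnorm sqrtr_sqr ger0_norm// rnorm_ge0. Qed.

Lemma cReD z w : complex.Re (z + w) = complex.Re z + complex.Re w.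
Proof. by case: z; case: w. Qed.

Lemma cImD z w : complex.Im (z + w) = complex.Im z + complex.Im w.
Proof. by case: z; case: w. Qed.

Lemma cReN z : complex.Re (- z) = - complex.Re z.
Proof. by case: z. Qed.

Lemma cImN z : complex.Im (- z) = - complex.Im z.
Proof. by case: z. Qed.

Lemma cReB z w : complex.Re (z - w) = complex.Re z - complex.Re w.
Proof. by rewrite cReD cReN. Qed.

Lemma cReM z w : complex.Re (z * w) =
  complex.Re z * complex.Re w - complex.Im z * complex.Im w.
Proof. by case: z; case: w. Qed.

Lemma cImM z w : complex.Im (z * w) =
  complex.Re z * complex.Im w + complex.Im z * complex.Re w.
Proof. by case: z; case: w. Qed.

Lemma Re_conj z : complex.Re z^*%C = complex.Re z.
Proof. by case: z. Qed.

Lemma Im_conj z : complex.Im z^*%C = - complex.Im z.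
Proof. by case: z. Qed.

Lemma conjcM z w : (z * w)^*%C = z^*%C * w^*%C.
Proof. exact: rmorphM. Qed.

Lemma conjcB z w : (z - w)^*%C = z^*%C - w^*%C.
Proof. exact: rmorphB. Qed.

Lemma conjcN z : (- z)^*%C = - z^*%C.
Proof. exact: rmorphN. Qed.

Lemma cReZ (r : R) z : complex.Re (r%:C%C * z) = r * complex.Re z.
Proof. by rewrite cReM/= mul0r subr0. Qed.

Lemma exists_phase z : exists2 u : R[i], rnorm u = 1 & u * z = (rnorm z)%:C%C.
Proof.
have [->|z0] := eqVneq z 0; first by exists 1; rewrite ?rnorm1 ?mulr0 ?rnorm0.
have nz : (rnorm z)%:C%C != 0 :> R[i].
  by rewrite -rnormE normr_eq0.
exists ((rnorm z)%:C%C / z); last by rewrite mulfVK.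
apply: (@complexI R).
by rewrite -rnormE -rnormE normrM normfV normr_id divff// normr_eq0.
Qed.

End complex_norm.

(** * Inner products *)

Section hilbert.
Variables (R : realType) (H : completeNormedModType R[i]).
Variable dot : {dot H for conjC}.
Hypothesis dot_norm : forall h : H, `|h| ^+ 2 = dot h h.
Implicit Types (u v w : H) (a : R[i]).

Lemma dotDl u v w : dot (u + v) w = dot u w + dot v w.
Proof. exact: linearDl. Qed.
Lemma dotBl u v w : dot (u - v) w = dot u w - dot v w.
Proof. exact: linearBl. Qed.
Lemma dotZl a u w : dot (a *: u) w = a * dot u w.
Proof. exact: linearZl_LR. Qed.
Lemma dotDr u v w : dot u (v + w) = dot u v + dot u w.
Proof. exact: linearDr. Qed.
Lemma dotBr u v w : dot u (v - w) = dot u v - dot u w.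
Proof. exact: linearBr. Qed.
Lemma dotZr a u w : dot u (a *: w) = (a^*)%C * dot u w.
Proof. exact: linearZr_LR. Qed.
Lemma dotC u v : dot u v = (dot v u)^*%C.
Proof. by rewrite hermC expr0 mul1r. Qed.
Lemma dot0l w : dot 0 w = 0. Proof. exact: linear0l. Qed.
Lemma dot0r w : dot w 0 = 0. Proof. exact: linear0r. Qed.
Lemma dot_suml (J : Type) (s : seq J) (F : J -> H) w :
  dot (\sum_(i <- s) F i) w = \sum_(i <- s) dot (F i) w.
Proof. exact: linear_sumlz. Qed.

Lemma rnorm_dotC u v : rnorm (dot u v) = rnorm (dot v u).
Proof. by rewrite dotC rnormJ. Qed.

Lemma Re_dotC u v : complex.Re (dot u v) = complex.Re (dot v u).
Proof. by rewrite dotC; case: (dot v u). Qed.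

Lemma dot_self u : complex.Re (dot u u) = rnorm u ^+ 2.
Proof. by rewrite -dot_norm rnormE -rmorphXn. Qed.

Lemma sqr_rnormD u v :
  rnorm (u + v) ^+ 2 = rnorm u ^+ 2 + rnorm v ^+ 2 + 2 * complex.Re (dot u v).
Proof.
by rewrite -!dot_self dotDl !dotDr !cReD (Re_dotC v u); ring.
Qed.

Lemma sqr_rnormB u v :
  rnorm (u - v) ^+ 2 = rnorm u ^+ 2 + rnorm v ^+ 2 - 2 * complex.Re (dot u v).
Proof.
by rewrite -!dot_self dotBl !dotBr !cReB (Re_dotC v u); ring.
Qed.

(** The quadratic polynomial [t |-> |u - t c v|^2], [c] a phase, is nonnegative. *)
Lemma CS u v : rnorm (dot u v) <= rnorm u * rnorm v.
Proof.
have [a a1 auv] := exists_phase (dot u v).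
have key t : 0 <= rnorm u ^+ 2 + t ^+ 2 * rnorm v ^+ 2 - 2 * t * rnorm (dot u v).
  have := sqr_ge0 (rnorm (a *: u - t%:C%C *: v)).
  rewrite sqr_rnormB !rnormZ a1 mul1r rnorm_real exprMn -normrX.
  rewrite (ger0_norm (sqr_ge0 t)) dotZl dotZr conjc_real.
  rewrite [a * _]mulrCA auv -rmorphM/=.
  by rewrite [2 * (t * _)]mulrA.
have [->|v0] := eqVneq v 0; first by rewrite dot0r !rnorm0 mulr0.
have nv : 0 < rnorm v by rewrite lt_neqAle rnorm_ge0 eq_sym rnorm_eq0 v0.
have [->|u0] := eqVneq u 0; first by rewrite dot0l !rnorm0 mul0r.
have nu : 0 < rnorm u by rewrite lt_neqAle rnorm_ge0 eq_sym rnorm_eq0 u0.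
have t0 : 0 < 2 * (rnorm u / rnorm v) by rewrite mulr_gt0// divr_gt0.
rewrite -subr_ge0 -(pmulr_rge0 _ t0).
apply: (le_trans (key (rnorm u / rnorm v))); rewrite le_eqVlt; apply/orP; left.
by apply/eqP; field; rewrite gt_eqF.
Qed.

End hilbert.

(** * Sums of nonnegative families *)

Section esum_extra.
Context (R : realType) (I : choiceType).
Implicit Types (a b : I -> \bar R) (J : {fset I}).
Local Open Scope ereal_scope.

Lemma esum_split a J : (forall i, 0 <= a i) ->
  \esum_(i in [set: I]) a i =
  \sum_(i <- J) a i + \esum_(i in ~` [set` J]) a i.
Proof.
move=> a0; rewrite (esumID [set` J])// !setTI esum_fset//.
by rewrite fsbig_finite//= set_fsetK.
Qed.

Lemma esum_tail_small a (e : R) : (forall i, 0 <= a i) ->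
  \esum_(i in [set: I]) a i < +oo -> (0 < e)%R ->
  exists J0, forall J, (J0 `<=` J)%fset ->
    \esum_(i in ~` [set` J]) a i <= e%:E.
Proof.
move=> a0 afin e0.
have afn : \esum_(i in [set: I]) a i \is a fin_num.
  by rewrite ge0_fin_numE ?esum_ge0.
have [_ [A [finA _] <-] lA] := ub_ereal_sup_adherent e0 afn.
exists (fset_set A) => J AJ.
have : \esum_(i in [set: I]) a i - e%:E <= \sum_(i <- J) a i.
  apply: (le_trans (ltW lA)); rewrite fsbig_finite//=.
  by apply: lee_sum_nneg_subfset => //; exact/fsubsetP.
have Jfin : \sum_(i <- J) a i \is a fin_num.
  rewrite ge0_fin_numE ?sume_ge0//; apply: le_lt_trans afin.
  by rewrite (esum_split J a0) leeDl// esum_ge0.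
have tfin : \esum_(i in ~` [set` J]) a i \is a fin_num.
  rewrite ge0_fin_numE ?esum_ge0//; apply: le_lt_trans afin.
  by rewrite (esum_split J a0) leeDr// sume_ge0.
by rewrite (esum_split J a0) leeBlDr// leeD2lE.
Qed.

Lemma le_esum_set a (A B : set I) : (forall i, 0 <= a i) -> A `<=` B ->
  \esum_(i in A) a i <= \esum_(i in B) a i.
Proof.
move=> a0 AB; rewrite (esumID A B)//.
have -> : B `&` A = A by rewrite setIidr.
by rewrite leeDl// esum_ge0.
Qed.

Lemma esum_ge_fset a J : (forall i, 0 <= a i) ->
  \sum_(i <- J) a i <= \esum_(i in [set: I]) a i.
Proof. by move=> a0; rewrite (esum_split J a0) leeDl// esum_ge0. Qed.

Lemma esum_ge1 a i : (forall i, 0 <= a i) -> a i <= \esum_(i in [set: I]) a i.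
Proof.
by move=> a0; have := esum_ge_fset [fset i]%fset a0; rewrite big_seq_fset1.
Qed.

Lemma esum_le_bound a (A : set I) (M : \bar R) : (forall i, 0 <= a i) ->
  (forall J : {fset I}, [set` J] `<=` A -> \sum_(i <- J) a i <= M) ->
  \esum_(i in A) a i <= M.
Proof.
move=> a0 H; apply: ge_ereal_sup => _ [F [finF FA] <-].
by rewrite fsbig_finite//; apply: H; rewrite fset_setK.
Qed.

Lemma ge0_esumZl a (A : set I) (c : R) : (forall i, 0 <= a i) -> (0 <= c)%R ->
  \esum_(i in A) (c%:E * a i) = c%:E * \esum_(i in A) a i.
Proof.
move=> a0 c0.
have le (b : I -> \bar R) (t : R) : (forall i, 0 <= b i) -> (0 <= t)%R ->
    \esum_(i in A) (t%:E * b i) <= t%:E * \esum_(i in A) b i.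
  move=> b0 t0; apply: esum_le_bound => [i|J JA]; first by rewrite mule_ge0.
  rewrite -ge0_sume_distrr//; apply: lee_wpmul2l; first by rewrite lee_fin.
  apply: ereal_sup_ubound; exists [set` J] => //.
  by rewrite fsbig_finite//= set_fsetK.
apply/eqP; rewrite eq_le le//=.
have [<-|c0'] := eqVneq 0%R c.
  by rewrite mul0e esum_ge0// => i _; rewrite mul0e.
have {}c0 : (0 < c)%R by rewrite lt_neqAle c0' c0.
rewrite -lee_pdivlMl//.
rewrite [X in X <= _](_ : _ = \esum_(i in A) ((c^-1)%:E * (c%:E * a i))); last first.
  by apply: eq_esum => i _; rewrite muleA -EFinM mulVf ?mul1e// gt_eqF.
by rewrite le// ?invr_ge0 ?ltW// => i; rewrite mule_ge0// lee_fin ltW.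
Qed.

End esum_extra.

Lemma seq_bounded (T : eqType) (s : seq T) (g : T -> nat) :
  exists N, forall k, k \in s -> (g k < N)%N.
Proof.
elim: s => [|x s [N HN]]; first by exists 0%N.
exists (maxn (g x).+1 N) => k; rewrite inE => /orP[/eqP ->|/HN lt].
  exact: leq_maxl.
exact: leq_trans lt (leq_maxr _ _).
Qed.

Lemma esum_geometric (R : realType) (t : R) : 0 <= t -> t < 1 ->
  (\esum_(n in [set: nat]) (t ^+ n)%:E <= ((1 - t)^-1)%:E)%E.
Proof.
move=> t0 t1; have t1' : 0 < 1 - t by rewrite subr_gt0.
apply: esum_le_bound => [n|K _]; first by rewrite lee_fin exprn_ge0.
have [m Hm] := seq_bounded (enum_fset K) id.
apply: (@le_trans _ _ (\sum_(0 <= n < m) (t ^+ n)%:E)%E).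
  apply: (@lee_sum_fset_nat _ (fun n => (t ^+ n)%:E) K m xpredT) => [n _|k /= kK].
    by rewrite lee_fin exprn_ge0.
  exact: Hm.
rewrite sumEFin lee_fin -[leRHS]mul1r ler_pdivlMr// mulrC big_mkord.
rewrite -opprB mulNr -subrX1 opprB lerBlDr lerDl.
exact: exprn_ge0.
Qed.

Section countable_esum.
Context d (T : measurableType d) (R : realType) (mu : {measure set T -> \bar R}).
Context (I : choiceType).
Hypothesis cI : countable [set: I].
Variable f : I -> T -> \bar R.
Hypothesis f0 : forall i x, (0 <= f i x)%E.
Hypothesis mf : forall i, measurable_fun [set: T] (f i).
Local Open Scope ereal_scope.

Let slice (D : set I) (code : I -> nat) (g : I -> \bar R) (n : nat) : \bar R :=
  \esum_(i in D `&` [set i | code i = n]) g i.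

Let esum_slice (D : set I) code (g : I -> \bar R) : (forall i, 0 <= g i) ->
  \esum_(i in D) g i = \sum_(n <oo) slice D code g n.
Proof.
move=> g0; rewrite -nneseries_sum_bigcup//.
  congr esum; apply/seteqP; split => [i Di|i [n _ []]//].
  by exists (code i).
by move=> m n _ _ [i [[_ <-] [_ <-]]].
Qed.

Let sliceE (D : set I) code (code_inj : injective code) n :
  (exists2 i, D i & forall g : I -> \bar R, 0 <= g i -> slice D code g n = g i) \/
  (forall g : I -> \bar R, slice D code g n = 0).
Proof.
have [[i [Di <-]]|H] := pselect (exists i, D i /\ code i = n); [left|right].
  exists i => // g g0; rewrite /slice -[RHS]esum_set1//; congr esum.
  by apply/seteqP; split => j /= => [[_ /code_inj]|->].
by move=> g; rewrite /slice esum1// => i Hi; exfalso; apply: H; exists i.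
Qed.

Let measurable_slice D code (code_inj : injective code) n :
  measurable_fun [set: T] (fun x => slice D code (f^~ x) n).
Proof.
have [[i _ H]|H] := sliceE D code_inj n.
  rewrite (_ : (fun x => _) = f i)//.
  by apply/funext => x; apply: H.
rewrite (_ : (fun x => _) = cst 0)//.
by apply/funext => x; exact: H.
Qed.

Let exists_code : exists code : I -> nat, injective code.
Proof.
move/countable_injP: cI => [c ci]; exists c => x y exy.
by apply: ci => //; rewrite in_setT.
Qed.

(** An injective code makes the family a series over [nat], at most one index being
    coded by each number. *)
Lemma measurable_esum (D : set I) :
  measurable_fun [set: T] (fun x => \esum_(i in D) f i x).
Proof.
have [code code_inj] := exists_code.
rewrite (_ : (fun x => _) = fun x => \sum_(n <oo) slice D code (f^~ x) n).
  apply: ge0_emeasurable_sum => n //.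
    by move=> x _ _; exact: esum_ge0.
  by move=> _; exact: measurable_slice.
by apply/funext => x; exact: esum_slice.
Qed.

Lemma integral_esum (D : set I) :
  \int[mu]_x (\esum_(i in D) f i x) = \esum_(i in D) (\int[mu]_x f i x).
Proof.
have [code code_inj] := exists_code.
rewrite (eq_integral (fun x => \sum_(n <oo) slice D code (f^~ x) n)); last first.
  by move=> x _; exact: esum_slice.
rewrite (esum_slice D code) => [|i]; last exact: integral_ge0.
rewrite integral_nneseries//; last 2 first.
- by move=> n; exact: measurable_slice.
- by move=> n x _; exact: esum_ge0.
apply: eq_eseriesr => n _.
have [[i _ H]|H] := sliceE D code_inj n.
  rewrite H ?integral_ge0//; apply: eq_integral => x _; exact: H.
by rewrite H integral0_eq// => x _; rewrite H.
Qed.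

End countable_esum.

(** * Integrals of nonnegative functions and kernels *)

Lemma measurable_inv_ge0 d (T : measurableType d) (R : realType) (f : T -> R) :
  (forall x, 0 <= f x) -> measurable_fun [set: T] f ->
  measurable_fun [set: T] (fun x => (f x)^-1).
Proof.
move=> f0 mf; have -> : (fun x => (f x)^-1) = fun x => powR (f x) (-1).
  by apply/funext => x; rewrite powR_inv1.
exact: (measurableT_comp (@measurable_powR R (-1))).
Qed.

Section almost_everywhere_rules.
Context d (T : measurableType d) (R : realType) (mu : {measure set T -> \bar R}).
Implicit Types P Q : T -> Prop.

Lemma ae_imp P Q : (\forall x \ae mu, P x) -> (forall x, P x -> Q x) ->
  \forall x \ae mu, Q x.
Proof. by move=> aP PQ; apply: filterS aP. Qed.

Lemma ae_imp2 P P' Q : (\forall x \ae mu, P x) -> (\forall x \ae mu, P' x) ->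
  (forall x, P x -> P' x -> Q x) -> \forall x \ae mu, Q x.
Proof. by move=> aP aP' PQ; apply: filterS2 aP aP'. Qed.

Lemma ae_all P : (forall x, P x) -> \forall x \ae mu, P x.
Proof. exact: aeW. Qed.

End almost_everywhere_rules.

Section tonelli.
Context d (T : measurableType d) (R : realType) (mu : {measure set T -> \bar R}).
Hypothesis sfmu : sigma_finite [set: T] mu.
Local Open Scope ereal_scope.

(** Tonelli's theorem is available for bundled sigma-finite measures; this bundles
    one that is only known to be sigma-finite. *)
Lemma sigma_finite_pack :
  exists m : {sigma_finite_measure set T -> \bar R}, (m : set T -> \bar R) = mu.
Proof.
move: sfmu; case: mu => f c sf.
pose b := Measure_isSigmaFinite.Build d T R (Measure.Pack c) sf.
pose m : {sigma_finite_measure set T -> \bar R} := HB.pack f b (Measure.Pack c).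
by exists m.
Qed.

Variables (f : T * T -> \bar R).
Hypotheses (mf : measurable_fun [set: T * T] f) (f0 : forall p, 0 <= f p).

Lemma tonelli : \int[mu]_x \int[mu]_y f (x, y) = \int[mu]_y \int[mu]_x f (x, y).
Proof. by have [m <-] := sigma_finite_pack; exact: fubini_tonelli. Qed.

Lemma measurable_int_snd : measurable_fun [set: T] (fun x => \int[mu]_y f (x, y)).
Proof.
by have [m <-] := sigma_finite_pack; exact: measurable_fun_fubini_tonelli_F.
Qed.

Lemma measurable_int_fst : measurable_fun [set: T] (fun y => \int[mu]_x f (x, y)).
Proof.
by have [m <-] := sigma_finite_pack; exact: measurable_fun_fubini_tonelli_G.
Qed.

Lemma fubini_pack (g : T * T -> \bar R) : measurable_fun [set: T * T] g ->
  \int[mu]_x \int[mu]_y `|g (x, y)| < +oo ->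
  \int[mu]_x \int[mu]_y g (x, y) = \int[mu]_y \int[mu]_x g (x, y).
Proof.
have [m <-] := sigma_finite_pack => mg gfin.
by apply: Fubini; apply/integrable12ltyP.
Qed.

Lemma measurable_int_fst_real (g : T * T -> \bar R) : measurable_fun [set: T * T] g ->
  measurable_fun [set: T] (fun y => \int[mu]_x g (x, y)).
Proof.
have [m <-] := sigma_finite_pack => mg.
have mp := measurable_fun_fubini_tonelli_G (m1 := m) _ (measurable_funepos mg) (funepos_ge0 g).
have mn := measurable_fun_fubini_tonelli_G (m1 := m) _ (measurable_funeneg mg) (funeneg_ge0 g).
have -> : (fun y => \int[m]_x g (x, y)) = fun y => fubini_G m g^\+ y - fubini_G m g^\- y.
  by apply/funext => y; rewrite integralE; congr (_ - _); apply: eq_integral => x _; rewrite ?funeposE ?funenegE.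
exact: emeasurable_funB.
Qed.

End tonelli.

Section product_ae.
Context d (T : measurableType d) (R : realType) (mu : {measure set T -> \bar R}).
Hypothesis sfmu : sigma_finite [set: T] mu.
Local Open Scope ereal_scope.
Variable P : T * T -> Prop.
Hypothesis aeP : \forall p \ae (mu \x mu), P p.

Let null_integral (g : T -> \bar R) : measurable_fun [set: T] g ->
  (forall x, 0 <= g x) -> \int[mu]_x g x = 0 -> \forall x \ae mu, g x = 0.
Proof.
move=> mg g0 ig0.
have : \int[mu]_x `|g x| = 0.
  by rewrite -[RHS]ig0; apply: eq_integral => x _; rewrite gee0_abs.
by move/(ae_eq_integral_abs mu measurableT mg); apply: filterS => x; exact.
Qed.

Let cover : exists N : set (T * T), [/\ measurable N,
  \int[mu]_x \int[mu]_y (\1_N (x, y))%:E = 0 & forall p, ~ N p -> P p].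
Proof.
have [N [mN N0 sub]] := aeP; exists N; split => //; last first.
  by move=> p Np; apply: contrapT => nP; apply: Np; apply: sub.
rewrite -[RHS]N0 /product_measure1; apply: eq_integral => x _ /=.
rewrite -[RHS]mul1e -integral_cst//; last exact: measurable_xsection.
rewrite [in RHS]integral_mkcond.
by apply: eq_integral => y _ /=; rewrite patchE mem_xsection indicE; case: ifPn.
Qed.

(** Tonelli's theorem for the indicator of a null set that contains all exceptions. *)
Lemma ae_prod_fst : \forall x \ae mu, \forall y \ae mu, P (x, y).
Proof.
have [N [mN N0 NP]] := cover.
have mI : measurable_fun [set: T * T] (fun p => (\1_N p)%:E : \bar R).
  exact/measurable_EFinP.
have I0 p : 0 <= (\1_N p)%:E :> \bar R by rewrite lee_fin indicE.
have := null_integral (measurable_int_snd sfmu mI I0) _ N0.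
move=> /(_ (fun x => integral_ge0 _ (fun y _ => I0 (x, y)))).
apply: filterS => x.
have mIx : measurable_fun [set: T] (fun y => (\1_N (x, y))%:E : \bar R).
  exact: measurableT_comp mI _.
move/(null_integral mIx (fun y => I0 (x, y))).
apply: filterS => y; rewrite indicE => -[].
by case: (boolP ((x, y) \in N)) => [_ /eqP|/negP]; rewrite ?oner_eq0// in_setE => /NP.
Qed.

Lemma ae_prod_snd : \forall y \ae mu, \forall x \ae mu, P (x, y).
Proof.
have [N [mN N0 NP]] := cover.
have mI : measurable_fun [set: T * T] (fun p => (\1_N p)%:E : \bar R).
  exact/measurable_EFinP.
have I0 p : 0 <= (\1_N p)%:E :> \bar R by rewrite lee_fin indicE.
rewrite (tonelli sfmu mI I0) in N0.
have := null_integral (measurable_int_fst sfmu mI I0) _ N0.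
move=> /(_ (fun y => integral_ge0 _ (fun x _ => I0 (x, y)))).
apply: filterS => y.
have mIy : measurable_fun [set: T] (fun x => (\1_N (x, y))%:E : \bar R).
  exact: measurableT_comp mI _.
move/(null_integral mIy (fun x => I0 (x, y))).
apply: filterS => x; rewrite indicE => -[].
by case: (boolP ((x, y) \in N)) => [_ /eqP|/negP]; rewrite ?oner_eq0// in_setE => /NP.
Qed.

End product_ae.

Lemma ge0_muleDl3 (R : realType) (a b c e : \bar R) :
  (0 <= a -> 0 <= b -> 0 <= c -> (a + (b + c)) * e = a * e + (b * e + c * e))%E.
Proof.
by move=> a0 b0 c0; rewrite (ge0_muleDl _ a0 (adde_ge0 b0 c0)) (ge0_muleDl _ b0 c0).
Qed.

Section positive_kernels.
Context d (T : measurableType d) (R : realType) (mu : {measure set T -> \bar R}).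
Hypothesis sfmu : sigma_finite [set: T] mu.
Local Open Scope ereal_scope.
Implicit Types (k l : T -> T -> R) (F G A B C : T -> \bar R) (nu : T -> R).

Definition kop k F : T -> \bar R := fun x => \int[mu]_y ((k x y)%:E * F y).

Definition ktrans k : T -> T -> R := fun x y => k y x.

Definition pos_kernel k :=
  measurable_fun [set: T * T] (fun p => k p.1 p.2) /\ forall x y, (0 <= k x y)%R.

Definition nn_measurable F := measurable_fun [set: T] F /\ forall x, 0 <= F x.

Lemma pos_ktrans k : pos_kernel k -> pos_kernel (ktrans k).
Proof.
move=> [mk k0]; split=> [|x y]; last exact: k0.
exact: (measurableT_comp mk (@measurable_swap _ _ T T)).
Qed.

Lemma measurable_section1 k x : pos_kernel k -> measurable_fun [set: T] (k x).
Proof.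
by move=> [mk k0]; exact: (measurableT_comp mk (measurable_pair1 x)).
Qed.

Let mkF k F : pos_kernel k -> nn_measurable F ->
  measurable_fun [set: T * T] (fun p => (k p.1 p.2)%:E * F p.2).
Proof.
move=> [mk k0] [mF F0]; apply: emeasurable_funM; first exact/measurable_EFinP.
exact: measurableT_comp mF measurable_snd.
Qed.

Lemma nn_kop k F : pos_kernel k -> nn_measurable F -> nn_measurable (kop k F).
Proof.
move=> pk nF; split; last first.
  move=> x; apply: integral_ge0 => y _; rewrite mule_ge0 ?lee_fin//; first exact: pk.2.
  exact: nF.2.
apply: (measurable_int_snd sfmu (mkF pk nF)) => p.
by rewrite mule_ge0 ?lee_fin//; [exact: pk.2|exact: nF.2].
Qed.

Lemma nn_kopP k F x : pos_kernel k -> nn_measurable F ->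
  nn_measurable (fun y => (k x y)%:E * F y).
Proof.
move=> pk nF; split; last first.
  by move=> y; rewrite mule_ge0 ?lee_fin//; [exact: pk.2|exact: nF.2].
apply: emeasurable_funM; last exact: nF.1.
by apply/measurable_EFinP; exact: measurable_section1.
Qed.

Lemma nnM F G : nn_measurable F -> nn_measurable G -> nn_measurable (fun x => F x * G x).
Proof.
move=> [mF F0] [mG G0]; split; first exact: emeasurable_funM.
by move=> x; rewrite mule_ge0.
Qed.

Lemma nnD F G : nn_measurable F -> nn_measurable G -> nn_measurable (fun x => F x + G x).
Proof.
move=> [mF F0] [mG G0]; split; first exact: emeasurable_funD.
by move=> x; rewrite adde_ge0.
Qed.

Lemma nnZ (c : R) F : (0 <= c)%R -> nn_measurable F -> nn_measurable (fun x => c%:E * F x).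
Proof.
move=> c0 [mF F0]; split; first exact: measurable_funeM.
by move=> x; rewrite mule_ge0.
Qed.

Lemma nn_EFin (g : T -> R) : measurable_fun [set: T] g -> (forall x, (0 <= g x)%R) ->
  nn_measurable (fun x => (g x)%:E).
Proof. by move=> mg g0; split => [|x]; [exact/measurable_EFinP|rewrite lee_fin]. Qed.

Lemma le_nn_integral F G : nn_measurable F -> nn_measurable G ->
  (\forall x \ae mu, F x <= G x) -> \int[mu]_x F x <= \int[mu]_x G x.
Proof.
move=> [mF F0] [mG G0] FG; apply: ae_ge0_le_integral => //.
by apply: filterS FG => x + _.
Qed.

Lemma integral_nnD F G : nn_measurable F -> nn_measurable G ->
  \int[mu]_x (F x + G x) = \int[mu]_x F x + \int[mu]_x G x.
Proof. by move=> [mF F0] [mG G0]; rewrite ge0_integralD. Qed.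

Lemma nnD3 A B C : nn_measurable A -> nn_measurable B -> nn_measurable C ->
  nn_measurable (fun x => A x + (B x + C x)).
Proof. by move=> nA nB nC; apply: nnD => //; exact: nnD. Qed.

Lemma integral_nnD3 A B C :
  nn_measurable A -> nn_measurable B -> nn_measurable C ->
  \int[mu]_x (A x + (B x + C x)) =
  \int[mu]_x A x + (\int[mu]_x B x + \int[mu]_x C x).
Proof.
by move=> nA nB nC; rewrite (integral_nnD nA (nnD nB nC)) (integral_nnD nB nC).
Qed.

Lemma integral_nnZ (c : R) F : (0 <= c)%R -> nn_measurable F ->
  \int[mu]_x (c%:E * F x) = c%:E * \int[mu]_x F x.
Proof. by move=> c0 [mF F0]; rewrite ge0_integralZl// lee_fin. Qed.

Lemma le_kop k F G x : pos_kernel k -> nn_measurable F -> nn_measurable G ->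
  (\forall x \ae mu, F x <= G x) -> kop k F x <= kop k G x.
Proof.
move=> pk nF nG FG; apply: le_nn_integral; [exact: nn_kopP|exact: nn_kopP|].
by apply: filterS FG => y; apply: lee_wpmul2l; rewrite lee_fin; exact: pk.2.
Qed.

Lemma kopDl k l F x : pos_kernel k -> pos_kernel l -> nn_measurable F ->
  kop (fun x y => k x y + l x y)%R F x = kop k F x + kop l F x.
Proof.
move=> pk pl nF; rewrite /kop -integral_nnD; [|exact: nn_kopP|exact: nn_kopP].
by apply: eq_integral => y _; rewrite EFinD ge0_muleDl ?lee_fin ?(pk.2, pl.2).
Qed.

Lemma pos_kernelD k l : pos_kernel k -> pos_kernel l ->
  pos_kernel (fun x y => k x y + l x y)%R.
Proof.
move=> [mk k0] [ml l0]; split; first exact: measurable_funD.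
by move=> x y; rewrite addr_ge0.
Qed.

(** A kernel moves across the pairing as its transpose, by Tonelli's theorem. *)
Lemma kop_swap k F G : pos_kernel k -> nn_measurable F -> nn_measurable G ->
  \int[mu]_x (G x * kop k F x) = \int[mu]_y (kop (ktrans k) G y * F y).
Proof.
move=> pk nF nG.
have mGkF : measurable_fun [set: T * T] (fun p => G p.1 * ((k p.1 p.2)%:E * F p.2)).
  by apply: emeasurable_funM (mkF pk nF); exact: measurableT_comp nG.1 measurable_fst.
have GkF0 p : 0 <= G p.1 * ((k p.1 p.2)%:E * F p.2).
  by rewrite mule_ge0 ?nG.2//; exact: (nn_kopP _ pk nF).2.
transitivity (\int[mu]_x \int[mu]_y (G x * ((k x y)%:E * F y))).
  apply: eq_integral => x _; rewrite ge0_integralZl//; last exact: nG.2.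
  - exact: (nn_kopP _ pk nF).1.
  - by move=> y _; exact: (nn_kopP _ pk nF).2.
rewrite (tonelli sfmu mGkF GkF0); apply: eq_integral => y _.
rewrite muleC -ge0_integralZl//; last exact: nF.2.
- by apply: eq_integral => x _; rewrite muleA [in RHS]muleC [in RHS](muleC _ (G x)).
- exact: (nn_kopP _ (pos_ktrans pk) nG).1.
- by move=> x _; exact: (nn_kopP _ (pos_ktrans pk) nG).2.
Qed.

Lemma kop_comp k l F x : pos_kernel k -> pos_kernel l -> nn_measurable F ->
  \int[mu]_y ((\int[mu]_z ((k x z)%:E * (l z y)%:E)) * F y) = kop k (kop l F) x.
Proof.
move=> pk pl nF.
transitivity (\int[mu]_z ((k x z)%:E * kop l F z)); last by [].
rewrite kop_swap//; last first.
  by apply: nn_EFin; [exact: measurable_section1|exact: pk.2].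
apply: eq_integral => y _; congr (_ * _).
by apply: eq_integral => z _; rewrite muleC.
Qed.

(** By Fubini's theorem this bounds [k] by [c] on the [L1]-space with weight [nu]. *)
Definition schur nu k (c : R) :=
  \forall y \ae mu, kop (ktrans k) (fun x => (nu x)%:E) y <= c%:E * (nu y)%:E.

Lemma schur_integral nu k c F : pos_kernel k -> nn_measurable F ->
  measurable_fun [set: T] nu -> (forall x, (0 <= nu x)%R) -> (0 <= c)%R -> schur nu k c ->
  \int[mu]_x (kop k F x * (nu x)%:E) <= c%:E * \int[mu]_x (F x * (nu x)%:E).
Proof.
move=> pk nF mnu nu0 c0 sk.
have nnu := nn_EFin mnu nu0.
rewrite (eq_integral (fun x => (nu x)%:E * kop k F x)); last by move=> x _; rewrite muleC.
rewrite kop_swap// -integral_nnZ//; last exact: nnM.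
apply: le_nn_integral.
- by apply: nnM => //; apply: nn_kop => //; exact: pos_ktrans.
- by apply: nnZ => //; exact: nnM.
- apply: filterS sk => y ky; rewrite (muleC (F y)) muleA.
  by apply: lee_wpmul2r => //; exact: nF.2.
Qed.

Lemma schurD nu k l c c' : pos_kernel k -> pos_kernel l ->
  measurable_fun [set: T] nu -> (forall x, (0 <= nu x)%R) ->
  schur nu k c -> schur nu l c' -> schur nu (fun x y => k x y + l x y)%R (c + c')%R.
Proof.
move=> pk pl mnu nu0 sk sl; have nnu := nn_EFin mnu nu0.
apply: filterS2 sk sl => y sk sl; rewrite (_ : ktrans _ = fun x y => ktrans k x y + ktrans l x y)%R//.
rewrite kopDl//; [|exact: pos_ktrans|exact: pos_ktrans].
by rewrite EFinD muleDl//; exact: leeD.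
Qed.

End positive_kernels.

(** * Admissible coverings *)

Section covering.
Context (R : realType) (X : ptopologicalType).
Variable mu : {measure set (borel X) -> \bar R}.
Hypotheses (X_hausdorff : hausdorff_space X) (X_sigma_compact : sigma_compact X).
Hypotheses (mu_radon : radon_measure mu) (mu_support : full_support mu).
Context (I : choiceType) (U : I -> set X).
Hypothesis adm : admissible_covering U.
Local Notation BX := (borel X).

Lemma borel_open (O : set X) : open O -> measurable (O : set BX).
Proof. by move=> oO; apply: sub_sigma_algebra. Qed.

Lemma borel_closed (F : set X) : closed F -> measurable (F : set BX).
Proof.
move=> cF; rewrite -(setCK (F : set BX)); apply: measurableC.
by apply: borel_open; rewrite openC.
Qed.

Lemma borel_compact (K : set X) : compact K -> measurable (K : set BX).
Proof. by move=> cK; apply: borel_closed; exact: compact_closed. Qed.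

Lemma radon_sigma_finite : sigma_finite [set: BX] mu.
Proof.
have [K [cK KT]] := X_sigma_compact.
exists (fun n => K n); first by rewrite KT.
by move=> n; split; [exact: borel_compact|exact: radon_compact].
Qed.

Lemma radon_gt0 : (0 < mu [set: BX])%E.
Proof. by apply: mu_support; [exact: openT|exists point]. Qed.

Lemma cover_lty i : (mu (U i : set BX) < +oo)%E.
Proof.
have cU : compact (closure (U i)) by exact: adm_relatively_compact.
apply: le_lt_trans (radon_compact mu_radon cU).
apply: le_measure; rewrite ?inE; [exact: adm_measurable|exact: borel_compact|].
exact: subset_closure.
Qed.

Lemma cover_gt0 i : (0 < mu (U i : set BX))%E.
Proof.
apply: (lt_le_trans (mu_support (@open_interior _ (U i)) (adm_interior adm i))).
apply: le_measure; rewrite ?inE; [|exact: adm_measurable|exact: interior_subset].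
by apply: borel_open; exact: open_interior.
Qed.

Definition muU i : R := fine (mu (U i : set BX)).

Lemma muUE i : (muU i)%:E = mu (U i : set BX).
Proof. by rewrite /muU fineK// ge0_fin_numE// cover_lty. Qed.

Lemma muU_gt0 i : 0 < muU i.
Proof. by rewrite -lte_fin muUE cover_gt0. Qed.

Lemma compact_meets_finite (K : set X) : compact K ->
  finite_set [set i | K `&` U i !=set0].
Proof.
rewrite compact_cover => cK.
have /choice[V HV] : forall x, exists W : set X, [/\ open W, W x &
    finite_set [set i | W `&` U i !=set0]].
  move=> x.
  have [W nW fW] := adm_locally_finite adm x.
  exists W°; split; [exact: open_interior|exact: nW|].
  apply: sub_finite_set fW => i [y [Wy Uy]]; exists y; split => //.
  exact: interior_subset Wy.
have [D _ KD] := cK X setT V (fun x _ => let: And3 o _ _ := HV x in o)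
  (fun x Kx => ex_intro2 _ _ x Logic.I (let: And3 _ v _ := HV x in v)).
apply: (@sub_finite_set _ _ (\bigcup_(x in [set` D]) [set i | V x `&` U i !=set0])).
  move=> i [y [/KD[x Dx Vxy] Uy]]; exists x => //; by exists y.
by apply: bigcup_finite => // x _; have [] := HV x.
Qed.

(** Every compact set meets only finitely many members, and each member, having
    a point, meets one of countably many compact sets. *)
Lemma cover_countable : countable [set: I].
Proof.
have [K [cK KT]] := X_sigma_compact.
apply: (@sub_countable _ _ _ (\bigcup_n [set i | K n `&` U i !=set0])); last first.
  apply: bigcup_countable => // n _; apply: finite_set_countable.
  exact: compact_meets_finite.
apply: subset_card_le => i _.
have [x /interior_subset Ux] := adm_interior adm i.
have : [set: X] x by []. rewrite -KT => -[n _ Kx].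
by exists n => //; exists x.
Qed.

(** Take the index of least code: the sets where the choice is constant are then
    Boolean combinations of members of the covering. *)
Lemma cover_selection : exists io : BX -> I,
  (forall z, U (io z) z) /\ forall i, measurable (io @^-1` [set i]).
Proof.
have [code code_inj] : exists code : I -> nat, injective code.
  move/countable_injP: cover_countable => [c ci]; exists c => x y exy.
  by apply: ci => //; rewrite in_setT.
have ex z : exists n, `[< exists2 i, U i z & code i = n >].
  have : [set: X] z by []. rewrite -(adm_cover adm) => -[i _ Uz].
  by exists (code i); apply/asboolP; exists i.
have /choice[io Hio] : forall z : BX, exists i, U i z /\ code i = ex_minn (ex z).
  move=> z; by case: ex_minnP => n /asboolP[i Uz <-] _; exists i.
exists io; split => [z|i]; first by have [] := Hio z.
rewrite (_ : _ @^-1` _ = (U i : set BX) `\` \bigcup_(j in [set j | (code j < code i)%N]) (U j : set BX)).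
  apply: measurableD; first exact: adm_measurable.
  rewrite bigcup_mkcond; apply: countable_bigcupT_measurable cover_countable _ => j.
  by case: ifP => _; [exact: adm_measurable|exact: measurable0].
apply/seteqP; split => z /=.
  move=> <-; have [Uz cz] := Hio z; split => // -[j /= ji Uj].
  move: ji; rewrite cz; case: ex_minnP => n _ /(_ (code j)) H; rewrite ltnNge H//.
  by apply/asboolP; exists j.
move=> [Uz nz]; have [Uioz cz] := Hio z; apply: code_inj.
apply/eqP; rewrite eqn_leq; apply/andP; split.
  by rewrite cz; case: ex_minnP => n _; apply; apply/asboolP; exists i.
by rewrite leqNgt; apply/negP => lt; apply: nz; exists (io z).
Qed.

Let sume_const (s : seq I) (a : \bar R) : (0 <= a)%E ->
  (\sum_(i <- s) a)%E = ((size s)%:R%:E * a)%E.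
Proof.
move=> a0; elim: s => [|i s IH]; first by rewrite big_nil mul0e.
rewrite big_cons IH/= -[(size s).+1]add1n natrD EFinD.
by rewrite ge0_muleDl ?mul1e// lee_fin.
Qed.

(** At [z] only the members that meet a fixed one containing [z] contribute, and
    their number is bounded uniformly. *)
Lemma cover_overlap : exists N : nat, forall (z : X) (b : I -> \bar R) (a : \bar R),
  (0 <= a)%E -> (forall i, 0 <= b i)%E -> (forall i, U i z -> b i <= a)%E ->
  (forall i, ~ U i z -> b i = 0)%E ->
  (\esum_(i in [set: I]) b i <= N%:R%:E * a)%E.
Proof.
have [N HN] := adm_overlap adm; exists N => z b a a0 b0 ba bz.
have : [set: X] z by []. rewrite -(adm_cover adm) => -[i0 _ Uz].
pose A := [set j | U i0 `&` U j !=set0].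
have finA : finite_set A by apply: card_le_finite (HN i0) _; exact: finite_II.
have cA : (#|` fset_set A| <= N)%N.
  have /finite_setP[n An] := finA; rewrite (card_fset_set An) -card_le_II.
  apply: card_le_trans (HN i0).
  by move: An; rewrite card_eq_le => /andP[].
apply: esum_le_bound => // J _.
apply: (@le_trans _ _ (\sum_(i <- fset_set A) b i)%E); last first.
  apply: (@le_trans _ _ (\sum_(i <- fset_set A) a)%E).
    apply: lee_sum => i _; have [Ui|Ui] := pselect (U i z); first exact: ba.
    by rewrite bz.
  rewrite sume_const//.
  by apply: lee_wpmul2r => //; rewrite lee_fin ler_nat.
have -> : (\sum_(i <- J) b i = \sum_(i <- (J `&` fset_set A)%fset) b i)%E.
  rewrite (big_fset_incl _ (fsubsetIl J (fset_set A)))// => i iJ iA.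
  apply: bz => Ui; move/negP: iA; apply; rewrite in_fsetI iJ/= in_fset_set// inE.
  by exists z.
apply: lee_sum_nneg_subfset => [i|i _ _]; last exact: b0.
by rewrite in_fsetI => /andP[].
Qed.

Variable io : BX -> I.
Hypotheses (ioU : forall z, U (io z) z)
  (mio : forall i, measurable (io @^-1` [set i])).

Lemma measurable_io d' (T' : measurableType d') (g : I -> T') :
  measurable_fun [set: BX] (g \o io).
Proof.
move=> _ B mB; rewrite setTI comp_preimage.
rewrite (_ : _ @^-1` _ = \bigcup_(i in g @^-1` B) (io @^-1` [set i])); last first.
  apply/seteqP; split => [z /= gB|z [i /= gB]]; last by move=> /= ->.
  by exists (io z).
rewrite bigcup_mkcond; apply: countable_bigcupT_measurable cover_countable _ => i.
by case: ifP => _; [exact: mio|exact: measurable0].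
Qed.

Definition cell i : R := fine (mu (io @^-1` [set i])).

Lemma cellE i : (cell i)%:E = mu (io @^-1` [set i]).
Proof.
rewrite /cell fineK// ge0_fin_numE//; apply: le_lt_trans (cover_lty i).
by apply: le_measure; rewrite ?inE//; [exact: adm_measurable|move=> z <-].
Qed.

Lemma cell_ge0 i : 0 <= cell i.
Proof. exact: fine_ge0. Qed.

Lemma cell_le i : cell i <= muU i.
Proof.
rewrite -lee_fin cellE muUE.
by apply: le_measure; rewrite ?inE//; [exact: adm_measurable|move=> z <-].
Qed.

Lemma integral_cell (a : I -> \bar R) : (forall i, 0 <= a i)%E ->
  (\int[mu]_z a (io z) = \esum_(i in [set: I]) ((cell i)%:E * a i))%E.
Proof.
move=> a0.
transitivity (\int[mu]_z (\esum_(i in [set: I]) (a i * (\1_(io @^-1` [set i]) z)%:E)))%E.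
  apply: eq_integral => z _.
  rewrite (esumID [set io z])//; last first.
    by move=> i _; rewrite mule_ge0// lee_fin indicE.
  rewrite setTI esum_set1; last by rewrite mule_ge0// lee_fin indicE.
  rewrite [X in (_ + X)%E]esum1 ?adde0.
    by rewrite indicE mem_set// mule1.
  by move=> i [_ /= ii]; rewrite indicE memNset ?mule0// => /= ei; exact: ii.
rewrite integral_esum//; last 3 first.
- exact: cover_countable.
- by move=> i z; rewrite mule_ge0// lee_fin indicE.
- by move=> i; apply: measurable_funeM; apply/measurable_EFinP; exact: measurable_indic.
apply: eq_esum => i _; rewrite ge0_integralZl//; last first.
  by apply/measurable_EFinP; exact: measurable_indic.
by rewrite integral_indic// setIT cellE muleC.
Qed.

End covering.

Section polarization.
Variable R : realType.
Implicit Types p q : R[i].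

(** * Polarization without integrals *)

Lemma polar_arith (A n J : R) : A + 2 * n <= A - 2 * n + 4 * J -> n <= J.
Proof. by move=> ?; lra. Qed.

Let arith (A B a b n : R) : a - b <= n -> A + 4 * a + B <= A + (B + 4 * b) + 4 * n.
Proof. by move=> ?; lra. Qed.

Lemma polar_arith2 (A B x y J : R) :
  A + 2 * x + (B - 2 * y) <= A - 2 * x + (B + 2 * y) + 4 * J -> x - y <= J.
Proof. by move=> ?; lra. Qed.

(** The integrand of the polarization identity for the difference of two sesquilinear
    forms: with signs arranged so that all integrals are of nonnegative functions, it
    replaces complex integration. *)
Lemma polar_bound (p q p' q' : R[i]) :
  rnorm (p + q) ^+ 2 + rnorm (p' - q') ^+ 2 <=
  rnorm (p - q) ^+ 2 + rnorm (p' + q') ^+ 2 + 4 * rnorm (p * q^*%C - p' * q'^*%C).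
Proof.
have polar (s t : R[i]) :
    rnorm (s + t) ^+ 2 = rnorm (s - t) ^+ 2 + 4 * complex.Re (s * t^*%C).
  by case: s => sr si; case: t => tr ti; rewrite !sqr_rnorm/=; ring.
by rewrite (polar p q) (polar p' q'); apply: arith; rewrite -cReB; exact: ler_Re_rnorm.
Qed.

End polarization.

(** * Unordered sums of complex families *)

Section complex_sums.
Context (R : realType) (I : choiceType).
Implicit Types (b : I -> R[i]) (s : R[i]).

Definition csum b s := forall e : R, 0 < e -> exists K0 : {fset I},
  forall K : {fset I}, (K0 `<=` K)%fset -> rnorm (s - \sum_(i <- K) b i) <= e.

Lemma csum_unique b s s' : csum b s -> csum b s' -> s = s'.
Proof.
move=> bs bs'; apply/eqP; rewrite -subr_eq0 -rnorm_eq0 eq_le rnorm_ge0 andbT.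
apply/ler_addgt0Pr => e e0; rewrite add0r.
have e2 : 0 < e / 2 by rewrite divr_gt0.
have [K1 H1] := bs _ e2; have [K2 H2] := bs' _ e2.
pose K := (K1 `|` K2)%fset.
have -> : s - s' = (s - \sum_(i <- K) b i) - (s' - \sum_(i <- K) b i) by ring.
apply: (le_trans (rnormB _ _)); rewrite [e]splitr.
by apply: lerD; [apply: H1|apply: H2]; rewrite ?fsubsetUl ?fsubsetUr.
Qed.

Lemma csumZ c b s : csum b s -> csum (fun i => c * b i) (c * s).
Proof.
move=> bs e e0; have c0 := rnorm_ge0 c.
have ec : 0 < e / (1 + rnorm c) by rewrite divr_gt0// ltr_pwDl.
have [K0 HK] := bs _ ec; exists K0 => K /HK; rewrite -mulr_sumr -mulrBr rnormM.
rewrite ler_pdivlMr ?ltr_pwDl// => /(le_trans _); apply.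
by rewrite mulrC ler_wpM2l ?rnorm_ge0// lerDr.
Qed.

Lemma csumD b b' s s' : csum b s -> csum b' s' -> csum (fun i => b i + b' i) (s + s').
Proof.
move=> bs bs' e e0; have e2 : 0 < e / 2 by rewrite divr_gt0.
have [K1 H1] := bs _ e2; have [K2 H2] := bs' _ e2.
exists (K1 `|` K2)%fset => K; rewrite fsubUset => /andP[/H1 le1 /H2 le2].
rewrite big_split/= opprD addrACA [e]splitr.
by apply: (le_trans (rnormD _ _)); exact: lerD.
Qed.

Lemma csum_conj b s : csum b s -> csum (fun i => (b i)^*%C) s^*%C.
Proof.
move=> bs e e0; have [K0 HK] := bs _ e0; exists K0 => K /HK.
by rewrite -(rnormJ (_ - _)) rmorphB rmorph_sum.
Qed.

Lemma eq_csum b b' s : b =1 b' -> csum b s -> csum b' s.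
Proof. by move=> /funext ->. Qed.

Lemma csum_tail b s (K : {fset I}) : csum b s ->
  ((rnorm (s - \sum_(i <- K) b i))%:E <=
   \esum_(i in ~` [set` K]) (rnorm (b i))%:E)%E.
Proof.
move=> bs; apply/lee_addgt0Pr => e e0.
have [K0 HK] := bs _ e0; pose L := (K0 `|` K)%fset.
have -> : \sum_(i <- K) b i = \sum_(i <- L) b i - \sum_(i <- (L `\` K)%fset) b i.
  rewrite [X in _ = X - _](big_fsetID _ (mem K))/=.
  rewrite (_ : [fset x in L | x \in K]%fset = K); last first.
    apply/fsetP => i; rewrite !inE/=; case: (i \in K); by rewrite ?orbT ?andbF.
  rewrite (_ : [fset x in L | x \notin K]%fset = (L `\` K)%fset) ?addrK//.
  by apply/fsetP => i; rewrite !inE/= andbC.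
rewrite opprB addrCA addrC.
apply: (@le_trans _ _ ((e + \sum_(i <- (L `\` K)%fset) rnorm (b i))%:E)).
  rewrite lee_fin; apply: (le_trans (rnormD _ _)); apply: lerD (rnorm_sum _ _).
  by apply: HK; exact: fsubsetUl.
rewrite EFinD addeC; apply: leeD => //.
rewrite -sumEFin; apply: esum_ge; exists [set` (L `\` K)%fset].
  split; first exact: finite_fset.
  by move=> i /=; rewrite in_fsetD => /andP[/negP].
by rewrite fsbig_finite//= set_fsetK.
Qed.

Lemma csum_bound b s (M : \bar R) : csum b s ->
  (\esum_(i in [set: I]) (rnorm (b i))%:E <= M)%E -> ((rnorm s)%:E <= M)%E.
Proof.
move=> bs; apply: le_trans.
have := csum_tail fset0 bs; rewrite big_seq_fset0 subr0 => /le_trans; apply.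
by apply: le_esum_set => // i; rewrite lee_fin rnorm_ge0.
Qed.

Lemma csum_abs_ge0 (r : I -> R) s : (forall i, 0 <= r i) ->
  csum (fun i => (r i)%:C%C) s ->
  (\esum_(i in [set: I]) (r i)%:E = (complex.Re s)%:E)%E.
Proof.
move=> r0 rs; apply/eqP; rewrite eq_le; apply/andP; split.
  apply: esum_le_bound => [i|K _]; first by rewrite lee_fin.
  rewrite sumEFin lee_fin; apply/ler_addgt0Pr => e e0.
  have [K0 HK] := rs _ e0; pose L := (K0 `|` K)%fset.
  have : \sum_(i <- K) r i <= \sum_(i <- L) r i.
    rewrite -lee_fin -!sumEFin; apply: lee_sum_nneg_subfset => [|i _ _].
      exact/fsubsetP/fsubsetUr.
    by rewrite lee_fin.
  move/le_trans; apply; rewrite -lerBlDl.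
  apply: le_trans (HK L (fsubsetUl _ _)); rewrite rdistC.
  apply: le_trans (ler_Re_rnorm _).
  by rewrite -rmorph_sum cReB.
apply/lee_addgt0Pr => e e0; have [K0 HK] := rs _ e0.
have := le_trans (ler_Re_rnorm _) (HK K0 (fsubset_refl _)).
rewrite -rmorph_sum cReB/= lerBlDr => H.
apply: (@le_trans _ _ (e + \sum_(i <- K0) r i)%:E); first by rewrite lee_fin.
rewrite EFinD addeC -sumEFin; apply: leeD => //.
by apply: esum_ge_fset => i; rewrite lee_fin.
Qed.

Lemma csum_exists_ge0 (r : I -> R) : (forall i, 0 <= r i) ->
  (\esum_(i in [set: I]) (r i)%:E < +oo)%E -> exists s, csum (fun i => (r i)%:C%C) s.
Proof.
move=> r0 rfin; have r0' i : (0 <= (r i)%:E)%E by rewrite lee_fin.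
exists (fine (\esum_(i in [set: I]) (r i)%:E)%E)%:C%C => e e0.
have [K0 HK] := esum_tail_small r0' rfin e0; exists K0 => K /HK tail.
have fin : (\esum_(i in [set: I]) (r i)%:E)%E \is a fin_num.
  by rewrite ge0_fin_numE ?esum_ge0.
rewrite -rmorph_sum -rmorphB rnorm_real -lee_fin; apply: le_trans tail.
have := esum_split K r0'; rewrite -[LHS](fineK fin) sumEFin.
move: (fine _) => S.
set t := (\esum_(i in ~` _) _)%E; have : (0 <= t)%E by exact: esum_ge0.
case: t => [t t0|_|//]; last by rewrite addey.
move=> /eqP; rewrite -EFinD eqe => /eqP ->.
by rewrite addrC addKr lee_fin ger0_norm// -lee_fin.
Qed.

(** Split the terms into positive and negative parts of their real and imaginary parts. *)
Lemma csum_exists b : (\esum_(i in [set: I]) (rnorm (b i))%:E < +oo)%E ->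
  exists s, csum b s.
Proof.
move=> bfin.
have part (p : I -> R) : (forall i, `|p i| <= rnorm (b i)) ->
    exists s, csum (fun i => (p i)%:C%C) s.
  move=> ple; pose u i := (`|p i| + p i) / 2; pose v i := (`|p i| - p i) / 2.
  have u0 i : 0 <= u i by rewrite /u; have := ler_norm (- p i); rewrite normrN; lra.
  have v0 i : 0 <= v i by rewrite /v; have := ler_norm (p i); lra.
  have ule i : u i <= rnorm (b i) by rewrite /u; have := ple i; have := ler_norm (p i); lra.
  have vle i : v i <= rnorm (b i).
    by rewrite /v; have := ple i; have := ler_norm (- p i); rewrite normrN; lra.
  have [|s us] := csum_exists_ge0 u0.
    by apply: le_lt_trans bfin; apply: le_esum => i _; rewrite lee_fin.
  have [|t vt] := csum_exists_ge0 v0.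
    by apply: le_lt_trans bfin; apply: le_esum => i _; rewrite lee_fin.
  exists (s + (-1) * t); apply: eq_csum (csumD us (csumZ (-1) vt)) => i.
  by rewrite mulN1r -rmorphB; congr (_%:C%C); rewrite /u /v; lra.
have [s bs] := part _ (fun i => ler_absRe (b i)).
have [t bt] := part _ (fun i => ler_absIm (b i)).
exists (s + 'i%C * t); apply: eq_csum (csumD bs (csumZ 'i%C bt)) => i.
exact: (esym (complexE (b i))).
Qed.

End complex_sums.

(** * Measurability of complex functions *)

Section complex_measurability.
Context (R : realType) d (T : measurableType d).
Implicit Types F G : T -> R[i].

Lemma cmeasurableB F G : cmeasurable F -> cmeasurable G ->
  cmeasurable (fun x => F x - G x).
Proof.
move=> [mF1 mF2] [mG1 mG2]; split.
  by under eq_fun do rewrite cReB; exact: measurable_funB.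
by under eq_fun do rewrite cImD cImN; exact: measurable_funB.
Qed.

Lemma cmeasurableD F G : cmeasurable F -> cmeasurable G ->
  cmeasurable (fun x => F x + G x).
Proof.
move=> [mF1 mF2] [mG1 mG2]; split.
  by under eq_fun do rewrite cReD; exact: measurable_funD.
by under eq_fun do rewrite cImD; exact: measurable_funD.
Qed.

Lemma cmeasurableM F G : cmeasurable F -> cmeasurable G ->
  cmeasurable (fun x => F x * G x).
Proof.
move=> [mF1 mF2] [mG1 mG2]; split.
  by under eq_fun do rewrite cReM; apply: measurable_funB; exact: measurable_funM.
by under eq_fun do rewrite cImM; apply: measurable_funD; exact: measurable_funM.
Qed.

Lemma cmeasurable_conj F : cmeasurable F -> cmeasurable (fun x => (F x)^*%C).
Proof.
move=> [mF1 mF2]; split; first by under eq_fun do rewrite Re_conj.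
by under eq_fun do rewrite Im_conj; exact: measurable_funN.
Qed.

Lemma cmeasurable_real (g : T -> R) : measurable_fun [set: T] g ->
  cmeasurable (fun x => (g x)%:C%C).
Proof. by []. Qed.

Lemma cmeasurable_cst (c : R[i]) : cmeasurable (fun _ : T => c).
Proof. by []. Qed.

(** A coding of the countable index set exhibits the sum as a pointwise limit of
    a sequence of finite sums. *)
Lemma csum_measurable (I : choiceType) (cI : countable [set: I])
    (b : I -> T -> R[i]) (s : T -> R[i]) :
  (forall i, cmeasurable (b i)) -> (forall x, csum (b^~ x) (s x)) -> cmeasurable s.
Proof.
move=> mb bs.
have [code code_inj] : exists code : I -> nat, injective code.
  move/countable_injP: cI => [c ci]; exists c => x y exy.
  by apply: ci => //; rewrite in_setT.
pose A n := [set i | (code i < n)%N].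
have finA n : finite_set (A n).
  apply: (@sub_finite_set _ _ (code @^-1` `I_n)) => //.
  by apply: finite_preimage (finite_II n) => x y _ _; exact: code_inj.
pose K n := fset_set (A n).
have KS (K0 : {fset I}) : exists N, forall n, (N <= n)%N -> (K0 `<=` K n)%fset.
  have [N HN] := seq_bounded (enum_fset K0) code; exists N => n le.
  apply/fsubsetP => i iK0; rewrite in_fset_set// inE /A/=.
  exact: leq_trans (HN i iK0) le.
pose S n x := \sum_(i <- K n) b i x.
have mS n : cmeasurable (S n).
  rewrite /S; elim: (enum_fset (K n)) => [|i l IH].
    by rewrite (_ : (fun x => _) = fun _ => 0)//; apply/funext => x; rewrite big_nil.
  rewrite (_ : (fun x => _) = fun x => b i x + \sum_(j <- l) b j x).
    exact: cmeasurableD.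
  by apply/funext => x; rewrite big_cons.
have lim (P : R[i] -> R) : (forall z w, `|P z - P w| <= rnorm (z - w)) ->
    forall x, (fun n => P (S n x)) @ \oo --> P (s x).
  move=> HP x; apply/cvgrPdist_le => e e0.
  have [K0 HK] := bs x e e0; have [N HN] := KS K0.
  exists N => // n /= Nn; apply: (le_trans (HP _ _)).
  exact: HK (HN _ Nn).
split.
  apply: (@measurable_fun_cvg _ _ _ _ (fun n x => complex.Re (S n x))) => //.
    by move=> n; exact: (mS n).1.
  by move=> x _; apply: lim => z w; rewrite -cReB; exact: ler_absRe.
apply: (@measurable_fun_cvg _ _ _ _ (fun n x => complex.Im (S n x))) => //.
  by move=> n; exact: (mS n).2.
by move=> x _; apply: lim => z w; rewrite -cImN -cImD; exact: ler_absIm.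
Qed.

End complex_measurability.

(** * The space of test vectors *)

Section weighted_norm.
Context (R : realType) (H : completeNormedModType R[i]) (dot : {dot H for conjC}).
Hypothesis dot_norm : forall h : H, `|h| ^+ 2 = dot h h.
Context (X : ptopologicalType) (mu : {measure set (borel X) -> \bar R}).
Local Notation BX := (borel X).
Variables (phi : BX -> H) (nu : BX -> R).
Hypotheses (phi_frame : parseval_frame mu dot phi) (nu_weight : weight nu).
Variable CB : R.
Hypotheses (CB_gt0 : 0 < CB) (phi_le : forall x, rnorm (phi x) <= CB * nu x).
Implicit Types (f : H -> R[i]) (g h u : H).

Definition aV f : BX -> \bar R := fun x => (rnorm (f (phi x)))%:E.

Definition wnorm h : \bar R := \int[mu]_x (aV (emb dot h) x * (nu x)%:E)%E.

Arguments wnorm h%_ring_scope.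
Local Notation N1 := wnorm.
Local Notation aVh h := (aV (emb dot h)).

Lemma weight_gt0 x : 0 < nu x.
Proof. by apply: lt_le_trans (nu_weight.2 x). Qed.

Lemma nn_weight : nn_measurable (fun x => (nu x)%:E).
Proof. by apply: nn_EFin => [|x]; [exact: nu_weight.1|exact/ltW/weight_gt0]. Qed.

Lemma measurable_rnorm (F : BX -> R[i]) : cmeasurable F ->
  measurable_fun [set: BX] (fun x => rnorm (F x)).
Proof.
move=> [mR mI]; rewrite (_ : (fun x => _) =
  fun x => Num.sqrt (complex.Re (F x) ^+ 2 + complex.Im (F x) ^+ 2)); last first.
  by apply/funext => x; exact: rnorm_Re_Im.
apply: (measurableT_comp (continuous_measurable_fun (@sqrt_continuous R))).
by apply: measurable_funD; apply: measurable_funX.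
Qed.

Lemma nn_rnorm (F : BX -> R[i]) : cmeasurable F ->
  nn_measurable (fun x => (rnorm (F x))%:E).
Proof.
by move=> mF; apply: nn_EFin => [|x]; [exact: measurable_rnorm|exact: rnorm_ge0].
Qed.

Lemma nn_aVh h : nn_measurable (aVh h).
Proof. by apply: nn_rnorm; exact: phi_frame.1. Qed.

Lemma nn_aVnu h : nn_measurable (fun x => aVh h x * (nu x)%:E)%E.
Proof. by apply: nnM; [exact: nn_aVh|exact: nn_weight]. Qed.

Lemma N1_ge0 h : (0 <= N1 h)%E.
Proof. by apply: integral_ge0 => x _; exact: (nn_aVnu h).2. Qed.

Lemma H1_normE h : H1_norm mu dot phi nu h = N1 h.
Proof.
rewrite /H1_norm /Lpw_norm Lnorm1; apply: eq_integral => x _.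
rewrite gee0_abs -?EFinM// lee_fin mulr_ge0 ?rnorm_ge0//; exact/ltW/weight_gt0.
Qed.

Lemma H1E h : H1 mu dot phi nu h <-> (N1 h < +oo)%E.
Proof.
rewrite -H1_normE; split => [[]//|lt]; split => //; exact: phi_frame.1.
Qed.

Lemma N1D g h : (N1 (g + h) <= N1 g + N1 h)%E.
Proof.
rewrite /wnorm -integral_nnD; [|exact: nn_aVnu|exact: nn_aVnu].
apply: le_nn_integral; [exact: nn_aVnu|by apply: nnD; exact: nn_aVnu|].
apply: aeW => x; rewrite -ge0_muleDl ?lee_fin ?rnorm_ge0//.
apply: ler_wpM2r; first exact/ltW/weight_gt0.
by rewrite /emb dotDl rnormD.
Qed.

Lemma N1Z c h : N1 (c *: h) = ((rnorm c)%:E * N1 h)%E.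
Proof.
rewrite /wnorm -integral_nnZ; [|exact: rnorm_ge0|exact: nn_aVnu].
by apply: eq_integral => x _; rewrite /aV /emb dotZl rnormM EFinM muleA.
Qed.

Lemma N10 : N1 0 = 0%E.
Proof. by rewrite -(scale0r (0 : H)) N1Z rnorm0 mul0e. Qed.

Lemma N1N h : N1 (- h) = N1 h.
Proof. by rewrite -scaleN1r N1Z rnormN rnorm1 mul1e. Qed.

Lemma N1B g h : (N1 (g - h) <= N1 g + N1 h)%E.
Proof. by rewrite -(N1N h) N1D. Qed.

Lemma N1_sum (J : Type) (s : seq J) (F : J -> H) :
  (N1 (\sum_(i <- s) F i) <= \sum_(i <- s) N1 (F i))%E.
Proof.
elim: s => [|a s IH]; first by rewrite !big_nil N10.
by rewrite !big_cons (le_trans (N1D _ _))// leeD2l.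
Qed.

Lemma H1D g h : (N1 g < +oo -> N1 h < +oo -> N1 (g + h) < +oo)%E.
Proof. by move=> lg lh; apply: le_lt_trans (N1D _ _) _; exact: lte_add_pinfty. Qed.

Lemma H1Z c h : (N1 h < +oo -> N1 (c *: h) < +oo)%E.
Proof. by move=> lh; rewrite N1Z lte_mul_pinfty// lee_fin rnorm_ge0. Qed.

Lemma H1B g h : (N1 g < +oo -> N1 h < +oo -> N1 (g - h) < +oo)%E.
Proof. by move=> lg lh; apply: le_lt_trans (N1B _ _) _; exact: lte_add_pinfty. Qed.

Lemma H1_sum (J : Type) (s : seq J) (F : J -> H) :
  (forall i, N1 (F i) < +oo)%E -> (N1 (\sum_(i <- s) F i) < +oo)%E.
Proof.
move=> HF; elim: s => [|a s IH]; first by rewrite big_nil N10.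
by rewrite big_cons H1D.
Qed.

Lemma parsevalE h : ((rnorm h ^+ 2)%:E = \int[mu]_x (aVh h x * aVh h x))%E.
Proof.
by rewrite phi_frame.2; apply: eq_integral => x _; rewrite -EFinM -expr2.
Qed.

Lemma aV_le h x : (aVh h x <= (rnorm h)%:E * (CB * nu x)%:E)%E.
Proof.
rewrite lee_fin (le_trans (CS dot_norm _ _))// ler_wpM2l ?rnorm_ge0//.
Qed.

(** [|h|^2 = int |Vh|^2], where one factor is at most [|h| CB nu] by the
    Cauchy-Schwarz inequality; divide by [|h|]. *)
Lemma rnorm_le_N1 h : ((rnorm h)%:E <= CB%:E * N1 h)%E.
Proof.
have [->|h0] := eqVneq h 0; first by rewrite rnorm0 N10 mule0.
have nh : 0 < rnorm h by rewrite lt_neqAle rnorm_ge0 eq_sym rnorm_eq0 h0.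
have : ((rnorm h)%:E * (rnorm h)%:E <= (rnorm h)%:E * (CB%:E * N1 h))%E.
  rewrite -EFinM -expr2 parsevalE -!integral_nnZ; last 4 first.
  - exact: ltW.
  - by apply: nnZ; [exact: ltW|exact: nn_aVnu].
  - exact: ltW.
  - exact: nn_aVnu.
  apply: le_nn_integral.
  - by apply: nnM; exact: nn_aVh.
  - by do 2![apply: nnZ; first exact: ltW]; exact: nn_aVnu.
  apply: aeW => x; rewrite [X in (_ <= X)%E](_ : _ =
    aVh h x * ((rnorm h)%:E * (CB * nu x)%:E))%E.
    by apply: lee_wpmul2l; [rewrite lee_fin rnorm_ge0|exact: aV_le].
  by rewrite -!EFinM; congr (_%:E); ring.
by rewrite lee_pmul2l// lte_fin.
Qed.

Lemma N1_eq0 h : N1 h = 0%E -> h = 0.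
Proof.
move=> h0; have := rnorm_le_N1 h; rewrite h0 mule0 lee_fin => le0.
by apply/eqP; rewrite -rnorm_eq0 eq_le le0 rnorm_ge0.
Qed.

Lemma dot_N1 h u : ((rnorm (dot h u))%:E <= (CB * rnorm u)%:E * N1 h)%E.
Proof.
apply: (@le_trans _ _ ((rnorm u)%:E * (rnorm h)%:E)%E).
  by rewrite -EFinM lee_fin mulrC CS.
rewrite mulrC EFinM -muleA; apply: lee_wpmul2l; first by rewrite lee_fin rnorm_ge0.
exact: rnorm_le_N1.
Qed.

Lemma dot_ext g h : (forall u, dot g u = dot h u) -> g = h.
Proof.
move=> E; apply/eqP; rewrite -subr_eq0 -rnorm_eq0 -sqrf_eq0 -(dot_self dot_norm).
by rewrite dotBl E subrr.
Qed.

End weighted_norm.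

(** * Solid quasi-Banach function spaces *)

Section solid_spaces.
Context (R : realType) (X : ptopologicalType).
Variable mu : {measure set (borel X) -> \bar R}.
Local Notation BX := (borel X).
Hypothesis sfmu : sigma_finite [set: BX] mu.
Variables (Y : set (BX -> R[i])) (q : (BX -> R[i]) -> R) (CY : R).
Hypotheses (Y_qbf : qbf_space mu Y q CY) (Y_solid : solid mu Y q).
Hypothesis CY_ge1 : 1 <= CY.
Implicit Types (F W : BX -> R[i]) (G : BX -> \bar R).

Let CY_ge0 : 0 <= CY. Proof. exact: le_trans CY_ge1. Qed.

Lemma q_0 : q (fun=> 0) = 0.
Proof.
have := qbf_homog Y_qbf 0 (qbf_0 Y_qbf); rewrite rnorm0 [0 * q _]mul0r => <-.
by congr q; apply/funext => x; rewrite mul0r.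
Qed.

Lemma Ynorm_lty F : (Ynorm Y q F < +oo)%E <-> Y F.
Proof. by rewrite /Ynorm; case: asboolP => [YF|nY]; split => //; rewrite ?ltry ?ltxx. Qed.

Lemma YnormE F : Y F -> Ynorm Y q F = (q F)%:E.
Proof. by move=> YF; rewrite /Ynorm; case: asboolP. Qed.

Lemma solid_abs F : Y F ->
  Y (fun x => (rnorm (F x))%:C%C) /\ q (fun x => (rnorm (F x))%:C%C) = q F.
Proof.
move=> YF; have mF := qbf_measurable Y_qbf YF.
have mA : cmeasurable (fun x => (rnorm (F x))%:C%C).
  by apply: cmeasurable_real; exact: measurable_rnorm.
have nA x : rnorm (rnorm (F x))%:C%C = rnorm (F x).
  by rewrite rnorm_real ger0_norm// rnorm_ge0.
have [YA qA] := Y_solid mA YF (ae_all mu (fun x => eq_ind _ (fun t => t <= _) (lexx _) _ (esym (nA x)))).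
split => //; apply/eqP; rewrite eq_le qA/=.
have [_ //] := Y_solid mF YA (ae_all mu (fun x => eq_ind _ (fun t => _ <= t) (lexx _) _ (esym (nA x)))).
Qed.

(** [G] need not be measurable here, so that solidity can be applied after all
    pointwise estimates are done. *)
Definition Ydom G (c : R) := exists F, [/\ Y F, q F <= c &
  \forall x \ae mu, (G x <= (rnorm (F x))%:E)%E].

Lemma Ydom_abs F : Y F -> Ydom (fun x => (rnorm (F x))%:E) (q F).
Proof. by move=> YF; exists F; split => //; exact: ae_all. Qed.

Lemma Ydom_solid W c : cmeasurable W -> Ydom (fun x => (rnorm (W x))%:E) c ->
  Y W /\ q W <= c.
Proof.
move=> mW [F [YF qF le]].
have [|YW qW] := Y_solid mW YF; first by apply: (ae_imp le) => x; rewrite lee_fin.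
by split => //; exact: le_trans qF.
Qed.

Lemma Ydom_le G G' c c' : (\forall x \ae mu, (G x <= G' x)%E) -> c <= c' ->
  Ydom G' c -> Ydom G c'.
Proof.
move=> GG' cc' [F [YF qF le]]; exists F; split => //; first exact: le_trans cc'.
by apply: (ae_imp2 GG' le) => x; exact: le_trans.
Qed.

Lemma Ydom_ge0 G c : Ydom G c -> 0 <= c.
Proof. by move=> [F [YF qF _]]; exact: le_trans (qbf_ge0 Y_qbf YF) qF. Qed.

Lemma YdomD G G' c c' : Ydom G c -> Ydom G' c' ->
  Ydom (fun x => (G x + G' x)%E) (CY * (c + c')).
Proof.
move=> [F [YF qF le]] [F' [YF' qF' le']].
have [YA qA] := solid_abs YF; have [YA' qA'] := solid_abs YF'.
exists (fun x => (rnorm (F x))%:C%C + (rnorm (F' x))%:C%C); split.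
- exact: (qbf_D Y_qbf YA YA').
- apply: le_trans (qbf_triangle Y_qbf YA YA') _; rewrite qA qA'.
  by apply: ler_wpM2l => //; exact: lerD.
- apply: (ae_imp2 le le') => x lx lx'; rewrite -rmorphD rnorm_real.
  by rewrite ger0_norm ?addr_ge0 ?rnorm_ge0// EFinD; exact: leeD.
Qed.

Lemma YdomZ G c t : 0 <= t -> Ydom G c -> Ydom (fun x => (t%:E * G x)%E) (t * c).
Proof.
move=> t0 [F [YF qF le]].
exists (fun x => t%:C%C * F x); split.
- exact: (qbf_Z Y_qbf _ YF).
- by rewrite (qbf_homog Y_qbf _ YF) rnorm_real ger0_norm// ler_wpM2l.
- apply: (ae_imp le) => x lx; rewrite rnormM rnorm_real ger0_norm// EFinM.
  by apply: lee_wpmul2l.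
Qed.

(** * Positive kernels *)

Let fineZ (t : R) (v : \bar R) : 0 < t -> (0 <= v)%E -> fine (t%:E * v) = t * fine v.
Proof.
by move=> t0; case: v => [v| |]//= _; rewrite mulry gtr0_sg// mul1e/= mulr0.
Qed.

Lemma kapply_real (k : BX -> BX -> R) (g : BX -> R) x :
  kapply mu (fun x y => (k x y)%:C%C) (fun y => (g y)%:C%C) x =
  (fine (kop mu k (fun y => (g y)%:E) x))%:C%C.
Proof.
rewrite /kapply /cintegral /kop; congr Complex.
  rewrite /Rintegral; congr fine; apply: eq_integral => y _.
  by rewrite -EFinM -rmorphM.
rewrite /Rintegral (eq_integral (cst 0%E)) ?integral0// => y _.
by rewrite -rmorphM.
Qed.

(** The bound on [k] as an operator concerns complex functions; it is applied to
    the modulus of a dominating function. *)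
Lemma Ydom_kop (k : BX -> BX -> R) (c : R) G e : pos_kernel k -> 0 <= c ->
  bounded_on mu Y q (fun x y => (k x y)%:C%C) ->
  (op_norm mu Y q (fun x y => (k x y)%:C%C) <= c%:E)%E ->
  nn_measurable G -> Ydom G e -> Ydom (kop mu k G) (c * e).
Proof.
move=> pk c0 [bi bY _] bc nG [F [YF qF le]].
set K := fun x y => _ in bi bY bc.
have [YA qA] := solid_abs YF; set A := fun x => (rnorm (F x))%:C%C in YA qA.
have nA : nn_measurable (fun x => (rnorm (F x))%:E).
  by apply: nn_rnorm; exact: (qbf_measurable Y_qbf YF).
have YKA := bY _ YA.
have KA x : rnorm (kapply mu K A x) = fine (kop mu k (fun y => (rnorm (F y))%:E) x).
  rewrite kapply_real rnorm_real ger0_norm// fine_ge0//.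
  exact: (nn_kop sfmu pk nA).2.
have q0 := qbf_ge0 Y_qbf YA.
have qKA : q (kapply mu K A) <= c * q F.
  rewrite -qA; have [qz|qnz] := eqVneq (q A) 0.
    have A0 := qbf_eq0 Y_qbf YA qz.
    have -> : kapply mu K A = fun=> 0.
      apply/funext => x; apply/eqP; rewrite -rnorm_eq0 KA; apply/eqP.
      rewrite (_ : kop _ _ _ _ = 0%E)//; apply/eqP; rewrite eq_le.
      rewrite (nn_kop sfmu pk nA).2 andbT.
      apply: (@le_trans _ _ (kop mu k (fun=> 0%E) x)).
        have n0 : nn_measurable (fun=> 0%E : \bar R).
          by split; [exact: measurable_cst|by []].
        apply: le_kop => //; apply: (ae_imp A0) => y /eqP; rewrite /A => /eqP Ay; rewrite lee_fin.
        by have := congr1 (@complex.Re R) Ay => /= ->.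
      by rewrite /kop; under eq_integral do rewrite mule0; rewrite integral0.
    by rewrite q_0 qz mulr0.
  have qp : 0 < q A by rewrite lt_neqAle eq_sym qnz.
  set t := (q A)^-1; have t0 : 0 < t by rewrite invr_gt0.
  have YtA := qbf_Z Y_qbf t%:C%C YA.
  have E : kapply mu K (fun x => t%:C%C * A x) = fun x => t%:C%C * kapply mu K A x.
    apply/funext => x.
    have -> : (fun x => t%:C%C * A x) = fun x => (t * rnorm (F x))%:C%C.
      by apply/funext => y; rewrite -rmorphM.
    rewrite !kapply_real -rmorphM; congr (_%:C%C).
    rewrite -fineZ//; last exact: (nn_kop sfmu pk nA).2.
    congr fine; rewrite /kop -integral_nnZ; [|exact: ltW|exact: nn_kopP].
    by apply: eq_integral => y _; rewrite EFinM muleCA.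
  have : (Ynorm Y q (kapply mu K (fun x => t%:C%C * A x)%R) <= c%:E)%E.
    apply: le_trans bc; apply: ereal_sup_ubound.
    exists (fun x => t%:C%C * A x) => //; split => //.
    by rewrite (qbf_homog Y_qbf _ YA) rnorm_real (ger0_norm (ltW t0)) /t mulVf.
  rewrite E /Ynorm; case: asboolP => [_|]; last by move=> n; exfalso; apply/n/(qbf_Z Y_qbf).
  rewrite lee_fin (qbf_homog Y_qbf _ YKA) rnorm_real (ger0_norm (ltW t0)) /t.
  by rewrite ler_pdivrMl// mulrC.
exists (kapply mu K A); split => //.
  by apply: (le_trans qKA); exact: ler_wpM2l.
apply: (ae_imp (bi _ YA)) => x [_ ix]; rewrite KA fineK.
  by apply: le_kop.
rewrite ge0_fin_numE; last exact: (nn_kop sfmu pk nA).2.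
have /integrableP[_] := ix; congr (_ < _)%E; apply: eq_integral => y _.
rewrite gee0_abs ?lee_fin ?rnorm_ge0// /K /A -rmorphM rnorm_real.
by rewrite ger0_norm ?EFinM// mulr_ge0 ?rnorm_ge0//; exact: pk.2.
Qed.

(** * Geometric series *)

Lemma q_sum (F : nat -> BX -> R[i]) n m : (forall k, Y (F k)) ->
  Y (fun x => \sum_(n <= k < n + m) F k x) /\
  q (fun x => \sum_(n <= k < n + m) F k x) <=
    \sum_(0 <= k < m) CY ^+ k.+1 * q (F (n + k)%N).
Proof.
move=> YF; elim: m n => [|m IH] n.
  rewrite addn0 big_nil.
  have -> : (fun x => \sum_(n <= k < n) F k x) = fun=> 0.
    by apply/funext => x; rewrite big_geq.
  by rewrite q_0; split => //; exact: qbf_0 Y_qbf.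
have -> : (fun x => \sum_(n <= k < n + m.+1) F k x) =
    (fun x => F n x + \sum_(n.+1 <= k < n.+1 + m) F k x).
  by apply/funext => x; rewrite big_ltn ?addSnnS// -addSnnS leq_addr.
have [YS qS] := IH n.+1; split; first exact: (qbf_D Y_qbf).
apply: (le_trans (qbf_triangle Y_qbf (YF n) YS)).
rewrite big_nat_recl// addn0 expr1 mulrDr lerD2l.
apply: (le_trans (ler_wpM2l CY_ge0 qS)); rewrite mulr_sumr; apply: ler_sum => k _.
by rewrite mulrA -exprS addSnnS.
Qed.

Let half_power (t : R) : 0 <= t -> t < 1 -> exists m, CY * t ^+ m <= 2^-1.
Proof.
move=> t0 t1; have e0 : 0 < (2 * CY)^-1.
  by rewrite invr_gt0 mulr_gt0//; exact: lt_le_trans CY_ge1.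
have : t ^+ n @[n --> \oo] --> (0 : R) by apply: cvg_expr; rewrite ger0_norm.
move=> /cvgrPdist_le/(_ _ e0)[m _ /(_ m (leqnn m))] /=.
rewrite sub0r normrN ger0_norm ?exprn_ge0// => le; exists m.
apply: (le_trans (ler_wpM2l CY_ge0 le)).
by rewrite invfM mulrCA mulfV ?mulr1// gt_eqF//; exact: lt_le_trans CY_ge1.
Qed.

Let half_sum (t : R) p : 0 <= t -> t <= 2^-1 -> \sum_(0 <= k < p) t ^+ k <= 2.
Proof.
move=> t0 t2; have t1 : t < 1 by apply: (le_lt_trans t2); rewrite invf_lt1// ltr1n.
have := esum_geometric t0 t1; set s := \sum_(_ <= _ < _) _ => le.
have : s <= (1 - t)^-1.
  rewrite -lee_fin; apply: le_trans le; rewrite /s -sumEFin.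
  have -> : (\sum_(0 <= k < p) (t ^+ k)%:E = \sum_(k <- [fset k in iota 0 p]%fset) (t ^+ k)%:E)%E.
    apply: perm_big; apply: uniq_perm; [exact: iota_uniq|exact: fset_uniq|].
    by move=> k; rewrite inE/= /index_iota subn0.
  by apply: esum_ge_fset => k; rewrite lee_fin exprn_ge0.
move/le_trans; apply; rewrite invf_ple ?posrE ?subr_gt0//.
by rewrite lerBrDl -lerBrDr; apply: (le_trans t2); rewrite [leRHS](_ : _ = 2^-1)//; lra.
Qed.

(** Completeness gives a limit of the sequence; solidity and monotonicity force it
    to dominate every term almost everywhere. *)
Lemma Ydom_increasing (P : nat -> BX -> R) (c d : R) : 0 <= c -> 0 <= d -> d < 1 ->
  (forall n, Y (fun x => (P n x)%:C%C)) -> (forall n x, 0 <= P n x) ->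
  (forall n p x, P n x <= P (n + p)%N x) ->
  (forall n p, q (fun x => (P (n + p)%N x)%:C%C - (P n x)%:C%C) <= c * d ^+ n) ->
  q (fun x => (P 0%N x)%:C%C) = 0 ->
  exists F, [/\ Y F, q F <= CY * c & \forall x \ae mu, forall n, P n x <= rnorm (F x)].
Proof.
move=> c0 d0 d1 YP P0 ndP qP qP0.
have YB F F' : Y F -> Y F' -> Y (fun x => F x - F' x).
  move=> YF YF'; have := qbf_D Y_qbf YF (qbf_Z Y_qbf (-1) YF').
  by congr Y; apply/funext => x; rewrite mulN1r.
have qC F F' : Y F -> Y F' -> q (fun x => F x - F' x) = q (fun x => F' x - F x).
  move=> YF YF'; have := qbf_homog Y_qbf (-1) (YB _ _ YF' YF).
  rewrite rnormN rnorm1 mul1r => <-; congr q; apply/funext => x.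
  by rewrite mulN1r opprB.
have [|F YF limF] := qbf_complete Y_qbf YP.
  move=> e e0; have : d ^+ n @[n --> \oo] --> (0 : R) by apply: cvg_expr; rewrite ger0_norm.
  have c1 : 0 < c + 1 by rewrite ltr_wpDl.
  have ec : 0 < e / (c + 1) by rewrite divr_gt0.
  move=> /cvgrPdist_lt/(_ _ ec)[N _ HN]; exists N.
  have key n p : (N <= n)%N -> q (fun x => (P (n + p)%N x)%:C%C - (P n x)%:C%C) < e.
    move=> /HN/=; rewrite sub0r normrN ger0_norm ?exprn_ge0// ltr_pdivlMr// => lt.
    apply: (le_lt_trans (qP n p)); apply: le_lt_trans lt; rewrite mulrC.
    by apply: ler_wpM2l; rewrite ?exprn_ge0// lerDl.
  move=> m n Nm Nn; have [mn|/ltnW nm] := leqP m n.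
    by rewrite qC// -(subnKC mn); exact: key.
  by rewrite -(subnKC nm); exact: key.
have small n e : 0 < e -> exists2 l, (n <= l)%N & q (fun x => (P l x)%:C%C - F x) < e.
  move=> e0; move: limF => /cvgrPdist_lt/(_ _ e0)[N _ HN].
  exists (maxn n N); first exact: leq_maxl.
  have /= := HN (maxn n N) (leq_maxr _ _); rewrite sub0r normrN ger0_norm//.
  by apply: (qbf_ge0 Y_qbf); exact: YB.
exists F; split => //.
  apply/ler_addgt0Pr => e e0.
  have e2 : 0 < e / CY by rewrite divr_gt0//; exact: lt_le_trans CY_ge1.
  have [l _ ql] := small 0%N _ e2.
  have -> : F = fun x => (F x - (P l x)%:C%C) + (P l x)%:C%C.
    by apply/funext => x; rewrite subrK.
  apply: (le_trans (qbf_triangle Y_qbf (YB _ _ YF (YP l)) (YP l))).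
  rewrite qC// mulrDr addrC; apply: lerD.
    apply: ler_wpM2l => //; have := qP 0%N l; rewrite expr0 mulr1 add0n.
    have P00 := qbf_eq0 Y_qbf (YP 0%N) qP0.
    suff -> : q (fun x => (P l x)%:C%C) = q (fun x => (P l x)%:C%C - (P 0%N x)%:C%C) by [].
    apply: (qbf_ae Y_qbf (YB _ _ (YP l) (YP 0%N)) _ _).2.
      exact: (qbf_measurable Y_qbf (YP l)).
    by apply: (ae_imp P00) => x ->; rewrite subr0.
  by move: (ltW ql); rewrite ler_pdivlMr ?(lt_le_trans _ CY_ge1)// mulrC.
apply/ae_foralln => n.
pose w x := Num.max 0 (P n x - rnorm (F x)).
have mP : measurable_fun [set: BX] (P n) by have [] := qbf_measurable Y_qbf (YP n).
have mw : cmeasurable (fun x => (w x)%:C%C).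
  apply: cmeasurable_real; apply: measurable_maxr => //.
  by apply: measurable_funB => //; apply: measurable_rnorm; exact: (qbf_measurable Y_qbf YF).
have wle l : (n <= l)%N -> Y (fun x => (w x)%:C%C) /\
    q (fun x => (w x)%:C%C) <= q (fun x => (P l x)%:C%C - F x).
  move=> nl; apply: Y_solid => //; first exact: YB.
  apply: ae_all => x; rewrite rnorm_real ger0_norm ?le_max ?lexx//.
  rewrite ge_max rnorm_ge0/= lerBlDr.
  apply: le_trans (rnorm_le_dist _ _); rewrite rnorm_real ger0_norm//.
  by rewrite -(subnKC nl).
have [Yw _] := wle n (leqnn n).
have qw0 : q (fun x => (w x)%:C%C) = 0.
  apply/eqP; rewrite eq_le (qbf_ge0 Y_qbf Yw) andbT; apply/ler_addgt0Pr => e e0.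
  rewrite add0r; have [l nl ql] := small n e e0.
  exact: le_trans (wle l nl).2 (ltW ql).
apply: (ae_imp (qbf_eq0 Y_qbf Yw qw0)) => x /(congr1 (@complex.Re R)) /= wx.
by rewrite -subr_le0 -wx le_max lexx orbT.
Qed.

(** The quasi-triangle inequality loses a factor [CY] per summand, which a ratio [t]
    close to 1 does not absorb.  Grouping [m] consecutive terms with
    [CY * t ^ m <= 1/2] makes it absorb the loss. *)
Lemma Ydom_series (t : R) : 0 <= t -> t < 1 -> exists2 C : R, 0 <= C &
  forall (G : nat -> BX -> \bar R) a, 0 <= a -> (forall k x, 0 <= G k x)%E ->
    (forall k, Ydom (G k) (t ^+ k * a)) ->
    Ydom (fun x => \esum_(k in [set: nat]) G k x)%E (C * a).
Proof.
move=> t0 t1; have [m mh] := half_power t0 t1.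
pose D := \sum_(0 <= k < m) CY ^+ k.+1.
have D0 : 0 <= D by apply: sumr_ge0 => k _; rewrite exprn_ge0.
exists (CY * (2 * CY * D)); first by rewrite !mulr_ge0.
move=> G a a0 G0 dG; have /choice[F HF] := dG.
have YF k := let: And3 y _ _ := HF k in y.
have qF k : q (F k) <= t ^+ k * a by have [] := HF k.
have GF : \forall x \ae mu, forall k, (G k x <= (rnorm (F k x))%:E)%E.
  by apply/ae_foralln => k; have [] := HF k.
pose A k x := (rnorm (F k x))%:C%C.
have YA k : Y (A k) by have [] := solid_abs (YF k).
have qA k : q (A k) <= t ^+ k * a by have [_ ->] := solid_abs (YF k).
pose P n x := \sum_(0 <= k < n * m) rnorm (F k x).
have PE n x : (P n x)%:C%C = \sum_(0 <= k < n * m) A k x by rewrite rmorph_sum.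
pose B j x := \sum_(j * m <= k < j * m + m) A k x.
have YB j : Y (B j) by have [] := q_sum (j * m) m YA.
have qB j : q (B j) <= D * (t ^+ m) ^+ j * a.
  have [_ le] := q_sum (j * m) m YA; apply: (le_trans le).
  rewrite /D !mulr_suml; apply: ler_sum => k _.
  rewrite -mulrA; apply: ler_wpM2l; first exact: exprn_ge0.
  apply: (le_trans (qA _)); apply: ler_wpM2r => //.
  rewrite exprD -exprM [(m * j)%N]mulnC ler_piMr ?exprn_ge0//.
  by rewrite exprn_ile1// ltW.
have PB n p x : (P (n + p)%N x)%:C%C - (P n x)%:C%C = \sum_(n <= j < n + p) B j x.
  elim: p => [|p IH]; first by rewrite addn0 subrr big_geq.
  rewrite addnS big_nat_recr/= ?leq_addr// -IH !PE mulSn addnC.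
  rewrite (big_cat_nat _ (n := ((n + p) * m)%N))//= ?leq_addr//.
  by rewrite addrAC /B.
have [F0 [YF0 qF0 leF0]] : exists F0, [/\ Y F0, q F0 <= CY * (2 * CY * D * a) &
    \forall x \ae mu, forall n, P n x <= rnorm (F0 x)].
  apply: (@Ydom_increasing P _ (t ^+ m)).
  - by rewrite !mulr_ge0.
  - exact: exprn_ge0.
  - apply: (le_lt_trans (y := 2^-1)); last by rewrite invf_lt1// ltr1n.
    by apply: le_trans mh; rewrite ler_peMl// exprn_ge0.
  - move=> n; have -> : (fun x => (P n x)%:C%C) = fun x => \sum_(0 <= k < 0 + n * m) A k x.
      by apply/funext => x; rewrite PE add0n.
    by have [] := q_sum 0 (n * m) YA.
  - by move=> n x; apply: sumr_ge0 => k _; exact: rnorm_ge0.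
  - move=> n p x; rewrite /P [leRHS](big_cat_nat _ (n := (n * m)%N))//=; last first.
      by rewrite leq_mul2r leq_addr orbT.
    by rewrite lerDl; apply: sumr_ge0 => k _; exact: rnorm_ge0.
  - move=> n p; have -> : (fun x => (P (n + p)%N x)%:C%C - (P n x)%:C%C) =
        fun x => \sum_(n <= j < n + p) B j x by apply/funext => x; exact: PB.
    have [_ le] := q_sum n p YB; apply: (le_trans le).
    apply: (@le_trans _ _ (\sum_(0 <= k < p)
       ((CY * t ^+ m) ^+ k * (CY * D * a * (t ^+ m) ^+ n)))).
      apply: ler_sum => k _; apply: (le_trans (ler_wpM2l (exprn_ge0 _ CY_ge0) (qB _))).
      by rewrite exprMn exprD exprS le_eqVlt; apply/orP; left; apply/eqP; ring.
    rewrite -mulr_suml [leRHS](_ : _ = 2 * (CY * D * a * (t ^+ m) ^+ n)); last by ring.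
    apply: ler_wpM2r; first by rewrite !mulr_ge0 ?exprn_ge0.
    by apply: half_sum => //; rewrite mulr_ge0 ?exprn_ge0.
  - by rewrite (_ : (fun x => _) = fun=> 0) ?q_0//; apply/funext => x; rewrite PE mul0n big_geq.
exists F0; split => //; first by rewrite -mulrA.
apply: (ae_imp2 GF leF0) => x Gx Px.
apply: esum_le_bound => // K _.
have [N HN] := seq_bounded (enum_fset K) id.
have m0 : (0 < m)%N.
  rewrite lt0n; apply/eqP => m0; move: mh; rewrite m0 expr0 mulr1 => /(le_trans CY_ge1).
  by rewrite leNgt invf_lt1// ltr1n.
apply: (@le_trans _ _ (P N x)%:E); last by rewrite lee_fin.
apply: (@le_trans _ _ (\sum_(k <- K) (rnorm (F k x))%:E)%E); first exact: lee_sum.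
rewrite /P -sumEFin; apply: (@lee_sum_fset_nat _ (fun k => (rnorm (F k x))%:E) K (N * m)%N xpredT).
  by move=> k _; rewrite lee_fin rnorm_ge0.
by move=> k /= /HN lt; apply: (leq_trans lt); exact: leq_pmulr.
Qed.

End solid_spaces.

Section discretized_frame.
Context (R : realType) (H : completeNormedModType R[i]) (dot : {dot H for conjC}).
Hypothesis dot_norm : forall h : H, `|h| ^+ 2 = dot h h.
Context (X : ptopologicalType) (mu : {measure set (borel X) -> \bar R}).
Local Notation BX := (borel X).
Hypotheses (X_hausdorff : hausdorff_space X) (X_sigma_compact : sigma_compact X).
Hypotheses (mu_radon : radon_measure mu) (mu_support : full_support mu).
Variables (phi : BX -> H) (nu : BX -> R).
Hypotheses (phi_frame : parseval_frame mu dot phi) (nu_weight : weight nu).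
Variable CB : R.
Hypotheses (CB_gt0 : 0 < CB) (phi_le : forall x, rnorm (phi x) <= CB * nu x).
Local Notation N1 h := (wnorm dot mu phi nu h%R).
Local Notation aVh h := (aV phi (emb dot h)).
Hypothesis phi_H1 : forall x, (N1 (phi x) < +oo)%E.
Implicit Types (f : H -> R[i]) (g h u : H).

Let sfmu := radon_sigma_finite X_hausdorff X_sigma_compact mu_radon.
Let nn_aVh h : nn_measurable (aVh h) := nn_aVh phi_frame h.
Let nn_aVnu h := nn_aVnu phi_frame nu_weight h.
Let nn_nu := nn_weight nu_weight.
Let nu_ge0 x : 0 <= nu x. Proof. exact/ltW/weight_gt0. Qed.
Let dotDl := dotDl dot.
Let dotDr := dotDr dot.
Let dotBl := dotBl dot.
Let dotBr := dotBr dot.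
Let dotZl := dotZl dot.
Let dotZr := dotZr dot.
Let dotC := dotC dot.

(** * Absolutely convergent sums *)

(** The error of a partial sum is at most the sum of the remaining norms, which is
    all that absolute convergence is used for. *)
Definition hsum (J : choiceType) (g : J -> H) h := forall K : {fset J},
  (N1 (h - \sum_(j <- K) g j) <= \esum_(j in ~` [set` K]) N1 (g j))%E.

(** Partial sums are Cauchy in [H], since [N1] dominates the norm.  The voice transform
    of the limit is at every point the sum of those of the terms, and integrating its
    tails gives the bound in [N1]. *)
Lemma hsum_exists (J : choiceType) (g : J -> H) : countable [set: J] ->
  (\esum_(j in [set: J]) N1 (g j) < +oo)%E -> exists h, hsum g h.
Proof.
move=> cJ gfin.
have g0 j : (0 <= N1 (g j))%E by exact: N1_ge0.
have tail (e : R) : 0 < e -> exists K0 : {fset J}, forall K, (K0 `<=` K)%fset ->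
    rnorm (\sum_(j <- K) g j - \sum_(j <- K0) g j) <= e.
  move=> e0; have [|K0 HK] := esum_tail_small g0 gfin (e := e / CB).
    by rewrite divr_gt0.
  exists K0 => K K0K; rewrite -lee_fin.
  have -> : \sum_(j <- K) g j - \sum_(j <- K0) g j = \sum_(j <- (K `\` K0)%fset) g j.
    rewrite [X in X - _](big_fsetID _ (mem K0))/=.
    rewrite (_ : [fset x in K | x \in K0]%fset = K0); last first.
      apply/fsetP => i; rewrite !inE/=.
      case: (boolP (i \in K0)) => iK; rewrite ?andbF//.
      by rewrite (fsubsetP K0K).
    rewrite (_ : [fset x in K | x \notin K0]%fset = (K `\` K0)%fset) 1?addrC ?addrK ?addKr//.
    by apply/fsetP => i; rewrite !inE/= andbC.
  apply: (le_trans (rnorm_le_N1 dot_norm phi_frame nu_weight CB_gt0 phi_le _)).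
  have H0 := HK _ (fsubset_refl K0).
  rewrite -lee_pdivlMl//.
  apply: (@le_trans _ _ (e / CB)%:E); last by rewrite -EFinM lee_fin mulrC.
  apply: le_trans H0; rewrite (le_trans (N1_sum _ _ _ _))//.
  apply: esum_ge; exists [set` (K `\` K0)%fset].
    split; first exact: finite_fset.
    by move=> i /=; rewrite in_fsetD => /andP[/negP].
  by rewrite fsbig_finite//= set_fsetK.
pose F : set_system H := (fun K : {fset J} => \sum_(j <- K) g j) @ summability.totally.
have FF : ProperFilter F.
  by apply: fmap_proper_filter; exact: summability.totally_filter.
have Fc : cauchy F.
  apply: cauchy_exP => e e0; have eE : e = (complex.Re e)%:C%C by rewrite RRe_real// gtr0_real.
  have e0' : 0 < complex.Re e by rewrite -ltcR -eE.
  have [|K0 HK] := tail (complex.Re e / 2); first by rewrite divr_gt0.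
  exists (\sum_(j <- K0) g j); exists K0 => // K /= K0K.
  rewrite -ball_normE/= eE rnormE ltcR rdistC.
  by apply: le_lt_trans (HK _ K0K) _; rewrite ltr_pdivrMr// ltr_pMr// ltr1n.
have /cvg_ex[h /= Fh] : cvg F by exact: cauchy_cvg.
exists h.
have lim (e : R) : 0 < e -> exists K0 : {fset J}, forall K, (K0 `<=` K)%fset ->
    rnorm (h - \sum_(j <- K) g j) <= e.
  move=> e0; have e0C : 0 < e%:C%C :> R[i] by rewrite ltcR.
  have [K0 _ HK] : \forall K \near summability.totally,
      `|h - \sum_(j <- (K : {fset J})) g j| < e%:C%C.
    have tF := @summability.totally_filter J.
    by move: Fh => /cvgrPdist_lt; apply.
  by exists K0 => K /HK /=; rewrite rnormE ltcR => /ltW.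
have hx x : csum (fun j => dot (g j) (phi x)) (dot h (phi x)).
  move=> e e0; have px : 0 < rnorm (phi x) + 1 by rewrite ltr_wpDl ?rnorm_ge0.
  have [|K0 HK] := lim (e / (rnorm (phi x) + 1)); first by rewrite divr_gt0.
  exists K0 => K /HK; rewrite ler_pdivlMr// => le.
  rewrite -dot_suml -dotBl; apply: le_trans (CS dot_norm _ _) (le_trans _ le).
  by rewrite ler_wpM2l ?rnorm_ge0// lerDl.
move=> K; pose G j x := (aVh (g j) x * (nu x)%:E)%E.
apply: (@le_trans _ _ (\int[mu]_x (\esum_(j in ~` [set` K]) G j x))%E); last first.
  rewrite integral_esum// => [j x|j]; [exact: (nn_aVnu _).2|exact: (nn_aVnu _).1].
apply: le_nn_integral; first exact: nn_aVnu.
  split => [|x]; last by apply: esum_ge0 => j _; exact: (nn_aVnu _).2.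
  by apply: measurable_esum => // [j x|j]; [exact: (nn_aVnu _).2|exact: (nn_aVnu _).1].
apply: aeW => x; rewrite /G.
under eq_esum do rewrite muleC.
rewrite ge0_esumZl// 1?muleC; last by move=> j; exact: (nn_aVh _).2.
apply: lee_wpmul2l; first by rewrite lee_fin.
by rewrite /aV /emb dotBl dot_suml; exact: csum_tail.
Qed.

Lemma hsum_N1 (J : choiceType) (g : J -> H) h : hsum g h ->
  (N1 h <= \esum_(j in [set: J]) N1 (g j))%E.
Proof.
move=> gh; have := gh fset0; rewrite big_seq_fset0 subr0 => /le_trans; apply.
by apply: le_esum_set => // j; exact: N1_ge0.
Qed.

Definition bounded_additive (L : H -> R[i]) (M : R) :=
  (forall g h, (N1 g < +oo)%E -> (N1 h < +oo)%E -> L (g - h) = L g - L h) /\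
  (forall h, (N1 h < +oo)%E -> ((rnorm (L h))%:E <= M%:E * N1 h)%E).

Lemma bounded_additive_sum L M (J : Type) (s : seq J) (g : J -> H) :
  bounded_additive L M -> (forall j, (N1 (g j) < +oo)%E) ->
  L (\sum_(j <- s) g j) = \sum_(j <- s) L (g j).
Proof.
move=> [LB _] gfin; have N0 : (N1 0 < +oo)%E by rewrite N10.
have L0 : L 0 = 0 by rewrite -(subrr 0) LB// subrr.
elim: s => [|j s IH]; first by rewrite !big_nil.
set v := \sum_(j <- s) g j in IH *.
have Nv : (N1 v < +oo)%E by apply: H1_sum.
have Nv' : (N1 (- v) < +oo)%E by rewrite N1N.
rewrite !big_cons -/v -IH -[X in L (_ + X)]opprK (LB _ _ (gfin j) Nv').
by rewrite -[- v]sub0r (LB _ _ N0 Nv) L0 sub0r opprK.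
Qed.

Lemma hsum_csum (J : choiceType) (g : J -> H) h L M : 0 <= M ->
  bounded_additive L M -> (\esum_(j in [set: J]) N1 (g j) < +oo)%E ->
  hsum g h -> csum (fun j => L (g j)) (L h).
Proof.
move=> M0 LM gfin gh e e0.
have g0 j : (0 <= N1 (g j))%E by exact: N1_ge0.
have gj j : (N1 (g j) < +oo)%E by apply: le_lt_trans gfin; exact: esum_ge1.
have M1 : 0 < M + 1 by rewrite ltr_wpDl.
have [|K0 HK] := esum_tail_small g0 gfin (e := e / (M + 1)); first by rewrite divr_gt0.
exists K0 => K /HK le.
have Nh : (N1 h < +oo)%E by apply: le_lt_trans gfin; exact: hsum_N1.
have Nhs : (N1 (h - \sum_(j <- K) g j) <= (e / (M + 1))%:E)%E.
  exact: le_trans (gh K) le.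
have Ns : (N1 (\sum_(j <- K) g j) < +oo)%E by apply: H1_sum.
rewrite -(bounded_additive_sum K LM gj) -(LM.1 _ _ Nh Ns) -lee_fin.
apply: (le_trans (LM.2 _ _)); first exact: le_lt_trans Nhs (ltry _).
apply: (@le_trans _ _ (M%:E * (e / (M + 1))%:E)%E).
  by apply: lee_wpmul2l; rewrite ?lee_fin.
rewrite -EFinM lee_fin mulrA ler_pdivrMr// mulrC ler_wpM2l// ?lerDl//.
exact: ltW.
Qed.

Lemma bounded_additive_dot u : bounded_additive (fun h => dot h u) (CB * rnorm u).
Proof.
split => [g h _ _|h _]; first exact: dotBl.
exact: (dot_N1 dot_norm phi_frame nu_weight CB_gt0 phi_le).
Qed.

Lemma hsum_dot (J : choiceType) (g : J -> H) h u :
  (\esum_(j in [set: J]) N1 (g j) < +oo)%E -> hsum g h ->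
  csum (fun j => dot (g j) u) (dot h u).
Proof.
move=> gfin gh; apply: (hsum_csum _ (bounded_additive_dot u) gfin gh).
by rewrite mulr_ge0 ?rnorm_ge0 ?ltW.
Qed.

(** * Polarization *)

(** After a change of phase the inner product is real and polarization writes it
    by the norms, to which Parseval's identity applies. *)
Lemma dot_le_integral g h :
  ((rnorm (dot g h))%:E <= \int[mu]_x (aVh g x * aVh h x))%E.
Proof.
have [u u1 uL] := exists_phase (dot g h).
have nnp v w : nn_measurable (fun x => aVh v x * aVh w x)%E by exact: nnM.
have -> : (\int[mu]_x (aVh g x * aVh h x) = \int[mu]_x (aVh (u *: g) x * aVh h x))%E.
  by apply: eq_integral => x _; rewrite /aV /emb dotZl rnormM u1 mul1r.
have : (((rnorm (u *: g + h)) ^+ 2)%:E <= ((rnorm (u *: g - h)) ^+ 2)%:E +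
    4%:E * \int[mu]_x (aVh (u *: g) x * aVh h x))%E.
  rewrite !(parsevalE phi_frame) -integral_nnZ// -integral_nnD//; last exact: nnZ.
  apply: le_nn_integral => //; first by apply: nnD => //; exact: nnZ.
  apply: aeW => x; rewrite -!EFinM -EFinD lee_fin /emb dotBl dotDl.
  have := polar_bound (dot (u *: g) (phi x)) (dot h (phi x)) 0 0.
  rewrite subr0 addr0 rnorm0 expr0n/= !addr0 mul0r subr0 rnormM rnormJ -!expr2.
  by rewrite mulrA.
rewrite (sqr_rnormD dot_norm) (sqr_rnormB dot_norm) dotZl uL/=.
set A := rnorm _ ^+ 2 + _; set t := 2 * _; set J := (\int[mu]_x _)%E.
have J0 : (0 <= J)%E by apply: integral_ge0 => x _; exact: (nnp _ _).2.
case: J J0 => [J| |]//; rewrite ?leey// => J0.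
rewrite -EFinM -EFinD !lee_fin /t => le.
exact: polar_arith le.
Qed.

(** * Oscillation bounds at the sampling points *)

Context (I : choiceType) (U : I -> set BX).
Hypothesis adm : admissible_covering (U : I -> set X).
Variable io : BX -> I.
Hypotheses (ioU : forall z, U (io z) z)
  (mio : forall i, measurable (io @^-1` [set i])).
Variables (xs : I -> BX) (Gam : X -> X -> R[i]) (o : BX -> BX -> R).
Local Notation Rk := (frame_kernel dot phi).
Local Notation c_ := (cell mu io).

Let a (x y : BX) : R := rnorm (Rk x y).

Hypotheses (pa : pos_kernel a) (po : pos_kernel o).
Hypothesis Gam1 : forall x y, rnorm (Gam x y) = 1.

Let osc_le (x z : BX) := forall i, U i z ->
  rnorm (Rk x z - Gam z (xs i) * Rk x (xs i)) <= o x z.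

Hypotheses (osc_fst : \forall x \ae mu, \forall z \ae mu, osc_le x z)
  (osc_snd : \forall z \ae mu, \forall x \ae mu, osc_le x z).
Variables (r d ds : R).
Hypotheses (r_ge0 : 0 <= r) (d_ge0 : 0 <= d) (ds_ge0 : 0 <= ds).
Hypotheses (schur_a : schur mu nu a r) (schur_o : schur mu nu o d)
  (schur_os : schur mu nu (ktrans o) ds).

Let aC x y : a x y = a y x. Proof. exact: rnorm_dotC. Qed.
Let ktrans_a : ktrans a = a.
Proof. by apply/funext => x; apply/funext => y; rewrite /ktrans aC. Qed.

Let pao : pos_kernel (fun x y => a x y + o x y)%R.
Proof. exact: pos_kernelD. Qed.

Let pos : pos_kernel (ktrans o). Proof. exact: pos_ktrans. Qed.

Let rnorm_phase (p q c : R[i]) (e : R) : rnorm c = 1 ->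
  rnorm (p - c * q) <= e -> rnorm q <= rnorm p + e.
Proof.
move=> c1 le; rewrite -[rnorm q]mul1r -c1 -rnormM.
by rewrite (le_trans (rnorm_le_dist _ p))// rdistC addrC lerD2l.
Qed.

Definition antilinear f := forall (c : R[i]) g h, (N1 g < +oo)%E -> (N1 h < +oo)%E ->
  f (c *: g + h) = c^*%C * f g + f h.

(** What the estimates use of an anti-dual functional; it holds for vectors by
    [dot_le_integral] and for all anti-dual functionals once the frame is inverted. *)
Definition represented f := [/\ antilinear f, cmeasurable (voice phi f) &
  forall h, (N1 h < +oo)%E ->
    ((rnorm (f h))%:E <= \int[mu]_x (aV phi f x * aVh h x))%E].

Lemma represented_emb h : represented (emb dot h).
Proof.
split; first by move=> c g k _ _; rewrite /emb dotDr dotZr.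
  exact: phi_frame.1.
by move=> g _; exact: dot_le_integral.
Qed.

Let nn_aV f : represented f -> nn_measurable (aV phi f).
Proof. by move=> [_ mf _]; exact: nn_rnorm. Qed.

(** Apply the bound on [f] to [phi_z - Gamma phi_i]: its voice transform is at
    most [osc (., z)]. *)
Lemma osc_voice f : represented f -> \forall z \ae mu, forall i, U i z ->
  (aV phi f (xs i) <= aV phi f z + kop mu (ktrans o) (aV phi f) z)%E.
Proof.
move=> rf; have [lf mf ff] := rf; apply: (ae_imp osc_snd) => z oz i Ui.
pose w := - (Gam z (xs i)) *: phi (xs i) + phi z.
have Nw : (N1 w < +oo)%E by apply: H1D => //; exact: H1Z.
have fw : f w = f (phi z) - (Gam z (xs i))^*%C * f (phi (xs i)).
  by rewrite lf// rmorphN mulNr addrC.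
have : ((rnorm (f w))%:E <= kop mu (ktrans o) (aV phi f) z)%E.
  apply: (le_trans (ff _ Nw)); apply: le_nn_integral.
  - by apply: nnM => //; exact: nn_aV.
  - by apply: nn_kopP => //; exact: nn_aV.
  apply: (ae_imp oz) => y /(_ i Ui) oy.
  rewrite muleC; apply: lee_wpmul2r; first exact: (nn_aV rf).2.
  rewrite lee_fin /emb /w dotDl dotZl mulNr addrC.
  exact: oy.
have /rnorm_phase : rnorm (Gam z (xs i))^*%C = 1 by rewrite rnormJ.
move=> /(_ (f (phi z)) (f (phi (xs i))) (rnorm (f w))); rewrite -fw lexx => /(_ isT).
rewrite -lee_fin EFinD => le1 le2; apply: (le_trans le1).
by rewrite leeD2l.
Qed.

Lemma osc_kernel_bound : \forall z \ae mu, \forall y \ae mu, forall i, U i z ->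
  a y (xs i) <= a y z + o y z.
Proof.
apply: (ae_imp osc_snd) => z; move/ae_imp; apply => y oy i Ui.
exact: rnorm_phase (oy i Ui).
Qed.

(** Hence [nu (z)] controls the norms of the samples from the covering sets at [z]. *)
Lemma osc_N1 : \forall z \ae mu, forall i, U i z ->
  (N1 (phi (xs i)) <= (r + d)%:E * (nu z)%:E)%E.
Proof.
have := schurD pa po nu_weight.1 nu_ge0 schur_a schur_o; rewrite /schur => sao.
apply: (ae_imp2 osc_kernel_bound sao) => z oz sz i Ui; apply: le_trans sz.
rewrite /wnorm; apply: le_nn_integral; first exact: nn_aVnu.
  by apply: nn_kopP => //; exact: pos_ktrans.
by apply: (ae_imp oz) => y /(_ i Ui) oy; apply: lee_wpmul2r; rewrite ?lee_fin.
Qed.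

Let nn_step (g : I -> \bar R) : (forall i, 0 <= g i)%E ->
  nn_measurable (fun z : BX => g (io z)).
Proof.
move=> g0; split => [|z]; last exact: g0.
exact: (measurable_io X_sigma_compact adm mio g).
Qed.

Let cellint := integral_cell X_hausdorff X_sigma_compact mu_radon adm ioU mio.

Let aVnu f := (\int[mu]_x (aV phi f x * (nu x)%:E))%E.

(** The weighted sum is the integral of a step function, whose values are bounded by
    the oscillation at almost every point of the cell. *)
Lemma cell_sum f : represented f ->
  (\esum_(i in [set: I]) ((c_ i)%:E * (aV phi f (xs i) * N1 (phi (xs i)))) <=
   ((r + d) * (1 + ds))%:E * aVnu f)%E.
Proof.
move=> rf; have nf := nn_aV rf; have kf := nn_kop sfmu pos nf.
rewrite -cellint; last by move=> i; rewrite mule_ge0 ?N1_ge0// nf.2.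
have rd0 : 0 <= r + d by rewrite addr_ge0.
pose F z := (aV phi f z + kop mu (ktrans o) (aV phi f) z)%E.
have nF : nn_measurable F by exact: nnD.
apply: (@le_trans _ _ ((r + d)%:E * \int[mu]_z (F z * (nu z)%:E))%E).
  rewrite -integral_nnZ//; last exact: nnM.
  apply: le_nn_integral; last first.
  - apply: (ae_imp2 (osc_voice rf) osc_N1) => z /(_ _ (ioU z)) le1 /(_ _ (ioU z)) le2.
    rewrite muleCA; apply: lee_pmul => //; first exact: nf.2.
    exact: N1_ge0.
  - by apply: nnZ => //; exact: nnM.
  - apply: (nn_step (g := fun i => aV phi f (xs i) * N1 (phi (xs i)))%E) => i.
    by rewrite mule_ge0 ?N1_ge0// nf.2.
rewrite EFinM -muleA; apply: lee_wpmul2l; first by rewrite lee_fin.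
rewrite (eq_integral (fun z => aV phi f z * (nu z)%:E +
   kop mu (ktrans o) (aV phi f) z * (nu z)%:E)%E); last first.
  by move=> z _; rewrite ge0_muleDl ?nf.2 ?kf.2.
rewrite integral_nnD; [|exact: nnM|exact: nnM].
rewrite EFinD ge0_muleDl// mul1e; apply: leeD => //.
by apply: schur_integral => //; exact: nu_weight.1.
Qed.

Lemma cell_sum2 h :
  (\esum_(i in [set: I]) ((c_ i)%:E *
      (N1 (phi (xs i)) * \int[mu]_y (aVh (phi (xs i)) y * aVh h y))) <=
   ((r + d) * (r + ds))%:E * N1 h)%E.
Proof.
have I0 i : (0 <= \int[mu]_y (aVh (phi (xs i)) y * aVh h y))%E.
  by apply: integral_ge0 => y _; rewrite mule_ge0 ?(nn_aVh _).2.
rewrite -cellint; last by move=> i; apply: mule_ge0; [exact: N1_ge0|exact: I0].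
have rd0 : 0 <= r + d by rewrite addr_ge0.
have pt : pos_kernel (ktrans (fun x y => a x y + o x y)%R) by exact: pos_ktrans.
pose F := kop mu (ktrans (fun x y => a x y + o x y)%R) (aVh h).
have nF : nn_measurable F by exact: nn_kop.
apply: (@le_trans _ _ ((r + d)%:E * \int[mu]_z (F z * (nu z)%:E))%E).
  rewrite -integral_nnZ//; last exact: nnM.
  apply: le_nn_integral; last first.
  - apply: (ae_imp2 osc_kernel_bound osc_N1) => z oz /(_ _ (ioU z)) le2.
    rewrite muleCA muleC; apply: lee_pmul => //; first exact: N1_ge0.
    apply: le_nn_integral; [exact: nnM|exact: nn_kopP|].
    apply: (ae_imp oz) => y /(_ _ (ioU z)) oy; apply: lee_wpmul2r.
      exact: (nn_aVh h).2.
    by rewrite lee_fin.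
  - by apply: nnZ => //; exact: nnM.
  - apply: (nn_step (g := fun i => N1 (phi (xs i)) *
      \int[mu]_y (aVh (phi (xs i)) y * aVh h y))%E) => i.
    by apply: mule_ge0; [exact: N1_ge0|exact: I0].
rewrite EFinM -muleA; apply: lee_wpmul2l; first by rewrite lee_fin.
apply: schur_integral => //; [exact: nu_weight.1|exact: addr_ge0|].
have -> : ktrans (fun x y => a x y + o x y) = fun x y => ktrans a x y + ktrans o x y.
  by [].
have sat : schur mu nu (ktrans a) r by rewrite ktrans_a.
by apply: schurD => //; [exact: pos_ktrans|exact: nu_weight.1].
Qed.

(** * The discretized frame operator *)

Definition Scoef h i : H := ((c_ i)%:C%C * dot h (phi (xs i))) *: phi (xs i).

Lemma N1_Scoef h i : N1 (Scoef h i) =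
  ((c_ i)%:E * (aVh h (xs i) * N1 (phi (xs i))))%E.
Proof.
rewrite /Scoef (N1Z phi_frame nu_weight).
by rewrite rnormM rnorm_real ger0_norm ?cell_ge0// EFinM muleA.
Qed.

Let CS := (r + d) * (1 + ds).

Let CS_ge0 : 0 <= CS.
Proof. by rewrite mulr_ge0// addr_ge0. Qed.

Lemma Scoef_sum h : (\esum_(i in [set: I]) N1 (Scoef h i) <= CS%:E * N1 h)%E.
Proof.
under eq_esum do rewrite N1_Scoef.
exact: (cell_sum (represented_emb h)).
Qed.

Let Scoef_fin h : (N1 h < +oo)%E -> (\esum_(i in [set: I]) N1 (Scoef h i) < +oo)%E.
Proof.
move=> Nh; apply: le_lt_trans (Scoef_sum h) _.
by rewrite lte_mul_pinfty// lee_fin.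
Qed.

Let cI : countable [set: I].
Proof. exact: (cover_countable X_sigma_compact adm). Qed.

Lemma exists_Sop : exists S : H -> H, forall h, (N1 h < +oo)%E ->
  hsum (Scoef h) (S h).
Proof.
suff /choice[S HS] : forall h, exists k, (N1 h < +oo)%E -> hsum (Scoef h) k.
  by exists S.
move=> h; have [Nh|Nh] := pselect (N1 h < +oo)%E; last by exists 0.
by have [k hk] := hsum_exists cI (Scoef_fin Nh); exists k.
Qed.

Definition Sop : H -> H := projT1 (cid exists_Sop).

Lemma SopP h : (N1 h < +oo)%E -> hsum (Scoef h) (Sop h).
Proof. exact: (projT2 (cid exists_Sop)). Qed.

Lemma Sop_N1 h : (N1 h < +oo)%E -> (N1 (Sop h) <= CS%:E * N1 h)%E.
Proof. by move=> Nh; rewrite (le_trans (hsum_N1 (SopP Nh)))// Scoef_sum. Qed.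

Lemma Sop_H1 h : (N1 h < +oo)%E -> (N1 (Sop h) < +oo)%E.
Proof.
move=> Nh; apply: le_lt_trans (Sop_N1 Nh) _.
by rewrite lte_mul_pinfty// lee_fin.
Qed.

Lemma Sop_dot h u : (N1 h < +oo)%E -> csum (fun i =>
  (c_ i)%:C%C * dot h (phi (xs i)) * dot (phi (xs i)) u) (dot (Sop h) u).
Proof.
move=> Nh; have := hsum_dot u (Scoef_fin Nh) (SopP Nh).
by apply: eq_csum => i; rewrite /Scoef dotZl.
Qed.

Lemma Sop_linear c g h : (N1 g < +oo)%E -> (N1 h < +oo)%E ->
  Sop (c *: g + h) = c *: Sop g + Sop h.
Proof.
move=> Ng Nh; apply: (dot_ext dot_norm) => u.
have Ns : (N1 (c *: g + h) < +oo)%E by apply: H1D => //; exact: H1Z.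
rewrite dotDl dotZl; apply: (csum_unique (Sop_dot u Ns)).
apply: eq_csum (csumD (csumZ c (Sop_dot u Ng)) (Sop_dot u Nh)) => i.
by rewrite dotDl dotZl; ring.
Qed.

Lemma Sop_adj g h : (N1 g < +oo)%E -> (N1 h < +oo)%E ->
  dot (Sop g) h = dot g (Sop h).
Proof.
move=> Ng Nh; apply: (csum_unique (Sop_dot h Ng)).
rewrite dotC; apply: eq_csum (csum_conj (Sop_dot g Nh)) => i.
by rewrite !conjcM conjc_real -!dotC; ring.
Qed.

(** The quadratic form of [S] is the integral of a step function; this is the discrete
    Parseval identity that polarization needs. *)
Lemma Sop_form h : (N1 h < +oo)%E ->
  (\int[mu]_z (aVh h (xs (io z)) * aVh h (xs (io z))) = (complex.Re (dot (Sop h) h))%:E)%E.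
Proof.
move=> Nh; rewrite -(csum_abs_ge0 (r := fun i => c_ i * rnorm (dot h (phi (xs i))) ^+ 2)).
- rewrite (cellint (a := fun i => aVh h (xs i) * aVh h (xs i))%E) => [|i]; last first.
    by rewrite mule_ge0 ?(nn_aVh _).2.
  by apply: eq_esum => i _; rewrite -!EFinM -expr2.
- by move=> i; rewrite mulr_ge0 ?cell_ge0// sqr_ge0.
- apply: eq_csum (Sop_dot h Nh) => i; rewrite -mulrA (dotC (phi (xs i))).
  by rewrite -sqr_normc rnormE rmorphM rmorphXn.
Qed.

Lemma Sop_sqrD g h (s : R) : (N1 g < +oo)%E -> (N1 h < +oo)%E ->
  complex.Re (dot (Sop (s%:C%C *: h + g)) (s%:C%C *: h + g)) =
  complex.Re (dot (Sop g) g) + s ^+ 2 * complex.Re (dot (Sop h) h) +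
  s * (2 * complex.Re (dot (Sop g) h)).
Proof.
move=> Ng Nh.
rewrite (Sop_linear _ Nh Ng) dotDl !dotDr !dotZl !dotZr conjc_real !cReD !cReZ.
have -> : complex.Re (dot (Sop h) g) = complex.Re (dot (Sop g) h).
  by rewrite (Sop_adj Nh Ng) Re_dotC.
by ring.
Qed.

Lemma cmeasurable_voiceh h : cmeasurable (fun z => dot h (phi z)).
Proof. exact: phi_frame.1. Qed.

Lemma cmeasurable_step (g : I -> R[i]) : cmeasurable (fun z : BX => g (io z)).
Proof.
split.
  have mg := measurable_io X_sigma_compact adm mio (fun i => complex.Re (g i)).
  exact: mg.
have mg := measurable_io X_sigma_compact adm mio (fun i => complex.Im (g i)).
exact: mg.
Qed.

(** Polarize both the inner product and the form of [S]; the difference of the two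
    integrands is bounded pointwise by [polar_bound]. *)
Lemma Sop_error g h : (N1 g < +oo)%E -> (N1 h < +oo)%E ->
  ((rnorm (dot g h - dot (Sop g) h))%:E <= \int[mu]_z
    (rnorm (dot g (phi z) * (dot h (phi z))^*%C -
      dot g (phi (xs (io z))) * (dot h (phi (xs (io z))))^*%C))%:E)%E.
Proof.
move=> Ng0 Nh.
have [u u1 uL] := exists_phase (dot g h - dot (Sop g) h).
pose g' := u *: g; have Ng : (N1 g' < +oo)%E by exact: H1Z.
pose D z := (rnorm (dot g' (phi z) * (dot h (phi z))^*%C -
      dot g' (phi (xs (io z))) * (dot h (phi (xs (io z))))^*%C))%:E : \bar R.
have nD : nn_measurable D.
  apply: nn_rnorm; apply: cmeasurableB.
    by apply: cmeasurableM; [|apply: cmeasurable_conj]; exact: cmeasurable_voiceh.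
  exact: (cmeasurable_step (fun i => dot g' (phi (xs i)) * (dot h (phi (xs i)))^*%C)).
rewrite (eq_integral D); last first.
  move=> z _; rewrite /D /g' !dotZl -!mulrA -mulrBr rnormM u1 mul1r.
  by rewrite [dot g _ * _]mulrC [dot g (phi (xs _)) * _]mulrC.
have Np : (N1 (1%:C%C *: h + g') < +oo)%E by apply: H1D => //; exact: H1Z.
have Nm : (N1 ((-1)%:C%C *: h + g') < +oo)%E by apply: H1D => //; exact: H1Z.
have nst k : nn_measurable (fun z => aVh k (xs (io z)) * aVh k (xs (io z)))%E.
  apply: (nn_step (g := fun i => aVh k (xs i) * aVh k (xs i))%E) => i.
  by rewrite mule_ge0 ?(nn_aVh _).2.
have nsq k : nn_measurable (fun z => aVh k z * aVh k z)%E by exact: nnM.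
have : ((rnorm (1%:C%C *: h + g') ^+ 2)%:E + (complex.Re (dot (Sop ((-1)%:C%C *: h + g')) ((-1)%:C%C *: h + g')))%:E
  <= (rnorm ((-1)%:C%C *: h + g') ^+ 2)%:E + (complex.Re (dot (Sop (1%:C%C *: h + g')) (1%:C%C *: h + g')))%:E
   + 4%:E * \int[mu]_z D z)%E.
  rewrite -!Sop_form// !(parsevalE phi_frame) -integral_nnZ// -!integral_nnD//; last 2 first.
  - exact: nnD.
  - exact: nnZ.
  apply: le_nn_integral; [exact: nnD|by apply: nnD; [exact: nnD|exact: nnZ]|].
  apply: aeW => z; rewrite -!EFinM -!EFinD lee_fin /emb rmorphN1 scale1r scaleN1r.
  rewrite -!expr2 [h + g']addrC [- h + g']addrC !dotDl !(linearNl dot).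
  exact: polar_bound.
rewrite !(Sop_sqrD _ Ng Nh).
rewrite rmorphN1 scale1r scaleN1r [h + g']addrC [- h + g']addrC.
rewrite (sqr_rnormD dot_norm) (sqr_rnormB dot_norm) sqrrN expr1n !mul1r mulN1r.
have -> : rnorm (dot g h - dot (Sop g) h) =
    complex.Re (dot g' h) - complex.Re (dot (Sop g') h).
  rewrite -cReB /g'.
  have -> : Sop (u *: g) = u *: Sop g.
    have N0 : (N1 0 < +oo)%E by rewrite N10.
    have S0 : Sop 0 = 0.
      have := Sop_linear 1 N0 N0; rewrite !scale1r add0r => /esym/eqP.
      by rewrite -subr_eq0 addrK => /eqP.
    by rewrite -[u *: g]addr0 Sop_linear// S0 addr0.
  by rewrite !dotZl -mulrBr uL.
have J0 : (0 <= \int[mu]_z D z)%E by apply: integral_ge0 => z _; exact: nD.2.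
case: (\int[mu]_z D z)%E J0 => [J| |]//; rewrite ?leey// => _.
rewrite -!EFinM -!EFinD !lee_fin; exact: polar_arith2.
Qed.

(** * The error operator is a contraction *)

Definition Top h := h - Sop h.

Lemma Top_H1 h : (N1 h < +oo)%E -> (N1 (Top h) < +oo)%E.
Proof. by move=> Nh; apply: H1B => //; exact: Sop_H1. Qed.

Lemma Top_adj g h : (N1 g < +oo)%E -> (N1 h < +oo)%E ->
  dot (Top g) h = dot g (Top h).
Proof. by move=> Ng Nh; rewrite /Top dotBl dotBr Sop_adj. Qed.

Let error_le (x y z : BX) : osc_le x z -> osc_le y z ->
  rnorm (dot (phi x) (phi z) * (dot (phi y) (phi z))^*%C -
    dot (phi x) (phi (xs (io z))) * (dot (phi y) (phi (xs (io z))))^*%C) <=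
  a x z * o y z + (o x z * a z y + o x z * o y z).
Proof.
move=> /(_ _ (ioU z)) ox /(_ _ (ioU z)) oy.
set s := xs (io z) in ox oy *; set G := Gam z s in ox oy *.
have G1 : rnorm G = 1 by exact: Gam1.
rewrite -!dotC.
have -> : dot (phi x) (phi z) * dot (phi z) (phi y) -
    dot (phi x) (phi s) * dot (phi s) (phi y) =
  (Rk x z)^*%C * (Rk y z - G * Rk y s) +
  G * Rk y s * ((Rk x z - G * Rk x s)^*%C).
  have GG : G * G^*%C = 1 by rewrite -sqr_normc rnormE G1 expr1n.
  rewrite /frame_kernel conjcB conjcM -!dotC mulrBr mulrBr.
  have -> : G * dot (phi s) (phi y) * (G^*%C * dot (phi x) (phi s)) =
     (G * G^*%C) * (dot (phi x) (phi s) * dot (phi s) (phi y)) by ring.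
  by rewrite GG mul1r; ring.
rewrite (le_trans (rnormD _ _))//; apply: lerD.
  by rewrite rnormM rnormJ ler_wpM2l ?rnorm_ge0.
rewrite !rnormM G1 mul1r rnormJ -mulrDr mulrC.
apply: ler_pM; rewrite ?rnorm_ge0//.
by rewrite aC; exact: rnorm_phase oy.
Qed.

Let Khat (F : BX -> \bar R) x : \bar R :=
  (kop mu a (kop mu (ktrans o) F) x + (kop mu o (kop mu a F) x +
   kop mu o (kop mu (ktrans o) F) x))%E.

Let comp3 (k l : BX -> BX -> R) x y : \bar R :=
  (\int[mu]_z ((k x z)%:E * (l z y)%:E))%E.

Let nn_comp3 k l x : pos_kernel k -> pos_kernel l -> nn_measurable (comp3 k l x).
Proof.
move=> pk pl.
have nk : nn_measurable (fun z => (k x z)%:E).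
  by apply: nn_EFin; [exact: measurable_section1|exact: pk.2].
have := nn_kop sfmu (pos_ktrans pl) nk; congr nn_measurable.
by apply/funext => y; apply: eq_integral => z _; rewrite muleC.
Qed.

(** With [s] the sample of the cell of [z], factor
    [R(x,z) R(z,y) - R(x,s) R(s,y)] through the phase: one of the two factors is
    always an oscillation, the other one a value of [R] at [z] or at [s]. *)
Lemma Top_kernel : \forall x \ae mu, \forall y \ae mu,
  ((rnorm (dot (Top (phi x)) (phi y)))%:E <=
   comp3 a (ktrans o) x y + (comp3 o a x y + comp3 o (ktrans o) x y))%E.
Proof.
apply: (ae_imp osc_fst) => x oscx; apply: (ae_imp osc_fst) => y oscy.
rewrite /Top dotBl; apply: (le_trans (Sop_error (phi_H1 x) (phi_H1 y))).
have nkl (k l : BX -> BX -> R) : pos_kernel k -> pos_kernel l ->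
    nn_measurable (fun z => (k x z)%:E * (l z y)%:E)%E.
  move=> pk pl; apply: nnM.
    by apply: nn_EFin; [exact: measurable_section1|exact: pk.2].
  apply: nn_EFin; first exact: (measurable_section1 y (pos_ktrans pl)).
  by move=> z; exact: pl.2.
rewrite /comp3 -(integral_nnD3 mu (nkl _ _ pa pos) (nkl _ _ po pa) (nkl _ _ po pos)).
apply: le_nn_integral.
- apply: nn_rnorm; apply: cmeasurableB.
    by apply: cmeasurableM; [|apply: cmeasurable_conj]; exact: cmeasurable_voiceh.
  exact: (cmeasurable_step (fun i => dot (phi x) (phi (xs i)) *
     (dot (phi y) (phi (xs i)))^*%C)).
- by apply: nnD3; exact: nkl.
- apply: (ae_imp2 oscx oscy) => z ox oy.
  by rewrite -!EFinM -!EFinD lee_fin; exact: error_le.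
Qed.

Lemma Top_bound f : represented f -> \forall x \ae mu,
  ((rnorm (f (Top (phi x))))%:E <= Khat (aV phi f) x)%E.
Proof.
move=> rf; have nf := nn_aV rf; apply: (ae_imp Top_kernel) => x kx.
have [_ _ ff] := rf; apply: (le_trans (ff _ (Top_H1 (phi_H1 x)))).
pose nc k l (pk : pos_kernel k) (pl : pos_kernel l) := nnM (nn_comp3 x pk pl) nf.
have n1 := nc _ _ pa pos; have n2 := nc _ _ po pa; have n3 := nc _ _ po pos.
rewrite /Khat -(kop_comp sfmu x pa pos nf) -(kop_comp sfmu x po pa nf).
rewrite -(kop_comp sfmu x po pos nf) -(integral_nnD3 mu n1 n2 n3).
apply: le_nn_integral; [exact: nnM|exact: nnD3|].
apply: (ae_imp kx) => y ky.
rewrite -ge0_muleDl3; [|exact: (nn_comp3 x pa pos).2|exact: (nn_comp3 x po pa).2|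
  exact: (nn_comp3 x po pos).2].
by rewrite muleC; apply: lee_wpmul2r => //; exact: nf.2.
Qed.

Definition rho1 := r * ds + (d * r + d * ds).

Let rho1_ge0 : 0 <= rho1.
Proof. by rewrite !addr_ge0 ?mulr_ge0. Qed.

Lemma Khat_schur F : nn_measurable F ->
  (\int[mu]_x (Khat F x * (nu x)%:E) <= rho1%:E * \int[mu]_x (F x * (nu x)%:E))%E.
Proof.
move=> nF; have nkF k : pos_kernel k -> nn_measurable (kop mu k F) by move=> pk; exact: nn_kop.
have nkl k l : pos_kernel k -> pos_kernel l -> nn_measurable (kop mu k (kop mu l F)).
  by move=> pk pl; apply: nn_kop => //; exact: nn_kop.
set J := (\int[mu]_x (F x * _))%E.
have key k l c c' : pos_kernel k -> pos_kernel l -> 0 <= c -> 0 <= c' ->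
    schur mu nu k c -> schur mu nu l c' ->
    (\int[mu]_x (kop mu k (kop mu l F) x * (nu x)%:E) <= (c * c')%:E * J)%E.
  move=> pk pl c0 c'0 sk sl.
  apply: (le_trans (schur_integral sfmu pk (nkF l pl) nu_weight.1 nu_ge0 c0 sk)).
  rewrite EFinM -muleA; apply: lee_wpmul2l; first by rewrite lee_fin.
  exact: (schur_integral sfmu pl nF nu_weight.1 nu_ge0 c'0 sl).
rewrite (eq_integral (fun x => kop mu a (kop mu (ktrans o) F) x * (nu x)%:E +
   (kop mu o (kop mu a F) x * (nu x)%:E +
    kop mu o (kop mu (ktrans o) F) x * (nu x)%:E))%E); last first.
  move=> x _; apply: ge0_muleDl3; [exact: (nkl _ _ pa pos).2|
    exact: (nkl _ _ po pa).2|exact: (nkl _ _ po pos).2].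
have n1 k l : pos_kernel k -> pos_kernel l ->
    nn_measurable (fun x => kop mu k (kop mu l F) x * (nu x)%:E)%E.
  by move=> pk pl; apply: nnM => //; exact: nkl.
rewrite (integral_nnD3 mu (n1 _ _ pa pos) (n1 _ _ po pa) (n1 _ _ po pos)).
have J0 : (0 <= J)%E by apply: integral_ge0 => x _; exact: (nnM nF nn_nu).2.
rewrite /rho1 !EFinD ge0_muleDl3 ?lee_fin; try exact: mulr_ge0.
apply: leeD; first exact: (key _ _ _ _ pa pos).
by apply: leeD; [exact: (key _ _ _ _ po pa)|exact: (key _ _ _ _ po pos)].
Qed.

Lemma Top_contraction h : (N1 h < +oo)%E -> (N1 (Top h) <= rho1%:E * N1 h)%E.
Proof.
move=> Nh; apply: le_trans (Khat_schur (nn_aVh h)).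
have nK : nn_measurable (Khat (aVh h)).
  by apply: nnD3; apply: nn_kop => //; exact: nn_kop.
apply: le_nn_integral; [exact: nn_aVnu|exact: nnM|].
apply: (ae_imp (Top_bound (represented_emb h))) => x le.
apply: lee_wpmul2r; first by rewrite lee_fin.
by rewrite /aV /emb Top_adj.
Qed.

(** * Inversion by the Neumann series *)

Hypothesis rho1_lt1 : rho1 < 1.

Let CI : R := (1 - rho1)^-1.

Let CI_ge0 : 0 <= CI.
Proof. by rewrite invr_ge0 subr_ge0 ltW. Qed.

Lemma iter_Top_H1 n h : (N1 h < +oo)%E -> (N1 (iter n Top h) < +oo)%E.
Proof. by move=> Nh; elim: n => //= n IH; exact: Top_H1. Qed.

Lemma iter_Top_N1 n h : (N1 h < +oo)%E ->
  (N1 (iter n Top h) <= (rho1 ^+ n)%:E * N1 h)%E.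
Proof.
move=> Nh; elim: n => [|n IH] /=; first by rewrite expr0 mul1e.
apply: (le_trans (Top_contraction (iter_Top_H1 n Nh))).
by rewrite exprS EFinM -muleA; apply: lee_wpmul2l; rewrite ?lee_fin.
Qed.

Lemma iter_Top_sum h : (N1 h < +oo)%E ->
  (\esum_(n in [set: nat]) N1 (iter n Top h) <= CI%:E * N1 h)%E.
Proof.
move=> Nh; have N0 : (0 <= N1 h)%E by exact: N1_ge0.
have Nf : N1 h \is a fin_num by rewrite ge0_fin_numE.
apply: (@le_trans _ _ (\esum_(n in [set: nat]) ((fine (N1 h))%:E * (rho1 ^+ n)%:E))%E).
  by apply: le_esum => n _; rewrite fineK// muleC; exact: iter_Top_N1.
rewrite ge0_esumZl; last 2 first.
- by move=> n; rewrite lee_fin exprn_ge0.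
- exact: fine_ge0.
rewrite fineK// muleC; apply: lee_wpmul2r => //.
exact: esum_geometric.
Qed.

Let iter_Top_fin h : (N1 h < +oo)%E ->
  (\esum_(n in [set: nat]) N1 (iter n Top h) < +oo)%E.
Proof.
move=> Nh; apply: le_lt_trans (iter_Top_sum Nh) _.
by rewrite lte_mul_pinfty// lee_fin.
Qed.

Lemma exists_Sinv : exists S : H -> H, forall h, (N1 h < +oo)%E ->
  hsum (fun n => iter n Top h) (S h).
Proof.
suff /choice[S HS] : forall h, exists k, (N1 h < +oo)%E ->
    hsum (fun n => iter n Top h) k by exists S.
move=> h; have [Nh|Nh] := pselect (N1 h < +oo)%E; last by exists 0.
by have [k hk] := hsum_exists (countableP [set: nat]) (iter_Top_fin Nh); exists k.
Qed.

Definition Sinv : H -> H := projT1 (cid exists_Sinv).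

Lemma SinvP h : (N1 h < +oo)%E -> hsum (fun n => iter n Top h) (Sinv h).
Proof. exact: (projT2 (cid exists_Sinv)). Qed.

Lemma Sinv_N1 h : (N1 h < +oo)%E -> (N1 (Sinv h) <= CI%:E * N1 h)%E.
Proof. by move=> Nh; rewrite (le_trans (hsum_N1 (SinvP Nh)))// iter_Top_sum. Qed.

Lemma Sinv_H1 h : (N1 h < +oo)%E -> (N1 (Sinv h) < +oo)%E.
Proof.
move=> Nh; apply: le_lt_trans (Sinv_N1 Nh) _.
by rewrite lte_mul_pinfty// lee_fin.
Qed.

Lemma Sop0 : Sop 0 = 0.
Proof.
have N0 : (N1 0 < +oo)%E by rewrite N10.
have := Sop_linear 1 N0 N0; rewrite !scale1r add0r => /esym/eqP.
by rewrite -subr_eq0 addrK => /eqP.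
Qed.

Lemma SopD g h : (N1 g < +oo)%E -> (N1 h < +oo)%E -> Sop (g + h) = Sop g + Sop h.
Proof. by move=> Ng Nh; have := Sop_linear 1 Ng Nh; rewrite !scale1r. Qed.

Lemma TopB g h : (N1 g < +oo)%E -> (N1 h < +oo)%E -> Top (g - h) = Top g - Top h.
Proof.
move=> Ng Nh; have := Sop_linear (-1) Nh Ng; rewrite !scaleN1r => E.
have -> : g - h = - h + g by exact: addrC.
by rewrite /Top E !opprD !opprK addrACA [RHS]addrC.
Qed.

Lemma Top_sum (J : Type) (s : seq J) (g : J -> H) :
  (forall j, (N1 (g j) < +oo)%E) ->
  Top (\sum_(j <- s) g j) = \sum_(j <- s) Top (g j).
Proof.
move=> gfin; elim: s => [|j s IH]; first by rewrite !big_nil /Top Sop0 subrr.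
have Ns : (N1 (\sum_(j <- s) g j) < +oo)%E by exact: H1_sum.
rewrite !big_cons -IH /Top (SopD (gfin j) Ns); set v := \sum_(j <- s) g j.
by rewrite opprD addrACA.
Qed.

(** Compare [m + 1] with [m] terms of the Neumann series: both tails are small. *)
Lemma Sop_Sinv h : (N1 h < +oo)%E -> Sop (Sinv h) = h.
Proof.
move=> Nh; have NS := Sinv_H1 Nh.
apply/eqP; rewrite -subr_eq0; apply/eqP.
apply: (N1_eq0 dot_norm phi_frame nu_weight CB_gt0 phi_le).
apply/eqP; rewrite eq_le N1_ge0// andbT; apply/lee_addgt0Pr => e e0; rewrite add0e.
have e2 : 0 < e / 2 by rewrite divr_gt0.
have T0 n : (0 <= N1 (iter n Top h))%E by exact: N1_ge0.
have [K0 HK] := esum_tail_small T0 (iter_Top_fin Nh) e2.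
have [m Hm] := seq_bounded (enum_fset K0) id.
pose K n := [fset k in iota 0 n]%fset.
have sumK n (F : nat -> H) : \sum_(k <- K n) F k = \sum_(0 <= k < n) F k.
  apply: perm_big; apply: uniq_perm; [exact: fset_uniq|exact: iota_uniq|].
  by move=> k; rewrite inE/= /index_iota subn0.
have K0K n : (m <= n)%N -> (K0 `<=` K n)%fset.
  move=> mn; apply/fsubsetP => k kK0; rewrite inE/= mem_iota/= add0n.
  exact: leq_trans (Hm k kK0) mn.
pose u n := \sum_(k <- K n) iter k Top h.
have Nu n : (N1 (u n) < +oo)%E by apply: H1_sum => // k; exact: iter_Top_H1.
have uS : u m.+1 = h + Top (u m).
  rewrite /u !sumK big_nat_recl//= Top_sum// => k; exact: iter_Top_H1.
have tail n : (m <= n)%N -> (N1 (Sinv h - u n) <= (e / 2)%:E)%E.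
  by move=> mn; apply: (le_trans (SinvP Nh _)); exact: HK (K0K _ mn).
have -> : Sop (Sinv h) - h = (Sinv h - u m.+1) - Top (Sinv h - u m).
  rewrite TopB// uS; move: (Top (u m)) => w; rewrite /Top; move: (Sinv h) => v.
  by rewrite addrAC -[v - Sop v - w]addrA -opprD subKr opprD addrACA subrr addr0.
apply: (le_trans (N1B phi_frame nu_weight _ _)).
rewrite [e]splitr EFinD; apply: leeD; first exact: tail.
have Nt : (N1 (Sinv h - u m) < +oo)%E by exact: H1B.
apply: (le_trans (Top_contraction Nt)); rewrite -[leRHS]mul1e.
apply: lee_pmul; [by rewrite lee_fin|exact: N1_ge0|by rewrite lee_fin ltW|exact: tail].
Qed.

Lemma Sop_inj g h : (N1 g < +oo)%E -> (N1 h < +oo)%E -> Sop g = Sop h -> g = h.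
Proof.
move=> Ng Nh E; have Nk : (N1 (g - h) < +oo)%E by exact: H1B.
have Tk : Top (g - h) = g - h by rewrite TopB// /Top E opprB addrA subrK.
apply/eqP; rewrite -subr_eq0; apply/eqP.
apply: (N1_eq0 dot_norm phi_frame nu_weight CB_gt0 phi_le).
have := Top_contraction Nk; rewrite Tk.
have : (0 <= N1 (g - h))%E by exact: N1_ge0.
case: (N1 (g - h)) Nk => [n| |]// _ n0; rewrite -EFinM lee_fin => le.
have n0' : 0 <= n by rewrite -lee_fin.
apply/eqP; rewrite eqe eq_le n0' andbT.
have : 0 < 1 - rho1 by rewrite subr_gt0.
by move/pmulr_rle0 => <-; rewrite mulrBl mul1r subr_le0.
Qed.

Lemma Sinv_Sop h : (N1 h < +oo)%E -> Sinv (Sop h) = h.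
Proof.
move=> Nh; have NS := Sop_H1 Nh; apply: Sop_inj => //; first exact: Sinv_H1.
exact: Sop_Sinv.
Qed.

Lemma Sinv_linear c g h : (N1 g < +oo)%E -> (N1 h < +oo)%E ->
  Sinv (c *: g + h) = c *: Sinv g + Sinv h.
Proof.
move=> Ng Nh; have NSg := Sinv_H1 Ng; have NSh := Sinv_H1 Nh.
have Ns : (N1 (c *: g + h) < +oo)%E by apply: H1D => //; exact: H1Z.
have NSs : (N1 (c *: Sinv g + Sinv h) < +oo)%E by apply: H1D => //; exact: H1Z.
apply: Sop_inj => //; first exact: Sinv_H1.
by rewrite (Sop_linear _ NSg NSh) (Sop_Sinv Ng) (Sop_Sinv Nh) (Sop_Sinv Ns).
Qed.

Lemma Sinv0 : Sinv 0 = 0.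
Proof.
have N0 : (N1 0 < +oo)%E by rewrite N10.
by rewrite -[X in Sinv X]Sop0 Sinv_Sop.
Qed.

Lemma SinvZ c h : (N1 h < +oo)%E -> Sinv (c *: h) = c *: Sinv h.
Proof.
have N0 : (N1 0 < +oo)%E by rewrite N10.
by move=> Nh; have := Sinv_linear c Nh N0; rewrite Sinv0 !addr0.
Qed.

Lemma Sinv_adj g h : (N1 g < +oo)%E -> (N1 h < +oo)%E ->
  dot (Sinv g) h = dot g (Sinv h).
Proof.
move=> Ng Nh; have NSg := Sinv_H1 Ng; have NSh := Sinv_H1 Nh.
by rewrite -{1}(Sop_Sinv Nh) -(Sop_adj NSg NSh) (Sop_Sinv Ng).
Qed.

(** * The dual family *)

(** This is the coefficient of [phi_i] in [S (S^-1 h)] moved to the other side by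
    symmetry. *)
Definition dual_family i : H := (c_ i)%:C%C *: Sinv (phi (xs i)).

Local Notation psi := dual_family.

Lemma dual_family_H1 i : (N1 (psi i) < +oo)%E.
Proof. by apply: H1Z => //; exact: Sinv_H1. Qed.

Lemma dot_dual h i : (N1 h < +oo)%E ->
  dot h (psi i) = (c_ i)%:C%C * dot (Sinv h) (phi (xs i)).
Proof. by move=> Nh; rewrite dotZr conjc_real (Sinv_adj Nh (phi_H1 _)). Qed.

Lemma hsum_dual h : (N1 h < +oo)%E ->
  hsum (fun i => dot h (psi i) *: phi (xs i)) h.
Proof.
move=> Nh; have -> : (fun i => dot h (psi i) *: phi (xs i)) = Scoef (Sinv h).
  by apply/funext => i; rewrite /Scoef (dot_dual _ Nh).
by have := SopP (Sinv_H1 Nh); rewrite (Sop_Sinv Nh).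
Qed.

Lemma hsum_dual_fin h : (N1 h < +oo)%E ->
  (\esum_(i in [set: I]) N1 (dot h (psi i) *: phi (xs i)) < +oo)%E.
Proof.
move=> Nh; have := Scoef_fin (Sinv_H1 Nh); congr (_ < _)%E.
by apply: eq_esum => i _; rewrite /Scoef (dot_dual _ Nh).
Qed.

Definition bounded_antilinear f M := antilinear f /\
  (forall h, (N1 h < +oo)%E -> ((rnorm (f h))%:E <= M%:E * N1 h)%E).

Lemma antilinear0 f : antilinear f -> f 0 = 0.
Proof.
have N0 : (N1 0 < +oo)%E by rewrite N10.
move=> lf; have := lf 1 _ _ N0 N0; rewrite scaler0 addr0 conjc1 mul1r => /esym/eqP.
by rewrite -subr_eq0 addrK => /eqP.
Qed.

Lemma antilinearZ f c h : antilinear f -> (N1 h < +oo)%E -> f (c *: h) = c^*%C * f h.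
Proof.
have N0 : (N1 0 < +oo)%E by rewrite N10.
by move=> lf Nh; have := lf c _ _ Nh N0; rewrite !addr0 (antilinear0 lf) addr0.
Qed.

Lemma bounded_antilinear_additive f M : bounded_antilinear f M -> bounded_additive f M.
Proof.
move=> [lf bf]; split => // g h Ng Nh.
have := lf (-1) _ _ Nh Ng; rewrite scaleN1r [- h + g]addrC conjcN conjc1 mulN1r => ->.
exact: addrC.
Qed.

(** Apply [f] to [h = sum_i <h, psi_i> phi_i]. *)
Lemma antidual_sum_dual f M h : 0 <= M -> bounded_antilinear f M -> (N1 h < +oo)%E ->
  csum (fun i => f (phi (xs i)) * dot (psi i) h) (f h).
Proof.
move=> M0 bf Nh.
have := hsum_csum M0 (bounded_antilinear_additive bf) (hsum_dual_fin Nh) (hsum_dual Nh).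
apply: eq_csum => i; rewrite (antilinearZ _ bf.1 (phi_H1 _)) -dotC; exact: mulrC.
Qed.

(** Apply [f o S^-1] to the series that defines [S h]. *)
Lemma antidual_sum_sample f M h : 0 <= M -> bounded_antilinear f M -> (N1 h < +oo)%E ->
  csum (fun i => f (psi i) * dot (phi (xs i)) h) (f h).
Proof.
move=> M0 bf Nh; have NSh := Sop_H1 Nh.
have bS : bounded_additive (fun g => f (Sinv g)) (M * CI).
  have [fB fM] := bounded_antilinear_additive bf; split => [g k Ng Nk|g Ng].
    have := Sinv_linear (-1) Nk Ng; rewrite !scaleN1r addrC => ->.
    by rewrite addrC fB//; exact: Sinv_H1.
  apply: (le_trans (fM _ (Sinv_H1 Ng))); rewrite EFinM -muleA.
  by apply: lee_wpmul2l; rewrite ?lee_fin// Sinv_N1.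
have MCI : 0 <= M * CI by rewrite mulr_ge0.
have := hsum_csum MCI bS (Scoef_fin Nh) (SopP Nh); rewrite Sinv_Sop//.
apply: eq_csum => i; rewrite /Scoef (SinvZ _ (phi_H1 _)).
have Np := Sinv_H1 (phi_H1 (xs i)).
rewrite /dual_family (antilinearZ _ bf.1 Np) (antilinearZ _ bf.1 Np).
by rewrite conjcM -dotC mulrAC.
Qed.

(** A finite partial sum of [antidual_sum_sample] is a vector, for which the bound
    is known; the remainder is summable because [f (psi_i)] is at most
    [c_i N1 (phi_i)] up to a constant. *)
Lemma antidual_represented f M : 0 <= M -> bounded_antilinear f M -> represented f.
Proof.
move=> M0 bf; have [lf fM] := bf.
have mf : cmeasurable (voice phi f).
  apply: (csum_measurable cI (b := fun i x => f (phi (xs i)) * dot (psi i) (phi x))).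
    by move=> i; apply: cmeasurableM; [exact: cmeasurable_cst|exact: cmeasurable_voiceh].
  by move=> x; exact: antidual_sum_dual M0 bf (phi_H1 x).
have nf : nn_measurable (aV phi f) by exact: nn_rnorm.
split => // h Nh.
pose b i := f (psi i).
pose J i := (\int[mu]_y (aVh (phi (xs i)) y * aVh h y))%E.
have J0 i : (0 <= J i)%E by apply: integral_ge0 => y _; rewrite mule_ge0 ?(nn_aVh _).2.
have t0 i : (0 <= (rnorm (b i))%:E * J i)%E by rewrite mule_ge0// lee_fin rnorm_ge0.
have bJ : (\esum_(i in [set: I]) ((rnorm (b i))%:E * J i) < +oo)%E.
  apply: (@le_lt_trans _ _ ((M * CI)%:E *
      \esum_(i in [set: I]) ((c_ i)%:E * (N1 (phi (xs i)) * J i)))%E).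
    rewrite -ge0_esumZl; last 2 first.
    - move=> i; apply: mule_ge0; first by rewrite lee_fin cell_ge0.
      by apply: mule_ge0; [exact: N1_ge0|exact: J0].
    - by rewrite mulr_ge0.
    apply: le_esum => i _; rewrite !muleA; apply: lee_wpmul2r => //.
    apply: (le_trans (fM _ (dual_family_H1 i))).
    rewrite /dual_family (N1Z phi_frame nu_weight) rnorm_real ger0_norm ?cell_ge0//.
    rewrite EFinM -!muleA; apply: lee_wpmul2l; first by rewrite lee_fin.
    rewrite muleCA; apply: lee_wpmul2l; first by rewrite lee_fin cell_ge0.
    exact: Sinv_N1.
  rewrite lte_mul_pinfty ?lee_fin ?mulr_ge0//.
  apply: le_lt_trans (cell_sum2 h) _.
  by rewrite lte_mul_pinfty// lee_fin mulr_ge0 ?addr_ge0.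
apply/lee_addgt0Pr => e e0; have e2 : 0 < e / 2 by rewrite divr_gt0.
have [K1 HK1] := antidual_sum_sample M0 bf Nh e2.
have [K2 HK2] := esum_tail_small t0 bJ e2.
pose K := (K1 `|` K2)%fset; pose hK := \sum_(i <- K) b i *: phi (xs i).
have dK u : dot hK u = \sum_(i <- K) b i * dot (phi (xs i)) u.
  by rewrite dot_suml; apply: eq_bigr => i _; rewrite dotZl.
have le1 : rnorm (f h) <= e / 2 + rnorm (dot hK h).
  rewrite (le_trans (rnorm_le_dist _ (dot hK h)))// lerD2r dK.
  by apply: HK1; exact: fsubsetUl.
apply: (@le_trans _ _ ((e / 2)%:E + (rnorm (dot hK h))%:E)%E); first by rewrite -EFinD lee_fin.
rewrite [e in X in (_ <= X)%E]splitr EFinD addeA addeC; apply: leeD => //.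
apply: (le_trans (dot_le_integral _ _)).
have nT : nn_measurable (fun y => \esum_(i in ~` [set` K])
    ((rnorm (b i))%:E * (aVh (phi (xs i)) y * aVh h y)))%E.
  have n1 i : nn_measurable (fun y => (rnorm (b i))%:E *
      (aVh (phi (xs i)) y * aVh h y))%E.
    by apply: nnZ; [exact: rnorm_ge0|exact: nnM].
  split => [|y]; last by apply: esum_ge0 => i _; exact: (n1 i).2.
  by apply: measurable_esum => // [i y|i]; [exact: (n1 i).2|exact: (n1 i).1].
have nfh : nn_measurable (fun y => aV phi f y * aVh h y)%E by exact: nnM.
apply: (@le_trans _ _ (\int[mu]_y (aV phi f y * aVh h y + \esum_(i in ~` [set` K])
    ((rnorm (b i))%:E * (aVh (phi (xs i)) y * aVh h y))))%E).
  apply: le_nn_integral; [exact: nnM|exact: nnD|].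
  apply: aeW => y.
  have hy0 : (0 <= aVh h y)%E by exact: (nn_aVh h).2.
  have s0 i : (0 <= (rnorm (b i))%:E * aVh (phi (xs i)) y)%E.
    by rewrite mule_ge0 ?lee_fin ?rnorm_ge0.
  have -> : (\esum_(i in ~` [set` K])
        ((rnorm (b i))%:E * (aVh (phi (xs i)) y * aVh h y)) =
      aVh h y * \esum_(i in ~` [set` K]) ((rnorm (b i))%:E * aVh (phi (xs i)) y))%E.
    rewrite -(ge0_esumZl _ s0 (rnorm_ge0 (emb dot h (phi y)))).
    by apply: eq_esum => i _; rewrite muleA muleC.
  rewrite [(aV phi f y * _)%E]muleC [(aVh hK y * _)%E]muleC.
  rewrite -ge0_muleDr; [|exact: nf.2|by apply: esum_ge0 => i _; exact: s0].
  apply: lee_wpmul2l => //.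
  have := csum_tail K (antidual_sum_sample M0 bf (phi_H1 y)); rewrite -dK => le2.
  rewrite /aV /emb; apply: (@le_trans _ _ ((rnorm (f (phi y)))%:E +
     (rnorm (f (phi y) - dot hK (phi y)))%:E)%E).
    by rewrite -EFinD lee_fin addrC rdistC rnorm_le_dist.
  apply: leeD => //; apply: (le_trans le2).
  by apply: le_esum => i _; rewrite rnormM EFinM.
rewrite integral_nnD//; apply: leeD => //.
rewrite integral_esum//; last 2 first.
- by move=> i y; rewrite !mule_ge0 ?lee_fin ?rnorm_ge0.
- by move=> i; apply: measurable_funeM; exact: (nnM (nn_aVh _) (nn_aVh h)).1.
apply: le_trans (HK2 K (fsubsetUr _ _)); apply: le_esum => i _.
by rewrite integral_nnZ//; [exact: rnorm_ge0|exact: nnM].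
Qed.

(** * Bounds on the function space *)

Variables (Y : set (BX -> R[i])) (q : (BX -> R[i]) -> R) (CY : R).
Hypotheses (Y_qbf : qbf_space mu Y q CY) (Y_solid : solid mu Y q).
Hypothesis CY_ge1 : 1 <= CY.
Local Notation Ydom := (Ydom mu Y q).
Variables (rY dY dsY : R).
Hypotheses (rY_ge0 : 0 <= rY) (dY_ge0 : 0 <= dY) (dsY_ge0 : 0 <= dsY).
Hypothesis dom_a : forall G e, nn_measurable G -> Ydom G e -> Ydom (kop mu a G) (rY * e).
Hypothesis dom_o : forall G e, nn_measurable G -> Ydom G e -> Ydom (kop mu o G) (dY * e).
Hypothesis dom_os : forall G e, nn_measurable G -> Ydom G e ->
  Ydom (kop mu (ktrans o) G) (dsY * e).

Let CY_ge0 : 0 <= CY. Proof. exact: le_trans CY_ge1. Qed.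

(** * The pairing of Y with the test vectors *)

Lemma parseval_dot g h : (\int[mu]_x (complex.Re (dot g (phi x) * (dot h (phi x))^*%C))%:E =
  (complex.Re (dot g h))%:E)%E.
Proof.
have isq k : mu.-integrable [set: BX] (fun x => (rnorm (dot k (phi x)) ^+ 2)%:E).
  apply/integrableP; split.
    apply/measurable_EFinP; apply: measurable_funX; apply: measurable_rnorm.
    exact: cmeasurable_voiceh.
  apply: (@le_lt_trans _ _ (rnorm k ^+ 2)%:E); last exact: ltry.
  rewrite (phi_frame.2 k) le_eqVlt; apply/orP; left; apply/eqP.
  by apply: eq_integral => x _; rewrite gee0_abs// lee_fin sqr_ge0.
have E : (complex.Re (dot g h)) = (4^-1 * (rnorm (g + h) ^+ 2 - rnorm (g - h) ^+ 2)).
  by rewrite (sqr_rnormD dot_norm) (sqr_rnormB dot_norm); field.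
rewrite E EFinM EFinB !phi_frame.2.
rewrite -integralB_EFin; [|exact: measurableT|exact: isq|exact: isq].
rewrite -integralZl//; last by apply: integrableB.
apply: eq_integral => x _; rewrite -EFinB -EFinM dotDl dotBl; congr (_%:E).
move: (dot g (phi x)) (dot h (phi x)) => p p'.
by rewrite !sqr_rnorm; case: p => pr pi; case: p' => qr qi /=; field.
Qed.

Let fine_le (v : \bar R) : (`|fine v|%:E <= `|v|)%E.
Proof. by case: v => [v| |]//=; rewrite ?normr0 ?leey. Qed.

Let absRe := @ler_absRe R.
Let absIm := @ler_absIm R.

Lemma rnorm_cintegral (g : BX -> R[i]) : cmeasurable g ->
  ((rnorm (cintegral mu g))%:E <= 2%:E * \int[mu]_x (rnorm (g x))%:E)%E.
Proof.
move=> mg; have [mRe mIm] := mg.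
have part (p : R[i] -> R) : measurable_fun [set: BX] (fun x => p (g x)) ->
    (forall z, `|p z| <= rnorm z) ->
    (`|Rintegral mu [set: BX] (fun x => p (g x))|%:E <= \int[mu]_x (rnorm (g x))%:E)%E.
  move=> mp le; apply: (le_trans (fine_le _)).
  have mpE : measurable_fun [set: BX] (fun x => (p (g x))%:E) by exact/measurable_EFinP.
  apply: (le_trans (le_abse_integral mu measurableT mpE)).
  apply: ge0_le_integral => //.
  - exact: measurableT_comp.
  - exact: (nn_rnorm mg).1.
  - by move=> x _; rewrite lee_fin.
have tri (x y : R) : rnorm (Complex x y) <= `|x| + `|y|.
  rewrite rnorm_Re_Im/= -(@ger0_norm _ (`|x| + `|y|)) ?addr_ge0// -sqrtr_sqr.
  apply: ler_wsqrtr; rewrite sqrrD !real_normK ?num_real// lerD2r.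
  by rewrite lerDl mulrn_wge0// mulr_ge0.
apply: (@le_trans _ _ (`|Rintegral mu [set: BX] (fun x => complex.Re (g x))|%:E +
  `|Rintegral mu [set: BX] (fun x => complex.Im (g x))|%:E)%E).
  by rewrite -EFinD lee_fin; exact: tri.
rewrite (_ : 2%:E = 1 + 1)%E; last by rewrite -EFinD.
rewrite ge0_muleDl// mul1e.
by apply: leeD; [exact: (part (@complex.Re R))|exact: (part (@complex.Im R))].
Qed.

Variable ME : R.
Hypothesis ME_ge0 : 0 <= ME.
Hypothesis R_bounded : bounded_on mu Y q Rk.
Hypothesis R_embedding : forall F, Y F -> \forall x \ae mu,
  rnorm (kapply mu Rk F x) <= ME * q (kapply mu Rk F) * nu x.

Let cmeasurable_Rk x : cmeasurable (fun y => Rk x y).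
Proof.
have -> : (fun y => Rk x y) = fun y => (dot (phi x) (phi y))^*%C.
  by apply/funext => y; rewrite -dotC.
by apply: cmeasurable_conj; exact: cmeasurable_voiceh.
Qed.

(** The embedding bounds the image by its own quasi-norm, which the kernel [|R|]
    controls; the factor 2 comes from real and imaginary parts. *)
Lemma R_sup F : Y F -> \forall x \ae mu,
  rnorm (kapply mu Rk F x) <= ME * (2 * (rY * q F)) * nu x.
Proof.
move=> YF; have [_ bY _] := R_bounded; have YR := bY _ YF.
have mF := qbf_measurable Y_qbf YF.
have nF := nn_rnorm mF.
have dR : Ydom (fun x => (rnorm (kapply mu Rk F x))%:E) (2 * (rY * q F)).
  apply: (@Ydom_le _ _ _ _ _ _ (fun x => 2%:E * kop mu a (fun y => (rnorm (F y))%:E) x)%E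
    (2 * (rY * q F))) => //; last first.
    apply: (YdomZ Y_qbf) => //; apply: dom_a => //; exact: (Ydom_abs mu q YF).
  apply: ae_all => x.
  have mRF : cmeasurable (fun y => Rk x y * F y) by exact: cmeasurableM.
  apply: (le_trans (rnorm_cintegral mRF)); apply: lee_wpmul2l => //.
  by rewrite le_eqVlt; apply/orP; left; apply/eqP; apply: eq_integral => y _; rewrite rnormM EFinM.
have [_ qle] := Ydom_solid Y_solid (qbf_measurable Y_qbf YR) dR.
apply: (ae_imp (R_embedding YF)) => x /le_trans; apply.
by apply: ler_wpM2r => //; apply: ler_wpM2l.
Qed.

Hypothesis kmeas_R : kmeasurable Rk.

Let PC := ME * (2 * rY).

Let PC_ge0 : 0 <= PC. Proof. by rewrite !mulr_ge0. Qed.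

Let sgnV h y : R[i] := dot h (phi y) * ((rnorm (dot h (phi y)))^-1)%:C%C.

Let trunc (F : BX -> R[i]) (n : nat) (y : BX) : R :=
  if rnorm (F y) <= n%:R then rnorm (F y) else 0.

Let cmeasurable_sgnV h : cmeasurable (sgnV h).
Proof.
apply: cmeasurableM; first exact: cmeasurable_voiceh.
apply: cmeasurable_real.
apply: measurable_inv_ge0 => [y|]; first exact: rnorm_ge0.
by apply: measurable_rnorm; exact: cmeasurable_voiceh.
Qed.

Let sgnV_conj h y : sgnV h y * (dot h (phi y))^*%C = (rnorm (dot h (phi y)))%:C%C.
Proof.
rewrite /sgnV; set v := dot h (phi y).
have [->|v0] := eqVneq v 0; first by rewrite !mul0r rnorm0.
have vv : v * v^*%C = (rnorm v ^+ 2)%:C%C.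
  rewrite sqr_rnorm; case: v {v0} => x z; apply/eqP; rewrite eq_complex /=.
  by apply/andP; split; apply/eqP; ring.
rewrite mulrAC vv -rmorphM; congr (_%:C%C).
by rewrite expr2 mulfK// rnorm_eq0.
Qed.

Let rnorm_sgnV h y : rnorm (sgnV h y) <= 1.
Proof.
rewrite /sgnV rnormM rnorm_real ger0_norm ?invr_ge0 ?rnorm_ge0//.
set v := dot h (phi y).
have [->|v0] := eqVneq (rnorm v) 0; first by rewrite mul0r.
by rewrite mulfV.
Qed.

Let trunc_ge0 F n y : 0 <= trunc F n y.
Proof. by rewrite /trunc; case: ifP => // _; exact: rnorm_ge0. Qed.

Let trunc_le F n y : trunc F n y <= rnorm (F y).
Proof. by rewrite /trunc; case: ifP => // _; exact: rnorm_ge0. Qed.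

Let trunc_len F n y : trunc F n y <= n%:R.
Proof. by rewrite /trunc; case: ifP. Qed.

Let measurable_trunc F n : cmeasurable F -> measurable_fun [set: BX] (trunc F n).
Proof.
move=> mF; have mr := measurable_rnorm mF.
by apply: measurable_fun_ifT => //; exact: measurable_fun_ler.
Qed.

Lemma Re_cintegral (g : BX -> R[i]) (c : R[i]) : cintegrable mu g ->
  (\int[mu]_y (complex.Re (g y * c))%:E = (complex.Re (cintegral mu g * c))%:E)%E.
Proof.
move=> [[mRe mIm] ig].
have iRe : mu.-integrable [set: BX] (fun y => (complex.Re (g y))%:E).
  apply: le_integrable ig => //; first exact/measurable_EFinP.
  by move=> y _; rewrite /= lee_fin [leRHS]ger0_norm ?rnorm_ge0.
have iIm : mu.-integrable [set: BX] (fun y => (complex.Im (g y))%:E).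
  apply: le_integrable ig => //; first exact/measurable_EFinP.
  by move=> y _; rewrite /= lee_fin [leRHS]ger0_norm ?rnorm_ge0.
rewrite cReM /= EFinB !EFinM /Rintegral !fineK; try exact: integrable_fin_num.
rewrite !(muleC _ (_ c)%:E) -!integralZl// -integralB//; try exact: integrableZl.
apply: eq_integral => y _; rewrite cReM -!EFinM -EFinB.
by rewrite [_ c * _]mulrC [complex.Im c * _]mulrC.
Qed.

(** Let [W] be the truncation times the sign of [Vh].  Then
    [int |W| |Vh| = Re int int W(y) R(x,y) conj(Vh(x))] by Parseval's identity in
    [x], and the inner integral over [y] is the image of [W] under [R], which is
    bounded by [nu].  Truncation makes the double integral absolutely convergent. *)
Lemma pairing_trunc F h n : Y F -> (N1 h < +oo)%E ->
  (\int[mu]_y ((trunc F n y)%:E * aVh h y) <= (PC * q F)%:E * N1 h)%E.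
Proof.
move=> YF Nh; have mF := qbf_measurable Y_qbf YF.
have n0 : 0 <= n%:R :> R by [].
have mt : cmeasurable (fun y => (trunc F n y)%:C%C).
  by apply: cmeasurable_real; exact: measurable_trunc.
pose W y := (trunc F n y)%:C%C * sgnV h y.
have mW : cmeasurable W by exact: (cmeasurableM mt (cmeasurable_sgnV h)).
have Wle y : rnorm (W y) <= trunc F n y.
  rewrite /W rnormM rnorm_real ger0_norm//; exact: ler_piMr.
have [YW qW] : Y W /\ q W <= q F.
  by apply: Y_solid => //; apply: ae_all => y; exact: le_trans (Wle y) (trunc_le _ _ _).
pose Phi (p : BX * BX) := W p.1 * Rk p.2 p.1 * (dot h (phi p.2))^*%C.
have mPhi : cmeasurable Phi.
  apply: cmeasurableM; first apply: cmeasurableM.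
  - by split; [exact: measurableT_comp mW.1 _|exact: measurableT_comp mW.2 _].
  - have sw := @measurable_swap _ _ BX BX.
    by split; [exact: (measurableT_comp kmeas_R.1 sw)|exact: (measurableT_comp kmeas_R.2 sw)].
  - have mV := cmeasurable_conj (cmeasurable_voiceh h).
    by split; [exact: measurableT_comp mV.1 _|exact: measurableT_comp mV.2 _].
have := fubini_pack sfmu (g := fun p => (complex.Re (Phi p))%:E).
have mRP : measurable_fun [set: BX * BX] (fun p => (complex.Re (Phi p))%:E).
  by apply/measurable_EFinP; exact: mPhi.1.
move=> /(_ mRP).
have fin : (\int[mu]_y \int[mu]_x `|(complex.Re (Phi (y, x)))%:E| < +oo)%E.
  have rn : (r%:E * N1 h < +oo)%E by rewrite lte_mul_pinfty.
  apply: (@le_lt_trans _ _ (n%:R%:E * \int[mu]_y (kop mu a (aVh h) y * (nu y)%:E))%E).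
    have nk : nn_measurable (kop mu a (aVh h)) by exact: nn_kop.
    rewrite -integral_nnZ//; last exact: nnM.
    have mA : measurable_fun [set: BX * BX] (fun p => `|(complex.Re (Phi p))%:E|%E).
      exact: measurableT_comp.
    apply: le_nn_integral.
    - split => [|y]; last by apply: integral_ge0 => x _.
      by apply: (measurable_int_snd sfmu mA) => p; exact: abse_ge0.
    - by apply: nnZ => //; exact: nnM.
    apply: ae_all => y; rewrite muleA.
    apply: (@le_trans _ _ (n%:R%:E * kop mu a (aVh h) y)%E); last first.
      rewrite -[leLHS]mule1; apply: lee_wpmul2l.
        by apply: mule_ge0 => //; exact: nk.2.
      by rewrite lee_fin; exact: nu_weight.2.
    rewrite /kop -integral_nnZ//; last exact: nn_kopP.
    apply: le_nn_integral.
    - split => [|x]; last exact: abse_ge0.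
      exact: (measurableT_comp mA (measurable_pair1 y)).
    - by apply: nnZ => //; exact: nn_kopP.
    apply: ae_all => x; rewrite /Phi /= -!EFinM lee_fin.
    apply: (le_trans (absRe _)); rewrite rnormM rnormM rnormJ -mulrA.
    apply: ler_pM; first exact: rnorm_ge0.
    - by rewrite mulr_ge0 ?rnorm_ge0.
    - exact: le_trans (Wle y) (trunc_len _ _ _).
    - by rewrite (aC y x) lexx.
  rewrite lte_mul_pinfty//; apply: le_lt_trans rn.
  exact: (schur_integral sfmu pa (nn_aVh h) nu_weight.1 nu_ge0 r_ge0 schur_a).
move=> /(_ fin) fub.
have lhs y : (\int[mu]_x (complex.Re (Phi (y, x)))%:E = (trunc F n y)%:E * aVh h y)%E.
  rewrite (eq_integral (fun x =>
     (complex.Re (dot (W y *: phi y) (phi x) * (dot h (phi x))^*%C))%:E)); last first.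
    by move=> x _; rewrite dotZl.
  rewrite parseval_dot dotZl -EFinM (dotC (phi y)) /W -mulrA sgnV_conj.
  by rewrite -rmorphM.
rewrite (eq_integral (fun y => (\int[mu]_x (complex.Re (Phi (y, x)))%:E)%E)); last first.
  by move=> y _; rewrite lhs.
rewrite fub.
have c0 : 0 <= PC * q F := mulr_ge0 PC_ge0 (qbf_ge0 Y_qbf YF).
have nR : nn_measurable (fun x => (PC * q F)%:E * (aVh h x * (nu x)%:E))%E.
  exact: nnZ c0 (nn_aVnu h).
have [iW _ _] := R_bounded.
have key : \forall x \ae mu, (`|\int[mu]_y (complex.Re (Phi (y, x)))%:E| <=
    (PC * q F)%:E * (aVh h x * (nu x)%:E))%E.
  apply: (ae_imp2 (iW _ YW) (R_sup YW)) => x ix le.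
  rewrite (eq_integral (fun y => (complex.Re (Rk x y * W y * (dot h (phi x))^*%C))%:E)); last first.
    by move=> y _; rewrite /Phi /= [W y * _]mulrC.
  rewrite (Re_cintegral _ ix) -!EFinM lee_fin.
  apply: (le_trans (absRe _)); rewrite rnormM rnormJ.
  rewrite [leRHS](_ : _ = (PC * q F * nu x) * rnorm (dot h (phi x))); last by rewrite /emb; ring.
  apply: ler_wpM2r; first exact: rnorm_ge0.
  have {}le := le : rnorm (cintegral mu (fun y => Rk x y * W y)) <= _.
  apply: (le_trans le); apply: ler_wpM2r; first exact: nu_ge0.
  rewrite /PC -!mulrA; apply: ler_wpM2l; first exact: ME_ge0.
  apply: ler_wpM2l; first exact: ler0n.
  by apply: ler_wpM2l; [exact: rY_ge0|exact: qW].
rewrite /wnorm -integral_nnZ; [|exact: c0|exact: nn_aVnu].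
have mI : measurable_fun [set: BX] (fun x => \int[mu]_y (complex.Re (Phi (y, x)))%:E)%E.
  exact: (measurable_int_fst_real sfmu mRP).
apply: le_trans (lee_abs _) _; apply: le_trans (le_abse_integral mu measurableT mI) _.
apply: le_nn_integral; [|exact: nR|exact: key].
by split => [|x]; [exact: measurableT_comp|exact: abse_ge0].
Qed.

Lemma pairing F h : Y F -> (N1 h < +oo)%E ->
  (\int[mu]_y ((rnorm (F y))%:E * aVh h y) <= (PC * q F)%:E * N1 h)%E.
Proof.
move=> YF Nh; have mF := qbf_measurable Y_qbf YF.
pose g n y := ((trunc F n y)%:E * aVh h y)%E.
have h0 y : (0 <= aVh h y)%E by exact: (nn_aVh h).2.
have mg n : measurable_fun [set: BX] (g n).
  apply: (nnM _ (nn_aVh h)).1; apply: nn_EFin => //; exact: measurable_trunc.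
have g0 n y : [set: BX] y -> (0 <= g n y)%E.
  by move=> _; rewrite mule_ge0// lee_fin.
have ndt y m n : (m <= n)%N -> trunc F m y <= trunc F n y.
  move=> mn; rewrite {1}/trunc; case: ifP => // le.
  by rewrite /trunc ifT// (le_trans le)// ler_nat.
have nd y : [set: BX] y -> {homo g^~ y : m n / (m <= n)%N >-> (m <= n)%E}.
  by move=> _ m n mn; apply: lee_wpmul2r => //; rewrite lee_fin ndt.
have lim y : limn (g^~ y) = ((rnorm (F y))%:E * aVh h y)%E.
  apply: cvg_lim => //; apply: cvg_near_cst.
  exists (Num.truncn (rnorm (F y))).+1 => // n /= nN.
  have le : rnorm (F y) <= n%:R.
    by apply/ltW/(lt_le_trans (truncnS_gt _)); rewrite ler_nat; exact: nN.
  by rewrite /g /trunc ifT.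
rewrite (eq_integral (fun y => limn (g^~ y))); last by move=> y _; rewrite lim.
have mct := cvg_monotone_convergence (mu := mu) measurableT mg g0 nd.
rewrite -(cvg_lim _ mct)//; apply: lime_le; first by apply/cvg_ex; exists (\int[mu]_x limn (g^~ x))%E.
by apply: nearW => n; exact: pairing_trunc.
Qed.

Lemma pairing_dom G e h : nn_measurable G -> Ydom G e -> (N1 h < +oo)%E ->
  (\int[mu]_y (G y * aVh h y) <= (PC * e)%:E * N1 h)%E.
Proof.
move=> nG [F [YF qF GF]] Nh; have mF := qbf_measurable Y_qbf YF.
apply: (@le_trans _ _ ((PC * q F)%:E * N1 h)%E).
  apply: le_trans (pairing YF Nh); apply: le_nn_integral.
  - exact: nnM.
  - by apply: nnM => //; exact: nn_rnorm.
  by apply: (ae_imp GF) => y le; apply: lee_wpmul2r => //; exact: (nn_aVh h).2.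
apply: lee_wpmul2r; first exact: N1_ge0.
by rewrite lee_fin; apply: ler_wpM2l.
Qed.

(** * The Neumann series on the function space *)

Definition rhoY := CY * (rY * dsY + CY * (dY * rY + dY * dsY)).

Hypothesis rhoY_lt1 : rhoY < 1.

Let rhoY_ge0 : 0 <= rhoY.
Proof.
by apply: mulr_ge0 => //; apply: addr_ge0; [|apply: mulr_ge0 => //; apply: addr_ge0]; exact: mulr_ge0.
Qed.

Let nnk k F : pos_kernel k -> nn_measurable F -> nn_measurable (kop mu k F).
Proof. exact: nn_kop. Qed.

Lemma Khat_dom G e : nn_measurable G -> Ydom G e -> Ydom (Khat G) (rhoY * e).
Proof.
move=> nG dG; have na := nnk pa nG; have ns := nnk pos nG.
have d1 := dom_a ns (dom_os nG dG).
have d2 := dom_o na (dom_a nG dG).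
have d3 := dom_o ns (dom_os nG dG).
apply: (Ydom_le _ _ (YdomD Y_qbf Y_solid CY_ge1 d1 (YdomD Y_qbf Y_solid CY_ge1 d2 d3))).
  by apply: ae_all => x.
by rewrite /rhoY le_eqVlt; apply/orP; left; apply/eqP; ring.
Qed.

Lemma Top_linear c g h : (N1 g < +oo)%E -> (N1 h < +oo)%E ->
  Top (c *: g + h) = c *: Top g + Top h.
Proof.
move=> Ng Nh; rewrite /Top Sop_linear// scalerBr.
by rewrite opprD addrACA.
Qed.

Lemma bounded_antilinear_comp f M (S : H -> H) (c : R) : 0 <= M ->
  (forall h, (N1 h < +oo)%E -> (N1 (S h) < +oo)%E) ->
  (forall h, (N1 h < +oo)%E -> (N1 (S h) <= c%:E * N1 h)%E) ->
  (forall (b : R[i]) g h, (N1 g < +oo)%E -> (N1 h < +oo)%E ->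
    S (b *: g + h) = b *: S g + S h) ->
  bounded_antilinear f M -> bounded_antilinear (fun h => f (S h)) (M * c).
Proof.
move=> M0 SH1 SN1 Sl [lf fM]; split => [b g h Ng Nh|h Nh].
  by rewrite Sl// lf//; exact: SH1.
apply: (le_trans (fM _ (SH1 _ Nh))); rewrite EFinM -muleA.
by apply: lee_wpmul2l => //; exact: SN1.
Qed.

Lemma bounded_antilinear_Sinv f M : 0 <= M -> bounded_antilinear f M ->
  bounded_antilinear (fun h => f (Sinv h)) (M * CI).
Proof.
move=> M0; apply: bounded_antilinear_comp => //.
- exact: Sinv_H1.
- exact: Sinv_N1.
- exact: Sinv_linear.
Qed.

Lemma bounded_antilinear_Top f M : 0 <= M -> bounded_antilinear f M ->
  bounded_antilinear (fun h => f (Top h)) (M * rho1).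
Proof.
move=> M0; apply: bounded_antilinear_comp => //.
- exact: Top_H1.
- exact: Top_contraction.
- exact: Top_linear.
Qed.

Lemma bounded_antilinear_Sop f M : 0 <= M -> bounded_antilinear f M ->
  bounded_antilinear (fun h => f (Sop h)) (M * CS).
Proof.
move=> M0; apply: bounded_antilinear_comp => //.
- exact: Sop_H1.
- exact: Sop_N1.
- exact: Sop_linear.
Qed.

(** The voice transforms of [f o T^k] decay geometrically in [Y] by [Top_bound]. *)
Lemma Sinv_dom : exists2 C : R, 0 <= C & forall f (M e : R), 0 <= M ->
  bounded_antilinear f M -> Ydom (aV phi f) e ->
  Ydom (aV phi (fun h => f (Sinv h))) (C * e).
Proof.
have [C C0 HC] := Ydom_series Y_qbf Y_solid CY_ge1 rhoY_ge0 rhoY_lt1.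
exists C => // f M e M0 bf df.
pose g k := fun h => f (iter k Top h).
have bg k : bounded_antilinear (g k) (M * rho1 ^+ k).
  elim: k => [|k IH]; first by rewrite expr0 mulr1.
  have Mk : 0 <= M * rho1 ^+ k by rewrite mulr_ge0 ?exprn_ge0.
  have := bounded_antilinear_Top Mk IH; rewrite -mulrA -exprSr.
  by congr bounded_antilinear; apply/funext => h; rewrite /g iterSr.
have rg k : represented (g k).
  by apply: antidual_represented (bg k); rewrite mulr_ge0 ?exprn_ge0.
have e0 : 0 <= e := Ydom_ge0 Y_qbf df.
have dg k : Ydom (aV phi (g k)) (rhoY ^+ k * e).
  elim: k => [|k IH]; first by rewrite expr0 mul1r.
  apply: (Ydom_le _ _ (Khat_dom (nn_aV (rg k)) IH)); last by rewrite exprS mulrA.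
  apply: (ae_imp (Top_bound (rg k))) => x.
  by rewrite /aV /g iterSr.
have g0 k x : (0 <= aV phi (g k) x)%E by exact: (nn_aV (rg k)).2.
apply: (Ydom_le _ (lexx _) (HC _ _ e0 g0 dg)).
apply: ae_all => x.
have := hsum_csum M0 (bounded_antilinear_additive bf) (iter_Top_fin (phi_H1 x)) (SinvP (phi_H1 x)).
by move/csum_bound; apply.
Qed.

(** * Step functions of the covering *)

(** The functions that define both sequence spaces, with extended real values so that
    local finiteness does not interfere with interchanging sums and integrals. *)
Definition stepE (w : I -> R) (A : set I) (x : BX) : \bar R :=
  \esum_(i in A) ((w i)%:E * (\1_(U i) x)%:E)%E.

Let muUI i : R := muU mu U i.

Let muUI_gt0 i : 0 < muUI i := muU_gt0 X_hausdorff mu_radon mu_support adm i.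

Let nn_ind (w : I -> R) i : 0 <= w i ->
  nn_measurable (fun x : BX => ((w i)%:E * (\1_(U i) x)%:E)%E).
Proof.
move=> w0; apply: nnZ => //; apply: nn_EFin => [|x]; last by rewrite indicE.
by apply: measurable_indic; exact: adm_measurable.
Qed.

Lemma nn_stepE w A : (forall i, 0 <= w i) -> nn_measurable (stepE w A).
Proof.
move=> w0; split => [|x].
  apply: measurable_esum => //; first by move=> i x; exact: (nn_ind (w0 i)).2.
  by move=> i; exact: (nn_ind (w0 i)).1.
by apply: esum_ge0 => i _; exact: (nn_ind (w0 i)).2.
Qed.

(** [b_i] is at most the mean of [F] over [U_i]. *)
Lemma sample_le_integral (w : I -> R) (A : set I) (b : I -> R) (F : BX -> \bar R) :
  (forall i, 0 <= w i) -> (forall i, 0 <= b i) -> nn_measurable F ->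
  (\forall z \ae mu, forall i, U i z -> ((b i)%:E <= F z)%E) ->
  (\esum_(i in A) ((w i)%:E * (b i)%:E) <=
   \int[mu]_z (stepE (fun i => w i / muUI i)%R A z * F z))%E.
Proof.
move=> w0 b0 nF le.
have w0' i : 0 <= w i / muUI i by rewrite divr_ge0// ltW.
have nt i : nn_measurable (fun z => (w i / muUI i)%:E * (\1_(U i) z)%:E * F z)%E.
  exact: nnM (nn_ind (w := fun i => w i / muUI i) (w0' i)) nF.
apply: (@le_trans _ _ (\int[mu]_z (\esum_(i in A)
    ((w i / muUI i)%:E * (\1_(U i) z)%:E * F z)))%E); last first.
  apply: le_nn_integral.
  - split => [|z]; last by apply: esum_ge0 => i _; exact: (nt i).2.
    by apply: measurable_esum => // [i z|i]; [exact: (nt i).2|exact: (nt i).1].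
  - by apply: nnM => //; exact: nn_stepE.
  apply: ae_all => z; apply: esum_le_bound => [i|J JA]; first exact: (nt i).2.
  have t0 i : (0 <= (w i / muUI i)%:E * (\1_(U i) z)%:E)%E.
    exact: (nn_ind (w := fun i => w i / muUI i) (w0' i)).2.
  rewrite -ge0_sume_distrl => [|i _]; last exact: t0.
  apply: lee_wpmul2r; first exact: nF.2.
  apply: ereal_sup_ubound; exists [set` J] => //.
  by rewrite fsbig_finite//= set_fsetK.
rewrite integral_esum//; last 2 first.
- by move=> i z; exact: (nt i).2.
- by move=> i; exact: (nt i).1.
apply: le_esum => i _.
have wb0 : 0 <= w i / muUI i * b i by rewrite mulr_ge0.
apply: (@le_trans _ _ (\int[mu]_z ((w i / muUI i * b i)%:E * (\1_(U i) z)%:E))%E).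
  have mU : measurable (U i) by exact: adm_measurable.
  rewrite integral_nnZ//; last first.
    apply: nn_EFin => [|z]; [exact: measurable_indic|by rewrite indicE].
  rewrite integral_indic// setIT -(muUE X_hausdorff mu_radon adm i) -!EFinM lee_fin.
  by rewrite mulrAC divfK// gt_eqF.
apply: le_nn_integral; [exact: (nn_ind (w := fun i => w i / muUI i * b i) wb0)|exact: nt|].
apply: (ae_imp le) => z /(_ i) Fz.
rewrite indicE; have [zU|zU] := pselect (U i z); last by rewrite memNset// !mule0 mul0e.
rewrite mem_set// !mule1 EFinM; apply: lee_wpmul2l; first by rewrite lee_fin; exact: w0'.
exact: Fz.
Qed.

Lemma step_overlap : exists2 N : R, 0 <= N & forall (w : I -> R) (G : BX -> \bar R) e,
  (forall i, 0 <= w i) -> (forall z, 0 <= G z)%E ->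
  (\forall z \ae mu, forall i, U i z -> ((w i)%:E <= G z)%E) ->
  Ydom G e -> Ydom (stepE w [set: I]) (N * e).
Proof.
have [N HN] := cover_overlap R adm; exists N%:R => // w G e w0 G0 wG dG.
apply: (Ydom_le _ (lexx _) (YdomZ Y_qbf (ler0n _ N) dG)).
apply: (ae_imp wG) => z wGz; apply: (HN z) => //.
- by move=> i; exact: (nn_ind (w0 i)).2.
- move=> i Ui; rewrite indicE mem_set// mule1; exact: wGz.
- by move=> i nU; rewrite indicE memNset// mule0.
Qed.

(** * Analysis *)

Lemma analysis_sample : exists2 C : R, 0 <= C & forall f e, represented f ->
  Ydom (aV phi f) e -> Ydom (stepE (fun i => rnorm (f (phi (xs i)))) [set: I]) (C * e).
Proof.
have [N N0 HN] := step_overlap.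
exists (N * (CY * (1 + dsY))); first by rewrite !mulr_ge0// addr_ge0.
move=> f e rf df; have nf := nn_aV rf; have dk := dom_os nf df.
have nd : nn_measurable (fun z => aV phi f z + kop mu (ktrans o) (aV phi f) z)%E.
  by apply: nnD => //; exact: nn_kop.
have dd := YdomD Y_qbf Y_solid CY_ge1 df dk.
have -> : N * (CY * (1 + dsY)) * e = N * (CY * (e + dsY * e)) by ring.
apply: HN dd => //.
- by move=> i; exact: rnorm_ge0.
- exact: nd.2.
- by apply: (ae_imp (osc_voice rf)) => z.
Qed.

(** [f (psi_i) = c_i (f o S^-1) (phi_i)] and [c_i <= mu (U_i)]. *)
Lemma analysis_dual : exists2 C : R, 0 <= C & forall f (M e : R), 0 <= M ->
  bounded_antilinear f M -> Ydom (aV phi f) e ->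
  Ydom (stepE (fun i => rnorm (f (psi i)) / muUI i) [set: I]) (C * e).
Proof.
have [C1 C10 HC1] := Sinv_dom; have [C2 C20 HC2] := analysis_sample.
exists (C2 * C1) => [|f M e M0 bf df]; first exact: mulr_ge0.
have bg := bounded_antilinear_Sinv M0 bf.
have rg : represented (fun h => f (Sinv h)).
  by apply: antidual_represented bg; rewrite mulr_ge0.
rewrite -mulrA; apply: (Ydom_le _ (lexx _) (HC2 _ _ rg (HC1 _ _ _ M0 bf df))).
apply: ae_all => x; apply: le_esum => i _; apply: lee_wpmul2r.
  by rewrite lee_fin indicE.
rewrite lee_fin /dual_family (antilinearZ _ bf.1 (Sinv_H1 (phi_H1 _))).
rewrite rnormM conjc_real rnorm_real ger0_norm ?cell_ge0// mulrAC.
apply: ler_piMl; first exact: rnorm_ge0.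
rewrite ler_pdivrMr// mul1r; exact: cell_le.
Qed.

(** * Synthesis *)

(** Weak* convergence of [sum_i lam_i xi_i] to [f]. *)
Definition synthesized (lam : I -> R[i]) (xi : I -> H) f :=
  forall h, (N1 h < +oo)%E -> csum (fun i => lam i * dot (xi i) h) (f h).

Let synth_voice (lam : I -> R[i]) (xi : I -> H) f (J : {fset I}) (x : BX) : \bar R :=
  (rnorm (f (phi x) - \sum_(i <- J) lam i * dot (xi i) (phi x)))%:E.

Let rnormV (lam : I -> R[i]) i : 0 <= rnorm (lam i) / muUI i.
Proof. by rewrite divr_ge0 ?rnorm_ge0// ltW. Qed.

(** The set [J] is removed because convergence in the coorbit is about the remainders. *)
Lemma synthesis_sample_dom lam f (J : {fset I}) e :
  synthesized lam (fun i => phi (xs i)) f ->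
  Ydom (stepE (fun i => rnorm (lam i) / muUI i) (~` [set` J])) e ->
  Ydom (synth_voice lam (fun i => phi (xs i)) f J) (CY * ((rY + dY) * e)).
Proof.
move=> sf de; set E := stepE _ _ in de.
have nE : nn_measurable E by apply: nn_stepE => i.
rewrite mulrDl; apply: (Ydom_le _ (lexx _) (YdomD Y_qbf Y_solid CY_ge1 (dom_a nE de) (dom_o nE de))).
apply: (ae_imp osc_fst) => x ox.
apply: (le_trans (csum_tail J (sf _ (phi_H1 x)))).
have nao : nn_measurable (fun z => (a x z + o x z)%:E).
  by apply: nn_EFin => [|z]; [exact: (measurable_section1 x pao)|exact: pao.2].
apply: (@le_trans _ _ (\esum_(i in ~` [set` J]) ((rnorm (lam i))%:E * (a x (xs i))%:E))%E).
  by apply: le_esum => i _; rewrite rnormM EFinM.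
apply: le_trans (sample_le_integral _ _ _ nao _) _.
- by move=> i; exact: rnorm_ge0.
- by move=> i; exact: rnorm_ge0.
- by apply: (ae_imp ox) => z oz i Ui; rewrite lee_fin; exact: rnorm_phase (oz i Ui).
rewrite -(kopDl mu x pa po nE) le_eqVlt; apply/orP; left; apply/eqP.
by apply: eq_integral => z _; rewrite muleC.
Qed.

(** [|Vh|] is sampled by [osc_voice]; after transposing the oscillation, [pairing_dom]
    bounds the series. *)
Lemma synthesis_sample lam e : Ydom (stepE (fun i => rnorm (lam i) / muUI i) [set: I]) e ->
  exists f (M : R), [/\ 0 <= M, bounded_antilinear f M & synthesized lam (fun i => phi (xs i)) f].
Proof.
move=> de; set E := stepE _ _ in de; have e0 := Ydom_ge0 Y_qbf de.
have nE : nn_measurable E by apply: nn_stepE => i.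
pose M := PC * e + PC * (dY * e).
have M0 : 0 <= M by apply: addr_ge0; apply: mulr_ge0 => //; exact: mulr_ge0.
have bound h : (N1 h < +oo)%E ->
    (\esum_(i in [set: I]) (rnorm (lam i * dot (phi (xs i)) h))%:E <= M%:E * N1 h)%E.
  move=> Nh; have nk := nn_kop sfmu pos (nn_aVh h).
  apply: (@le_trans _ _ (\esum_(i in [set: I]) ((rnorm (lam i))%:E *
      (rnorm (dot h (phi (xs i))))%:E))%E).
    by apply: le_esum => i _; rewrite rnormM EFinM rnorm_dotC.
  apply: le_trans (sample_le_integral _ _ _ (nnD (nn_aVh h) nk) _) _.
  - by move=> i; exact: rnorm_ge0.
  - by move=> i; exact: rnorm_ge0.
  - by apply: (ae_imp (osc_voice (represented_emb h))) => z oz i Ui; exact: oz.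
  rewrite -/E (eq_integral (fun z => E z * aVh h z + E z * kop mu (ktrans o) (aVh h) z)%E); last first.
    by move=> z _; rewrite ge0_muleDr ?(nn_aVh h).2 ?nk.2.
  rewrite integral_nnD; [|exact: nnM|exact: nnM].
  rewrite (kop_swap sfmu pos (nn_aVh h) nE) EFinD ge0_muleDl ?lee_fin ?mulr_ge0//.
  apply: leeD; first exact: pairing_dom.
  by apply: pairing_dom => //; [exact: nn_kop|exact: dom_o].
have /choice[f Hf] : forall h, exists s, (N1 h < +oo)%E ->
    csum (fun i => lam i * dot (phi (xs i)) h) s.
  move=> h; have [Nh|nNh] := pselect (N1 h < +oo)%E; last by exists 0.
  have [|s hs] := @csum_exists R I (fun i => lam i * dot (phi (xs i)) h); last by exists s.
  apply: le_lt_trans (bound h Nh) _; by rewrite lte_mul_pinfty.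
exists f, M; split => //; split => [c g h Ng Nh|h Nh]; last exact: csum_bound (Hf h Nh) (bound h Nh).
have Ns : (N1 (c *: g + h) < +oo)%E by apply: H1D => //; exact: H1Z.
apply: csum_unique (Hf _ Ns) _.
apply: eq_csum (csumD (csumZ c^*%C (Hf g Ng)) (Hf h Nh)) => i.
by rewrite dotDr dotZr mulrDr mulrCA.
Qed.

Lemma bounded_antilinear_subsum f M lam (xi : I -> H) (J : {fset I}) :
  bounded_antilinear f M ->
  bounded_antilinear (fun h => f h - \sum_(i <- J) lam i * dot (xi i) h)
    (M + CB * rnorm (\sum_(i <- J) lam i *: xi i)).
Proof.
move=> [lf fM]; set u := \sum_(i <- J) _.
have E h : \sum_(i <- J) lam i * dot (xi i) h = dot u h.
  by rewrite dot_suml; apply: eq_bigr => i _; rewrite dotZl.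
split => [c g h Ng Nh|h Nh]; rewrite !E.
  rewrite lf// dotDr dotZr; move: (f g) (f h) (dot u g) (dot u h) c^*%C => *; ring.
rewrite EFinD; apply: (@le_trans _ _ ((rnorm (f h))%:E + (rnorm (dot u h))%:E)%E).
  by rewrite -EFinD lee_fin rnormB.
have M0 : (0 <= M%:E * N1 h)%E by apply: le_trans (fM h Nh); rewrite lee_fin rnorm_ge0.
have := dot_N1 dot_norm phi_frame nu_weight CB_gt0 phi_le h u; rewrite rnorm_dotC => du.
have N0 : (0 <= N1 h)%E by exact: N1_ge0.
have Nfin : N1 h \is a fin_num by rewrite ge0_fin_numE.
by rewrite muleDl//; apply: leeD => //; exact: fM.
Qed.

Let rnormc (lam : I -> R[i]) i : rnorm (lam i * (c_ i)%:C%C) / muUI i <= rnorm (lam i).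
Proof.
rewrite rnormM rnorm_real ger0_norm ?cell_ge0// -mulrA.
apply: ler_piMr; first exact: rnorm_ge0.
rewrite ler_pdivrMr// mul1r; exact: cell_le.
Qed.

Let step_cell (lam : I -> R[i]) A e :
  Ydom (stepE (fun i => rnorm (lam i)) A) e ->
  Ydom (stepE (fun i => rnorm (lam i * (c_ i)%:C%C) / muUI i) A) e.
Proof.
apply: Ydom_le (lexx _); apply: ae_all => x; apply: le_esum => i _; apply: lee_wpmul2r.
  by rewrite lee_fin indicE.
rewrite lee_fin; exact: rnormc.
Qed.

Let dot_psi i h : (N1 h < +oo)%E ->
  dot (psi i) h = (c_ i)%:C%C * dot (phi (xs i)) (Sinv h).
Proof. by move=> Nh; rewrite /dual_family dotZl (Sinv_adj (phi_H1 _) Nh). Qed.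

Lemma synthesis_dual lam e : Ydom (stepE (fun i => rnorm (lam i)) [set: I]) e ->
  exists f (M : R), [/\ 0 <= M, bounded_antilinear f M & synthesized lam psi f].
Proof.
move=> /step_cell/synthesis_sample[f [M [M0 bf sf]]].
exists (fun h => f (Sinv h)), (M * CI); split; first exact: mulr_ge0.
  exact: bounded_antilinear_Sinv.
move=> h Nh; apply: eq_csum (sf _ (Sinv_H1 Nh)) => i.
by rewrite (dot_psi _ Nh) mulrA.
Qed.

(** Composed with [S], a series in [psi_i] becomes the series in [phi_i] with
    coefficients multiplied by [c_i]. *)
Lemma synthesis_dual_dom : exists2 C : R, 0 <= C & forall lam f (M : R) (J : {fset I}) (e : R),
  0 <= M -> bounded_antilinear f M -> synthesized lam psi f ->
  Ydom (stepE (fun i => rnorm (lam i)) (~` [set` J])) e ->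
  Ydom (synth_voice lam psi f J) (C * e).
Proof.
have [C C0 HC] := Sinv_dom.
exists (C * (CY * (rY + dY))); first by rewrite !mulr_ge0// addr_ge0.
move=> lam f M J e M0 bf sf /step_cell de.
pose lam' i := lam i * (c_ i)%:C%C.
pose g h := \sum_(i <- J) lam' i * dot (phi (xs i)) h.
pose f' h := f (Sop h) - g h.
have sf' : synthesized lam' (fun i => phi (xs i)) (fun h => f (Sop h)).
  move=> h Nh; apply: eq_csum (sf _ (Sop_H1 Nh)) => i.
  by rewrite (dot_psi _ (Sop_H1 Nh)) Sinv_Sop// mulrA.
have := synthesis_sample_dom sf' de; rewrite -/f' => df'.
have [M' M'0 bf'] : exists2 M' : R, 0 <= M' & bounded_antilinear f' M'.
  exists (M * CS + CB * rnorm (\sum_(i <- J) lam' i *: phi (xs i))).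
    apply: addr_ge0; apply: mulr_ge0; [exact: M0|exact: CS_ge0|exact: ltW|exact: rnorm_ge0].
  exact: bounded_antilinear_subsum (bounded_antilinear_Sop M0 bf).
have := HC f' M' _ M'0 bf' df'; rewrite -!mulrA.
apply: Ydom_le (lexx _); apply: ae_all => x.
rewrite /synth_voice /aV /f' /g (Sop_Sinv (phi_H1 x)) lee_fin.
rewrite le_eqVlt; apply/orP; left; apply/eqP; congr rnorm; congr (_ - _).
by apply: eq_bigr => i _; rewrite (dot_psi _ (phi_H1 x)) mulrA.
Qed.

(** * Translation to quasi-norms *)

Lemma Ynorm_le F e : cmeasurable F ->
  (Ynorm Y q F <= e%:E)%E <-> Ydom (fun x => (rnorm (F x))%:E) e.
Proof.
move=> mF; split => [le|dF].
  have /Ynorm_lty YF : (Ynorm Y q F < +oo)%E by apply: le_lt_trans le _; rewrite ltry.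
  move: le; rewrite (YnormE q YF) lee_fin => le.
  by apply: (Ydom_le _ le (Ydom_abs mu q YF)); apply: ae_all => x.
have [YF qF] := Ydom_solid Y_solid mF dF.
by rewrite (YnormE q YF) lee_fin.
Qed.

Let meets (x : X) : {fset I} := fset_set [set i | U i x].

Let finite_meets (x : X) : finite_set [set i | U i x].
Proof.
have [V nV fV] := adm_locally_finite adm x; apply: sub_finite_set fV => i /= Uix.
by exists x; split => //; exact: nbhs_singleton.
Qed.

Let in_meets x i : (i \in meets x) = (x \in U i).
Proof. by rewrite in_fset_set//; apply/idP/idP; rewrite !inE. Qed.

Lemma stepE_sum w x : (forall i, 0 <= w i) ->
  stepE w [set: I] x = (\sum_(i <- meets x) w i)%:E.
Proof.
move=> w0; rewrite /stepE (esum_split (meets x)) => [|i]; last exact: (nn_ind (w0 i)).2.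
rewrite esum1 ?adde0 => [|i /= /negP]; last first.
  by rewrite in_meets indicE => /negbTE ->; rewrite mule0.
rewrite -sumEFin; apply: eq_big_seq => i.
by rewrite in_meets indicE => ->; rewrite mule1.
Qed.

Let flat_sum (g : I -> R[i]) (x : X) :
  \sum_(i \in [set: I]) (g i * \1_(U i) x) = \sum_(i <- meets x) g i.
Proof.
rewrite -(fsbig_widen [set i | U i x] [set: I]) => [||i [_ /= nU]]//; last first.
  by rewrite indicE memNset// mulr0.
rewrite fsbig_finite//; apply: eq_big_seq => i.
by rewrite in_meets indicE => ->; rewrite mulr1.
Qed.

Lemma flat_funE lam : flat_fun (U : I -> set X) lam =
  fun x => (fine (stepE (fun i => rnorm (lam i)) [set: I] x))%:C%C.
Proof.
apply/funext => x; rewrite stepE_sum => [|i]; last exact: rnorm_ge0.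
rewrite /flat_fun flat_sum rmorph_sum; apply: eq_bigr => i _; exact: rnormE.
Qed.

Lemma natural_funE lam : natural_fun mu (U : I -> set X) lam =
  fun x => (fine (stepE (fun i => rnorm (lam i) / muUI i) [set: I] x))%:C%C.
Proof.
apply/funext => x; rewrite stepE_sum => [|i]; last exact: rnormV.
rewrite /natural_fun flat_sum rmorph_sum; apply: eq_bigr => i _.
by rewrite rnormE rmorphM fmorphV.
Qed.

Lemma Ynorm_step (w : I -> R) e : (forall i, 0 <= w i) ->
  (Ynorm Y q (fun x => (fine (stepE w [set: I] x))%:C%C) <= e%:E)%E <->
  Ydom (stepE w [set: I]) e.
Proof.
move=> w0; have [ms s0] := nn_stepE [set: I] w0.
have ms' : cmeasurable (fun x => (fine (stepE w [set: I] x))%:C%C).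
  apply: cmeasurable_real; apply/measurable_EFinP; congr (measurable_fun _ _): ms.
  by apply/funext => x; rewrite /= stepE_sum.
rewrite (Ynorm_le _ ms'); have -> // : (fun x => (rnorm (fine (stepE w [set: I] x))%:C%C)%:E) =
  stepE w [set: I].
apply/funext => x; rewrite rnorm_real ger0_norm ?fine_ge0// fineK//.
by rewrite stepE_sum.
Qed.

Lemma flat_norm_le lam e : (flat_norm Y q (U : I -> set X) lam <= e%:E)%E <->
  Ydom (stepE (fun i => rnorm (lam i)) [set: I]) e.
Proof. by rewrite /flat_norm flat_funE; apply: Ynorm_step => i; exact: rnorm_ge0. Qed.

Lemma natural_norm_le lam e : (natural_norm mu Y q (U : I -> set X) lam <= e%:E)%E <->
  Ydom (stepE (fun i => rnorm (lam i) / muUI i) [set: I]) e.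
Proof. by rewrite /natural_norm natural_funE; apply: Ynorm_step => i; exact: rnormV. Qed.

Lemma Ynorm_real F : (Ynorm Y q F < +oo)%E -> exists2 e : R, 0 <= e & Ynorm Y q F = e%:E.
Proof. by move=> /Ynorm_lty YF; exists (q F); [exact: (qbf_ge0 Y_qbf)|exact: YnormE]. Qed.

Local Notation AD := (antidual mu dot phi nu).

Lemma antidualP f : AD f <-> exists2 M : R, 0 <= M & bounded_antilinear f M.
Proof.
have H1P h : H1 mu dot phi nu h <-> (N1 h < +oo)%E by exact: H1E.
split => [[lf [M fM]]|[M M0 [lf fM]]].
  exists `|M| => //; split => [c g h Ng Nh|h Nh]; first by apply: lf; apply/H1P.
  apply: le_trans (fM h _) _; first exact/H1P.
  rewrite H1_normE//; apply: lee_wpmul2r; first exact: N1_ge0.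
  by rewrite lee_fin ler_norm.
split => [c g h /H1P Ng /H1P Nh|]; first exact: lf.
by exists M => h /H1P Nh; rewrite H1_normE//; exact: fM.
Qed.

Lemma antidual_emb h : AD (emb dot h).
Proof.
apply/antidualP; exists (CB * rnorm h); first by rewrite mulr_ge0 ?rnorm_ge0// ltW.
split => [c g k _ _|g Ng]; first by rewrite /emb dotDr dotZr.
by rewrite /emb rnorm_dotC; exact: (dot_N1 dot_norm phi_frame nu_weight CB_gt0 phi_le).
Qed.

Lemma Co_norm_le f e : AD f -> (Co_norm Y q phi f <= e%:E)%E <-> Ydom (aV phi f) e.
Proof.
move=> /antidualP[M M0 bf]; have [_ mf _] := antidual_represented M0 bf.
exact: Ynorm_le mf.
Qed.

Lemma voice_antidual f : AD f -> synthesized (fun i => f (phi (xs i))) psi f /\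
  synthesized (fun i => f (psi i)) (fun i => phi (xs i)) f.
Proof.
move=> /antidualP[M M0 bf]; split => h Nh.
  exact: antidual_sum_dual M0 bf Nh.
exact: antidual_sum_sample M0 bf Nh.
Qed.

Let synth_voice0 lam xi f : synth_voice lam xi f fset0 = aV phi f.
Proof. by apply/funext => x; rewrite /synth_voice big_seq_fset0 subr0. Qed.

Let set0T : ~` [set` (fset0 : {fset I})] = [set: I].
Proof. by apply/seteqP; split => // i _ /=; rewrite in_fset0. Qed.

(** The analysis and synthesis statements are the same for [phi_i] and for [psi_i]:
    [xi] is the synthesizing family, [al f] the coefficients of [f] with respect to
    it, and [W (lam i)] the values of the step function whose quasi-norm is [N lam]. *)
Section one_expansion.
Variables (N : (I -> R[i]) -> \bar R) (W : R[i] -> I -> R) (xi : I -> H)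
  (al : (H -> R[i]) -> I -> R[i]).
Hypothesis NE : forall lam, exists F, N lam = Ynorm Y q F.
Hypothesis NW : forall lam (e : R),
  (N lam <= e%:E)%E <-> Ydom (stepE (fun i => W (lam i) i) [set: I]) e.
Hypothesis W0 : forall c i, 0 <= W c i.
Variables (Ca Cs : R).
Hypotheses (Ca0 : 0 <= Ca) (Cs0 : 0 <= Cs).
Hypothesis expansion : forall f, AD f -> synthesized (al f) xi f.
Hypothesis analysis : forall f (e : R), AD f -> Ydom (aV phi f) e ->
  Ydom (stepE (fun i => W (al f i) i) [set: I]) (Ca * e).
Hypothesis synthesis : forall lam e,
  Ydom (stepE (fun i => W (lam i) i) [set: I]) e -> exists2 f, AD f & synthesized lam xi f.
Hypothesis synthesis_dom : forall lam f (J : {fset I}) e, AD f -> synthesized lam xi f ->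
  Ydom (stepE (fun i => W (lam i) i) (~` [set` J])) e ->
  Ydom (synth_voice lam xi f J) (Cs * e).

Let N_real lam : (N lam < +oo)%E -> exists2 e : R, 0 <= e & N lam = e%:E.
Proof. by have [F ->] := NE lam; exact: Ynorm_real. Qed.

Let Co_norm_al f (e : R) : AD f -> (Co_norm Y q phi f <= e%:E)%E -> (N (al f) <= (Ca * e)%:E)%E.
Proof. by move=> Af /(Co_norm_le _ Af) df; apply/NW; exact: analysis. Qed.

Let synth_norm lam f (e : R) : AD f -> synthesized lam xi f -> (N lam <= e%:E)%E ->
  (Co_norm Y q phi f <= (Cs * e)%:E)%E.
Proof.
move=> Af sf /NW dl; apply/(Co_norm_le _ Af).
rewrite -(synth_voice0 lam xi); apply: synthesis_dom => //.
by rewrite set0T.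
Qed.

Let CoP f : Co mu Y dot phi nu f <-> AD f /\ (Co_norm Y q phi f < +oo)%E.
Proof. by split => -[Af] /(Ynorm_lty Y q). Qed.

Lemma Co_iff f : AD f -> (Co mu Y dot phi nu f <-> (N (al f) < +oo)%E).
Proof.
move=> Af; split => [/CoP[_ /Ynorm_real[e e0 fe]]|/N_real[e e0 fe]].
  by apply: le_lt_trans (Co_norm_al Af _) (ltry _); rewrite /Co_norm fe.
apply/CoP; split => //.
by apply: le_lt_trans (synth_norm Af (expansion Af) _) (ltry _); rewrite fe.
Qed.

Lemma Co_norm_equiv :
  norm_equiv (Co mu Y dot phi nu) (Co_norm Y q phi) (fun f => N (al f)).
Proof.
have Ca1 : 0 < Ca + 1 by rewrite ltr_wpDl.
exists (Ca + 1)^-1, (Cs + 1); split; [by rewrite invr_gt0|by rewrite ltr_wpDl|].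
move=> f Cf; have [Af /Ynorm_real[e e0 fe]] := (CoP f).1 Cf.
have /N_real[e' e'0 fe'] := (Co_iff Af).1 Cf.
have le1 : e' <= Ca * e by rewrite -lee_fin -fe'; apply: Co_norm_al => //; rewrite /Co_norm fe.
have le2 : e <= Cs * e'.
  by rewrite -lee_fin -fe; apply: synth_norm (expansion Af) _ => //; rewrite fe'.
rewrite fe' /Co_norm fe -!EFinM !lee_fin; split.
  by rewrite ler_pdivrMl//; apply: (le_trans le1); rewrite mulrDl mul1r lerDl.
by apply: (le_trans le2); rewrite mulrDl mul1r lerDl.
Qed.

(** Beyond the support of a nearby finite sequence the coefficients agree with those
    of the difference, and the remainder is bounded by [synthesis_dom]. *)
Lemma synthesized_converges lam f : AD f -> synthesized lam xi f -> (N lam < +oo)%E ->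
  sum_converges mu Y q dot phi nu N lam xi f.
Proof.
move=> Af sf Nl; have FF := @totally_filter I; split => [h /H1E-/(_ phi_frame nu_weight) Nh|dense].
  apply/cvgrPdist_le => e e0; have [K0 HK] := sf h Nh e e0.
  exists K0 => // K /= /HK; rewrite sub0r normrN ger0_norm ?rnorm_ge0//.
have small (e : R) : 0 < e -> exists K0 : {fset I}, forall K : {fset I}, (K0 `<=` K)%fset ->
    (Co_norm Y q phi (fun h => f h - \sum_(i <- K) lam i * dot (xi i) h)%R <= e%:E)%E.
  move=> e0; have C1 : 0 < Cs + 1 by rewrite ltr_wpDl.
  have e1 : 0 < e / (Cs + 1) by rewrite divr_gt0.
  have [lam' flam' /ltW Nll] := dense lam Nl _ e1.
  exists (fset_set [set i | lam' i != 0]) => K K0K.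
  have A' : AD (fun h => f h - \sum_(i <- K) lam i * dot (xi i) h).
    move/antidualP : Af => [M M0 bf]; apply/antidualP.
    exists (M + CB * rnorm (\sum_(i <- K) lam i *: xi i)).
      by apply: addr_ge0 => //; apply: mulr_ge0; [exact: ltW|exact: rnorm_ge0].
    exact: bounded_antilinear_subsum.
  apply/(Co_norm_le _ A').
  move/NW : Nll => dll.
  have dK : Ydom (stepE (fun i => W (lam i) i) (~` [set` K])) (e / (Cs + 1)).
    apply: (Ydom_le _ (lexx _) dll); apply: ae_all => x.
    pose w i := W (lam i - lam' i) i.
    apply: (@le_trans _ _ (stepE w (~` [set` K]) x)); last first.
      by apply: le_esum_set => // i; exact: (nn_ind (W0 _ i)).2.
    apply: le_esum => i /= /negP iK; rewrite /w.
    have -> : lam' i = 0; last by rewrite subr0.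
    apply/eqP; apply: contraNT iK => l0; apply: (fsubsetP K0K).
    by rewrite in_fset_set// inE.
  apply: (Ydom_le _ _ (synthesis_dom Af sf dK)); first exact: ae_all.
  rewrite mulrCA; apply: ler_piMr; first exact: ltW.
  by rewrite ler_pdivrMr// mul1r lerDl.
apply/fine_cvgP; split.
  have [K0 HK] := small 1 ltr01; exists K0 => // K /= /HK le.
  by have [t t0 E] := Ynorm_real (le_lt_trans le (ltry _)); rewrite /Co_norm E.
apply/cvgrPdist_le => e e0; have [K0 HK] := small e e0; exists K0 => // K /= /HK le.
have [t t0] := Ynorm_real (le_lt_trans le (ltry _)); rewrite /Co_norm in le *.
by move=> E; rewrite E/= sub0r normrN ger0_norm// -lee_fin -E.
Qed.

Lemma Co_synthesis : exists2 c : R, 0 < c & forall lam, (N lam < +oo)%E ->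
  exists f, [/\ Co mu Y dot phi nu f, sum_converges mu Y q dot phi nu N lam xi f
    & (Co_norm Y q phi f <= c%:E * N lam)%E].
Proof.
exists (Cs + 1); first by rewrite ltr_wpDl.
move=> lam Nl; have [e e0 le] := N_real Nl.
have [|f Af sf] := synthesis (lam := lam) (e := e); first by apply/NW; rewrite le.
have fe : (Co_norm Y q phi f <= (Cs * e)%:E)%E by apply: synth_norm sf _ => //; rewrite le.
exists f; split.
- by apply/CoP; split => //; exact: le_lt_trans fe (ltry _).
- exact: synthesized_converges.
- by rewrite le -EFinM; apply: (le_trans fe); rewrite lee_fin mulrDl mul1r lerDl.
Qed.

Lemma Co_reconstruction f : Co mu Y dot phi nu f ->
  sum_converges mu Y q dot phi nu N (al f) xi f.
Proof.
move=> Cf; have [Af _] := Cf; apply: synthesized_converges => //; first exact: expansion.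
exact/Co_iff.
Qed.

End one_expansion.

Hypothesis Y_rich : rich Y.

Let synthesis_dual_AD : exists2 C : R, 0 <= C & forall lam f (J : {fset I}) e, AD f ->
  synthesized lam psi f -> Ydom (stepE (fun i => rnorm (lam i)) (~` [set` J])) e ->
  Ydom (synth_voice lam psi f J) (C * e).
Proof.
have [C C0 HC] := synthesis_dual_dom; exists C => // lam f J e /antidualP[M M0 bf].
exact: (HC lam f M J e M0 bf).
Qed.

(** Synthesize [psi_i] from the sequence supported at [i]; its step function is
    dominated by the indicator of the compact closure of [U_i]. *)
Lemma dual_family_Co i : Co mu Y dot phi nu (emb dot (psi i)).
Proof.
have Ap := antidual_emb (psi i).
have [C C0 HC] := synthesis_dual_AD.
pose lam j : R[i] := (j == i)%:R.
have sp : synthesized lam psi (emb dot (psi i)).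
  move=> h Nh e e0; exists [fset i]%fset => K /fsubsetP/(_ i); rewrite in_fset1 eqxx => /(_ isT) iK.
  rewrite (big_fsetD1 i iK)/= /lam eqxx mul1r big_seq big1 ?addr0 ?subrr ?rnorm0 ?ltW//.
  by move=> j; rewrite !inE => /andP[/negbTE -> _]; rewrite mul0r.
have Yc : Y (\1_(closure (U i : set X)) : BX -> R[i]).
  by apply: Y_rich; exact: (adm_relatively_compact adm).
have dl : Ydom (stepE (fun j => rnorm (lam j)) [set: I]) (q (\1_(closure (U i : set X)) : BX -> R[i])).
  apply: (Ydom_le _ (lexx _) (Ydom_abs mu q Yc)); apply: ae_all => x.
  have w0 j : 0 <= rnorm (lam j) by exact: rnorm_ge0.
  rewrite /stepE (esum_split [fset i]%fset) => [|j]; last exact: (nn_ind (w := fun j => rnorm (lam j)) (w0 j)).2.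
  rewrite big_seq_fset1 esum1 ?adde0 => [|j /= /negP]; last first.
    by rewrite in_fset1 /lam => /negbTE ->; rewrite rnorm0 mul0e.
  rewrite /lam eqxx rnorm1 mul1e lee_fin !indicE.
  have [Ux|nU] := pselect (U i x); last by rewrite memNset// rnorm_ge0.
  by rewrite !mem_set// ?rnorm1//; exact: subset_closure.
have := HC lam _ fset0 _ Ap sp; rewrite set0T synth_voice0 => /(_ _ dl) dp.
split => //; apply/(Ynorm_lty Y q); apply: le_lt_trans (ltry _).
by apply/(Co_norm_le _ Ap); exact: dp.
Qed.

(** The expansion of the section above is used with the pairs
    ([flat_norm], [psi]) and ([natural_norm], [phi_i]). *)
Lemma discretization : exists psi : I -> H,
  [/\ forall i, H1 mu dot phi nu (psi i) /\ Co mu Y dot phi nu (emb dot (psi i)),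
      [/\ forall f, AD f ->
            (Co mu Y dot phi nu f <-> Yflat Y q (U : I -> set X) (fun i => f (phi (xs i)))),
          forall f, AD f ->
            (Co mu Y dot phi nu f <-> Ynatural mu Y q (U : I -> set X) (fun i => f (psi i))),
          norm_equiv (Co mu Y dot phi nu) (Co_norm Y q phi)
            (fun f => flat_norm Y q (U : I -> set X) (fun i => f (phi (xs i))))
        & norm_equiv (Co mu Y dot phi nu) (Co_norm Y q phi)
            (fun f => natural_norm mu Y q (U : I -> set X) (fun i => f (psi i)))],
      (exists2 c : R, 0 < c &
         forall lam, Ynatural mu Y q (U : I -> set X) lam ->
         exists f, [/\ Co mu Y dot phi nu f,
           sum_converges mu Y q dot phi nu (natural_norm mu Y q (U : I -> set X))
             lam (fun i => phi (xs i)) f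
           & (Co_norm Y q phi f <= c%:E * natural_norm mu Y q (U : I -> set X) lam)%E]) /\
      (exists2 c : R, 0 < c &
         forall lam, Yflat Y q (U : I -> set X) lam ->
         exists f, [/\ Co mu Y dot phi nu f,
           sum_converges mu Y q dot phi nu (flat_norm Y q (U : I -> set X)) lam psi f
           & (Co_norm Y q phi f <= c%:E * flat_norm Y q (U : I -> set X) lam)%E])
    & forall f, Co mu Y dot phi nu f ->
        sum_converges mu Y q dot phi nu (natural_norm mu Y q (U : I -> set X))
          (fun i => f (psi i)) (fun i => phi (xs i)) f /\
        sum_converges mu Y q dot phi nu (flat_norm Y q (U : I -> set X))
          (fun i => f (phi (xs i))) psi f].
Proof.
have [C1 C10 A1] := analysis_sample; have [C2 C20 A2] := analysis_dual.
have [C3 C30 S3] := synthesis_dual_AD.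
have rep f : AD f -> represented f.
  by move=> /antidualP[M M0 bf]; exact: antidual_represented bf.
have C40 : 0 <= CY * (rY + dY) by rewrite mulr_ge0// addr_ge0.
pose Nf := flat_norm Y q (U : I -> set X).
pose Nn := natural_norm mu Y q (U : I -> set X).
have NfE lam : exists F, Nf lam = Ynorm Y q F by eexists.
have NnE lam : exists F, Nn lam = Ynorm Y q F by eexists.
pose Wf (c : R[i]) (i : I) : R := rnorm c.
pose Wn (c : R[i]) (i : I) : R := rnorm c / muUI i.
have Wf0 c i : 0 <= Wf c i by exact: rnorm_ge0.
have Wn0 c i : 0 <= Wn c i by exact: rnormV (fun=> c) i.
have exf f : AD f -> synthesized (fun i => f (phi (xs i))) psi f by move=> /voice_antidual[].
have exn f : AD f -> synthesized (fun i => f (psi i)) (fun i => phi (xs i)) f.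
  by move=> /voice_antidual[].
have anf f (e : R) : AD f -> Ydom (aV phi f) e ->
    Ydom (stepE (fun i => Wf (f (phi (xs i))) i) [set: I]) (C1 * e).
  by move=> /rep; exact: A1.
have ann f (e : R) : AD f -> Ydom (aV phi f) e ->
    Ydom (stepE (fun i => Wn (f (psi i)) i) [set: I]) (C2 * e).
  by move=> /antidualP[M M0 bf]; exact: A2 M0 bf.
have syf lam e : Ydom (stepE (fun i => Wf (lam i) i) [set: I]) e ->
    exists2 f, AD f & synthesized lam psi f.
  move=> /synthesis_dual[f [M [M0 bf sf]]]; exists f => //.
  by apply/antidualP; exists M.
have syn lam e : Ydom (stepE (fun i => Wn (lam i) i) [set: I]) e ->
    exists2 f, AD f & synthesized lam (fun i => phi (xs i)) f.
  move=> /synthesis_sample[f [M [M0 bf sf]]]; exists f => //.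
  by apply/antidualP; exists M.
have sdn lam f (J : {fset I}) e : AD f -> synthesized lam (fun i => phi (xs i)) f ->
    Ydom (stepE (fun i => Wn (lam i) i) (~` [set` J])) e ->
    Ydom (synth_voice lam (fun i => phi (xs i)) f J) (CY * (rY + dY) * e).
  by move=> _ sf /(synthesis_sample_dom sf); rewrite mulrA.
exists psi; split.
- by move=> i; split; [apply/H1E => //; exact: dual_family_H1|exact: dual_family_Co].
- split.
  + exact: (Co_iff (al := fun f i => f (phi (xs i))) NfE flat_norm_le exf anf S3).
  + exact: (Co_iff (al := fun f i => f (psi i)) NnE natural_norm_le exn ann sdn).
  + exact: (Co_norm_equiv (al := fun f i => f (phi (xs i))) NfE flat_norm_le C10 C30 exf anf S3).
  + exact: (Co_norm_equiv (al := fun f i => f (psi i)) NnE natural_norm_le C20 C40 exn ann sdn).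
- split.
  + exact: (Co_synthesis NnE natural_norm_le Wn0 C40 syn sdn).
  + exact: (Co_synthesis NfE flat_norm_le Wf0 C30 syf S3).
- move=> f Cf; split.
  + exact: (Co_reconstruction (al := fun f i => f (psi i)) NnE natural_norm_le Wn0 C40 exn ann sdn Cf).
  + exact: (Co_reconstruction (al := fun f i => f (phi (xs i))) NfE flat_norm_le Wf0 C30 exf anf S3 Cf).
Qed.

End discretized_frame.

(** * The hypotheses of the discretization theorem *)

Section kernel_estimates.
Context (R : realType) (X : ptopologicalType).
Variable mu : {measure set (borel X) -> \bar R}.
Local Notation BX := (borel X).
Hypothesis sfmu : sigma_finite [set: BX] mu.
Variable nu : BX -> R.
Hypothesis nu_weight : weight nu.
Variables (Y : set (BX -> R[i])) (q : (BX -> R[i]) -> R) (CY : R).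
Hypotheses (Y_qbf : qbf_space mu Y q CY) (Y_solid : solid mu Y q).

Let nu_gt0 x : 0 < nu x. Proof. exact: weight_gt0. Qed.

Lemma mweight_gt0 x y : 0 < mweight nu x y.
Proof. by rewrite lt_max divr_gt0. Qed.

Lemma measurable_mweight :
  measurable_fun [set: BX * BX] (fun p => mweight nu p.1 p.2).
Proof.
have m1 : measurable_fun [set: BX * BX] (fun p => nu p.1).
  exact: measurableT_comp nu_weight.1 _.
have m2 : measurable_fun [set: BX * BX] (fun p => nu p.2).
  exact: measurableT_comp nu_weight.1 _.
apply: measurable_maxr; apply: measurable_funM => //; apply: measurable_inv_ge0 => // p; exact/ltW.
Qed.

Lemma kmeasurable_unweight K : kmeasurable (kweighted nu K) -> kmeasurable K.
Proof.
move=> mK; have mi : cmeasurable (fun p : BX * BX => ((mweight nu p.1 p.2)^-1)%:C%C).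
  apply: cmeasurable_real; apply: measurable_inv_ge0 => [p|]; first exact/ltW/mweight_gt0.
  exact: measurable_mweight.
have := cmeasurableM mK mi; congr cmeasurable; apply/funext => p.
by rewrite /kweighted -mulrA -rmorphM mulfV ?mulr1// gt_eqF// mweight_gt0.
Qed.

Lemma BYm_norm_ge0 K : bounded_on mu Y q K -> (0 <= BYm_norm mu Y q nu K)%E.
Proof.
move=> [_ bY _]; rewrite le_max; apply/orP; right.
have Y0 := qbf_0 Y_qbf; have YK := bY _ Y0.
apply: (@le_trans _ _ (Ynorm Y q (kapply mu K (fun=> 0)))).
  by rewrite (YnormE q YK) lee_fin (qbf_ge0 Y_qbf).
apply: ereal_sup_ubound; exists (fun=> 0) => //; split => //.
by rewrite (q_0 Y_qbf).
Qed.

Lemma BYm_norm_lty K : BYm mu Y q nu K -> (BYm_norm mu Y q nu K < +oo)%E.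
Proof. by move=> [[_ AK] [_ _ oK]]; rewrite gt_max AK. Qed.

Variable k : BX -> BX -> R.
Local Notation kC := (fun x y => (k x y)%:C%C).
Hypotheses (k0 : forall x y, 0 <= k x y) (kB : BYm mu Y q nu kC).
Variable c : R.
Hypothesis kc : (BYm_norm mu Y q nu kC <= c%:E)%E.

Lemma kernel_pos : pos_kernel k.
Proof. by split => //; exact: (kmeasurable_unweight kB.1.1).1. Qed.

Lemma kernel_bound_ge0 : 0 <= c.
Proof. by rewrite -lee_fin; apply: le_trans kc; exact: (BYm_norm_ge0 kB.2). Qed.

(** [nu (x) <= m (x, y) nu (y)]. *)
Lemma kernel_schur : schur mu nu k c.
Proof.
have := ess_sup_ge mu (fun y : BX => \int[mu]_x (rnorm (kweighted nu kC x y))%:E)%E.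
move/ae_imp; apply => y le.
have mk := (kernel_pos).1.
have pm : pos_kernel (fun y x => k x y * mweight nu x y).
  apply: (pos_ktrans (k := fun x y => k x y * mweight nu x y)); split => [|x z].
    by apply: measurable_funM => //; exact: measurable_mweight.
  by rewrite mulr_ge0// ltW// mweight_gt0.
have nm : nn_measurable (fun x => (k x y * mweight nu x y)%:E).
  by apply: nn_EFin => [|x]; [exact: (measurable_section1 y pm)|exact: pm.2].
have {}le : (\int[mu]_x (k x y * mweight nu x y)%:E <= c%:E)%E.
  apply: le_trans kc; rewrite /BYm_norm le_max; apply/orP; left.
  rewrite /Am_norm /A1_norm le_max; apply/orP; right; apply: le_trans le.
  rewrite le_eqVlt; apply/orP; left; apply/eqP; apply: eq_integral => x _.
  rewrite /kweighted -rmorphM rnorm_real ger0_norm//.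
  by rewrite mulr_ge0// ltW// mweight_gt0.
apply: (@le_trans _ _ ((nu y)%:E * \int[mu]_x (k x y * mweight nu x y)%:E)%E); last first.
  by rewrite muleC; apply: lee_wpmul2r => //; rewrite lee_fin ltW.
rewrite -integral_nnZ//; last exact: ltW.
apply: le_nn_integral.
- apply: (nn_kopP y (pos_ktrans kernel_pos)); exact: nn_weight.
- by apply: nnZ => //; exact: ltW.
apply: ae_all => x; rewrite -!EFinM lee_fin /ktrans mulrCA; apply: ler_wpM2l => //.
by rewrite mulrC -ler_pdivrMr// le_max lexx.
Qed.

Lemma kernel_dom G e : nn_measurable G -> Ydom mu Y q G e -> Ydom mu Y q (kop mu k G) (c * e).
Proof.
apply: (Ydom_kop sfmu Y_qbf Y_solid kernel_pos kernel_bound_ge0 kB.2).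
by apply: le_trans kc; rewrite /BYm_norm le_max lexx orbT.
Qed.

End kernel_estimates.

(** Apply the quasi-triangle inequality to [F + F] for a nonzero [F]. *)
Lemma qbf_constant_ge1 (R : realType) (X : ptopologicalType)
    (mu : {measure set (borel X) -> \bar R})
    (Y : set (borel X -> R[i])) (q : (borel X -> R[i]) -> R) (CY : R)
    (K : set X) (O : set (borel X)) :
  qbf_space mu Y q CY -> rich Y -> compact K -> measurable O -> O `<=` K ->
  (0 < mu O)%E -> 1 <= CY.
Proof.
move=> Y_qbf Y_rich cK mO OK O0; pose F : borel X -> R[i] := \1_K.
have YF : Y F by exact: Y_rich.
have qF : 0 < q F.
  rewrite lt_neqAle (qbf_ge0 Y_qbf YF) andbT; apply/negP => /eqP/esym q0.
  have [N [mN N0 NF]] := qbf_eq0 Y_qbf YF q0.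
  have : (mu O <= mu N)%E.
    apply: le_measure; rewrite ?inE// => x Ox; apply: NF => /= /eqP.
    by rewrite /F indicE mem_set ?oner_eq0//; exact: OK.
  by rewrite N0 leNgt O0.
have := qbf_triangle Y_qbf YF YF.
have -> : (fun x => F x + F x) = fun x => (2%:R)%:C%C * F x.
  by apply/funext => x; rewrite rmorphMn mulr_natl.
rewrite (qbf_homog Y_qbf _ YF) rnorm_real normr_nat.
have -> : CY * (q F + q F) = CY * (2 * q F) by ring.
by rewrite -[leLHS]mul1r ler_pM2r// mulr_gt0.
Qed.

Lemma common_bound (R : realType) (b b' : \bar R) (delta : R) :
  (0 <= b)%E -> (b < delta%:E)%E -> (b' < delta%:E)%E ->
  exists D : R, [/\ 0 <= D, D < delta, (b <= D%:E)%E & (b' <= D%:E)%E].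
Proof.
case: b => [b| |]//; rewrite lee_fin lte_fin => b0 bd.
case: b' => [b'| |]//; last by exists b; split; rewrite ?lexx ?leNye.
rewrite lte_fin => bd'; exists (Num.max b b'); split.
- by rewrite le_max b0.
- by rewrite gt_max bd.
- by rewrite lee_fin le_max lexx.
- by rewrite lee_fin le_max lexx orbT.
Qed.

(** [rhoY = D ((1 + C) b + D C) C] increases with [D], and [D < delta] makes the
    bound strict. *)
Lemma contraction_constants (R : realType) (b D delta C : R) :
  0 <= b -> 0 <= D -> D < delta -> 1 <= C ->
  delta * ((1 + C) * b + delta * C) * C <= 1 ->
  rho1 b D D < 1 /\ rhoY C b D D < 1.
Proof.
move=> b0 D0 Dd C1 small.
have C0 : 0 <= C by exact: le_trans C1.
have d0 : 0 < delta by exact: le_lt_trans Dd.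
have rhoY1 : rhoY C b D D < 1.
  apply: lt_le_trans small.
  have -> : rhoY C b D D = D * ((1 + C) * b + D * C) * C by rewrite /rhoY; ring.
  have Cp : 0 < C by exact: lt_le_trans C1.
  rewrite ltr_pM2r//; apply: (@le_lt_trans _ _ (D * ((1 + C) * b + delta * C))).
    by apply: ler_wpM2l => //; rewrite lerD2l; apply: ler_wpM2r => //; exact: ltW.
  rewrite ltr_pM2r// ltr_wpDl ?mulr_gt0// mulr_ge0// addr_ge0//.
split => //; apply: le_lt_trans rhoY1; rewrite /rho1 /rhoY.
set s := D * b + D * D; have s0 : 0 <= s by rewrite addr_ge0 ?mulr_ge0.
have sC : s <= C * s by apply: ler_peMl.
apply: (@le_trans _ _ (b * D + C * s)); first by rewrite lerD2l.
by apply: ler_peMl => //; rewrite addr_ge0 ?mulr_ge0.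
Qed.

Theorem theorem2p48
  (R : realType)
  (* the Hilbert space *)
  (H : completeNormedModType R[i]) (dot : {dot H for conjC})
  (dot_norm : forall h : H, `|h| ^+ 2 = dot h h)
  (H_separable : separable H)
  (* the measure space *)
  (X : ptopologicalType)
  (X_hausdorff : hausdorff_space X)
  (X_locally_compact : locally_compact [set: X])
  (X_sigma_compact : sigma_compact X)
  (mu : {measure set (borel X) -> \bar R})
  (mu_radon : radon_measure mu) (mu_support : full_support mu)
  (* the frame *)
  (phi : borel X -> H) (phi_frame : parseval_frame mu dot phi)
  (* the weight and the function space *)
  (nu : borel X -> R) (nu_weight : weight nu)
  (Y : set (borel X -> R[i])) (q : (borel X -> R[i]) -> R) (CY : R)
  (Y_qbf : qbf_space mu Y q CY) (Y_solid : solid mu Y q) (Y_rich : rich Y)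
  (* property D for the covering U, and smallness of delta *)
  (I : choiceType) (U : I -> set X) (delta : R) (delta_gt0 : 0 < delta)
  (phi_D : property_D mu Y q dot phi nu U delta)
  (delta_small :
    (delta%:E *
       ((1 + CY)%:E * BYm_norm mu Y q nu (abs_frame_kernel dot phi)
        + (delta * CY)%:E) * CY%:E <= 1)%E)
  (* the sampling points *)
  (x : I -> X) (x_in_U : forall i, U i (x i)) :
  exists psi : I -> H,
  [/\ forall i, H1 mu dot phi nu (psi i) /\
        Co mu Y dot phi nu (emb dot (psi i)),
      (* analysis *)
      [/\ forall f, antidual mu dot phi nu f ->
            (Co mu Y dot phi nu f <-> Yflat Y q U (fun i => f (phi (x i)))),
          forall f, antidual mu dot phi nu f ->
            (Co mu Y dot phi nu f <-> Ynatural mu Y q U (fun i => f (psi i))),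
          norm_equiv (Co mu Y dot phi nu) (Co_norm Y q phi)
            (fun f => flat_norm Y q U (fun i => f (phi (x i))))
        & norm_equiv (Co mu Y dot phi nu) (Co_norm Y q phi)
            (fun f => natural_norm mu Y q U (fun i => f (psi i)))],
      (* synthesis *)
      (exists2 c : R, 0 < c &
         forall lam, Ynatural mu Y q U lam ->
         exists f, [/\ Co mu Y dot phi nu f,
           sum_converges mu Y q dot phi nu (natural_norm mu Y q U)
             lam (fun i => phi (x i)) f
           & (Co_norm Y q phi f <= c%:E * natural_norm mu Y q U lam)%E]) /\
      (exists2 c : R, 0 < c &
         forall lam, Yflat Y q U lam ->
         exists f, [/\ Co mu Y dot phi nu f,
           sum_converges mu Y q dot phi nu (flat_norm Y q U) lam psi f
           & (Co_norm Y q phi f <= c%:E * flat_norm Y q U lam)%E])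
    & (* reconstruction *)
      forall f, Co mu Y dot phi nu f ->
        sum_converges mu Y q dot phi nu (natural_norm mu Y q U)
          (fun i => f (psi i)) (fun i => phi (x i)) f /\
        sum_converges mu Y q dot phi nu (flat_norm Y q U)
          (fun i => f (phi (x i))) psi f].
Proof.
have adm : admissible_covering (U : I -> set X) := D_admissible phi_D.
have sf := radon_sigma_finite X_hausdorff X_sigma_compact mu_radon.
have [F_fr F_bd [F_lp [ME0 F_emb]]] := D_F phi_D.
have [[CB CB0 phi_le] R_Am phi_H1] := F_fr.
have aB := D_abs phi_D; have [Gam osc_prop] := D_osc phi_D.
move: osc_prop => [Gam1 osc_fin oB osB [lt_o lt_os]].
have [io [ioU mio]] := cover_selection X_sigma_compact adm.
pose BX := borel X.
have Qx (z : BX) i : U i z -> Qset U z (x i) by move=> Uz; exists i => //; exact: x_in_U.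
pose o (y z : BX) : R := fine (osc dot phi U Gam y z).
have osc_ge (y z : BX) i : U i z ->
    ((rnorm (frame_kernel dot phi y z - Gam z (x i) * frame_kernel dot phi y (x i)))%:E
      <= osc dot phi U Gam y z)%E.
  by move=> Uz; apply: ereal_sup_ubound; exists (x i) => //; exact: Qx.
have o0 y z : 0 <= o y z.
  rewrite fine_ge0//; apply: le_trans (osc_ge y z _ (ioU z)).
  by rewrite lee_fin rnorm_ge0.
have osc_le (y z : BX) : osc dot phi U Gam y z \is a fin_num -> forall i, U i z ->
    rnorm (frame_kernel dot phi y z - Gam z (x i) * frame_kernel dot phi y (x i)) <= o y z.
  by move=> fin i Uz; rewrite -lee_fin /o fineK//; exact: osc_ge.
pose a (y z : BX) : R := rnorm (frame_kernel dot phi y z).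
have a0 y z : 0 <= a y z by exact: rnorm_ge0.
have aE : abs_frame_kernel dot phi = fun y z => (a y z)%:C%C.
  by apply/funext => y; apply/funext => z; exact: rnormE.
have CY1 : 1 <= CY.
  have Ui := muU_gt0 X_hausdorff mu_radon mu_support adm (io point).
  apply: (qbf_constant_ge1 (K := closure (U (io point))) (O := U (io point)) Y_qbf Y_rich).
  - exact: (adm_relatively_compact adm).
  - exact: (adm_measurable adm).
  - exact: subset_closure.
  - by rewrite -(muUE X_hausdorff mu_radon adm) lte_fin.
set ba := BYm_norm _ _ _ _ _ in delta_small.
have ba0 : (0 <= ba)%E := BYm_norm_ge0 nu Y_qbf aB.2.
have ba_fin : ba \is a fin_num by rewrite ge0_fin_numE//; exact: BYm_norm_lty.
have ba_le : (ba <= (fine ba)%:E)%E by rewrite fineK.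
set bo := BYm_norm _ _ _ _ _ in lt_o; set bos := BYm_norm _ _ _ _ _ in lt_os.
have bo0 : (0 <= bo)%E := BYm_norm_ge0 nu Y_qbf oB.2.
have [D [D0 Dd bo_le bos_le]] := common_bound bo0 lt_o lt_os.
have fba0 : 0 <= fine ba := fine_ge0 ba0.
have small : delta * ((1 + CY) * fine ba + delta * CY) * CY <= 1.
  have scalar (b : \bar R) : b \is a fin_num ->
      (delta%:E * ((1 + CY)%:E * b + (delta * CY)%:E) * CY%:E <= 1)%E ->
      delta * ((1 + CY) * fine b + delta * CY) * CY <= 1 by case: b.
  exact: scalar ba_fin delta_small.
have [rho1_lt rhoY_lt] := contraction_constants fba0 D0 Dd CY1 small.
rewrite aE in aB.
have {}ba_le : (BYm_norm mu Y q nu (fun y z => (a y z)%:C%C) <= (fine ba)%:E)%E.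
  by rewrite -aE.
have pa := kernel_pos nu_weight a0 aB.
have po : pos_kernel o := kernel_pos nu_weight o0 oB.
have os0 y z : 0 <= ktrans o y z by exact: o0.
have osB' : BYm mu Y q nu (fun y z => (ktrans o y z)%:C%C) := osB.
have R_emb F : Y F -> \forall y \ae mu, rnorm (kapply mu (frame_kernel dot phi) F y) <=
    `|ME0| * q (kapply mu (frame_kernel dot phi) F) * nu y.
  move=> YF; set G := kapply _ _ _; have [_ bY _] := F_bd.
  have YG : Y G by exact: bY.
  have le : (ess_sup mu (abse \o (fun y => (rnorm (G y) * (nu y)^-1)%:E)) <= (ME0 * q G)%:E)%E.
    have : [set kapply mu (frame_kernel dot phi) F | F in Y] G by exists F.
    move=> /F_emb; rewrite /Lpw_norm (YnormE q YG) unlock.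
    by rewrite (radon_gt0 mu_support).
  apply: (ae_imp (ess_sup_ge mu _)) => y /le_trans/(_ le).
  have n0 := weight_gt0 nu_weight y.
  have v0 : 0 <= rnorm (G y) * (nu y)^-1 by rewrite mulr_ge0 ?rnorm_ge0 ?invr_ge0 ?(ltW n0).
  rewrite /= lee_fin (ger0_norm v0) => le'; rewrite -ler_pdivrMr//; apply: (le_trans le').
  by apply: ler_wpM2r; [exact: (qbf_ge0 Y_qbf YG)|exact: ler_norm].
have phi_H1' y : (wnorm dot mu phi nu (phi y) < +oo)%E.
  by apply/(H1E phi_frame nu_weight).
apply: (@discretization R H dot dot_norm X mu X_hausdorff X_sigma_compact mu_radon
  mu_support phi nu phi_frame nu_weight CB CB0 phi_le phi_H1' I (U : I -> set BX)
  adm io ioU mio (x : I -> BX) Gam o pa po _ _ _ (fine ba) D D fba0 D0 D0 _ _ _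
  rho1_lt Y q CY Y_qbf Y_solid CY1 (fine ba) D D fba0 D0 D0 _ _ _ `|ME0| (normr_ge0 _)
  F_bd R_emb _ rhoY_lt Y_rich).
- by move=> y z; rewrite /rnorm Gam1.
- apply: (ae_imp (ae_prod_fst sf osc_fin)) => y /ae_imp; apply => z; exact: osc_le.
- apply: (ae_imp (ae_prod_snd sf osc_fin)) => z /ae_imp; apply => y; exact: osc_le.
- exact: (kernel_schur nu_weight a0 aB ba_le).
- exact: (kernel_schur nu_weight o0 oB bo_le).
- exact: (kernel_schur nu_weight os0 osB' bos_le).
- move=> G e nG; exact: (kernel_dom sf nu_weight Y_qbf Y_solid a0 aB ba_le nG).
- move=> G e nG; exact: (kernel_dom sf nu_weight Y_qbf Y_solid o0 oB bo_le nG).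
- move=> G e nG; exact: (kernel_dom sf nu_weight Y_qbf Y_solid os0 osB' bos_le nG).
- exact: (kmeasurable_unweight nu_weight R_Am.1).
Qed.
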